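(* Let $f(z)$ be a transcendental entire function, let $k\ge 1$ be an integer and let $a_1,\ldots,a_k$ be complex constants. If $f(z)^3+a_1f'(z)+\cdots+a_kf^{(k)}(z)$ is a periodic function with period $c$ and $i(f)<\infty$, then $f(z)$ is periodic with period $c$, $2c$ or $3c$.
   Context: For an integer $p\ge 1$, the $p$-iterated order of an entire function $f$ is $\rho_p(f)=\limsup_{r\to\infty}\frac{\log_p T(r,f)}{\log r}$, where $T(r,f)$ is the Nevanlinna characteristic function, $\log_1 r=\log r$ and $\log_p r=\log(\log_{p-1}r)$. The finiteness degree $i(f)$ is defined by $i(f):=0$ if $f$ is a polynomial; $i(f):=\min\{j\in\mathbb{N}:\rho_j(f)<\infty\}$ (with $\mathbb{N}=\{1,2,\ldots\}$) if $f$ is not a polynomial and $\rho_j(f)<\infty$ for some $j\in\mathbb{N}$; and $i(f):=\infty$ otherwise. An entire function $F$ is periodic of period $c$ ($c\in\mathbb{C}\setminus\{0\}$) if $F(z+c)=F(z)$ identically; $c$ need not be a minimal period. *)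

(* Defs.v *)
From mathcomp Require Import all_boot all_order all_algebra.
From mathcomp Require Import complex.
From mathcomp Require Import all_classical all_reals all_analysis.

Set Implicit Arguments.
Unset Strict Implicit.
Unset Printing Implicit Defensive.

Import Order.TTheory GRing.Theory Num.Theory.
Import numFieldNormedType.Exports.
Import ComplexField.Normc.

Local Open Scope classical_set_scope.
Local Open Scope ring_scope.
Local Open Scope complex_scope.

(* [R[i]^o] is [R[i]] as a normed module over itself, so that [derivable] is
   complex differentiability. *)
Definition entire (R : realType) (f : R[i] -> R[i]) : Prop :=
  forall z : R[i], derivable (f : R[i]^o -> R[i]^o) z 1.

Definition is_polynomial (R : realType) (f : R[i] -> R[i]) : Prop :=
  exists q : {poly R[i]}, forall z : R[i], f z = q.[z].

Definition transcendental_entire (R : realType) (f : R[i] -> R[i]) : Prop :=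
  entire f /\ ~ is_polynomial f.

(* [ln x = 0] for [x <= 0], so [log_plus 0 = 0] as usual. *)
Definition log_plus (R : realType) (x : R) : R := Num.max (ln x) 0.

Definition proximity (R : realType) (r : R) (f : R[i] -> R[i]) : R :=
  (2 * pi)^-1 * \int[lebesgue_measure]_(t in `[0, 2 * pi])
    log_plus (normc (f ((r * cos t) +i* (r * sin t)))).

(* The characteristic is the proximity function plus the integrated counting
   function of the poles; functions [R[i] -> R[i]] that are entire have no
   poles, so the second term is absent. *)
Definition nevanlinna_char (R : realType) (r : R) (f : R[i] -> R[i]) : R :=
  proximity r f.

(* The values of [iter p ln] where the iterated logarithm is undefined are
   immaterial: the characteristic of a nonconstant entire function tends to
   infinity, and constants are polynomials. *)
Definition iterated_order (R : realType) (p : nat) (f : R[i] -> R[i]) : \bar R :=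
  limf_esup (fun r : R => (iter p (@ln R) (nevanlinna_char r f) / ln r)%:E)
    (+oo%R : set_system R).

Definition has_finite_order (R : realType) (f : R[i] -> R[i]) : pred nat :=
  fun j => `[< (0 < j)%N /\ (iterated_order j f < +oo)%E >].

Definition finiteness_degree (R : realType) (f : R[i] -> R[i]) : \bar R :=
  if pselect (is_polynomial f) then 0%E
  else if pselect (exists j, has_finite_order f j) is left ex_j
    then (ex_minn ex_j)%:R%:E
  else +oo%E.

(* Main.v *)
(** Write f1, f2 for f(. + c), f(. + 2c), and set h = f1 - f,
    w = f^2 + f f1 + f1^2, w' = w(. + c) = f1^2 + f1 f2 + f2^2.  Periodicity of the
    given expression says w h = - sum a_j h^(j), so w is a combination of
    logarithmic derivatives of h and grows like log |f| only.  With u a primitive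
    cube root of unity put X = u^2 f1 - f2, Y = f2 - u f1, U = f - u f1 and
    V = u^2 f1 - f.  Then X Y = - w', U V = - w and (X - U) (X - V) = w' - w.  If
    none of w, w', w' - w vanishes identically, X, U and X - U divide functions of
    the smaller growth class, so X' Y, U' V and (X - U)' (X - V) lie in it as well,
    and Borel's argument gives linear relations X A = U B, X A2 = V B2 with
    coefficients in that class; as X^2 A A2 = - w B B2, also X, U, V and f
    lie in it.  Iterating, a function of finite iterated order descends
    to a polynomial.  Hence h, w or w' - w is zero, and these cases give the
    periods c, 3c, and 2c or 3c.

    All contour integrals are taken over squares, as differences of primitives
    along horizontal and vertical segments. *)

Require Import Defs.
From mathcomp Require Import all_boot all_order all_algebra.
From mathcomp Require Import complex ring lra.
From mathcomp Require Import all_classical all_reals all_analysis.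

Set Implicit Arguments.
Unset Strict Implicit.
Unset Printing Implicit Defensive.

Import Order.TTheory GRing.Theory Num.Theory.
Import numFieldNormedType.Exports.
Import ComplexField.Normc.

Local Open Scope classical_set_scope.
Local Open Scope ring_scope.
Local Open Scope complex_scope.

(** The finite order of [f] is converted at once into a pointwise bound, and from then on only the
    classes [growth p] occur. Their bounds absorb constants, powers and dilations of [r], so crude
    constants cost nothing, and a bound on one square per scale is a bound everywhere. This is why
    the exceptional sets usual for logarithmic derivatives do not arise. The obstacle is that [h]
    and its derivatives have zeros, near which logarithmic derivatives are unbounded. The number of
    zeros of a function of class [p.+1] in a square is bounded by a function of [r] of class [p], so
    some radius in [r, 2r] stays away from all of them. Dividing the zeros out and taking a
    logarithm of the rest bounds the logarithmic derivative there, one exponential lower, and also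
    bounds the function from below, which is what makes division possible inside a class. A divisor
    X of w' gains a level because X' Y = - (X' / X) w' and X' / X is small on such squares. *)

Local Notation Re := (@complex.Re _).
Local Notation Im := (@complex.Im _).

(** * The modulus of a complex number *)

Section Normc.
Context {R : realType}.
Implicit Types (z w : R[i]).

Lemma normc_ge0 z : 0 <= normc z.
Proof. by case: z => x y; rewrite /normc sqrtr_ge0. Qed.

Lemma normcB z w : normc (z - w) = normc (w - z).
Proof. by rewrite -normcN opprB. Qed.

Lemma normc_triB z w : normc z - normc w <= normc (z - w).
Proof. by rewrite lerBlDr -{1}(subrK w z) le_normcD. Qed.

Lemma normc_gt0 z : (0 < normc z) = (z != 0).
Proof.
rewrite lt_neqAle normc_ge0 andbT eq_sym; congr (~~ _).
by apply/eqP/eqP => [/eq0_normc //|->]; rewrite normc0.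
Qed.

Lemma normcX z n : normc (z ^+ n) = normc z ^+ n.
Proof. by elim: n => [|n IH]; rewrite ?expr0 ?normc1 // !exprS normcM IH. Qed.

Lemma normc_real (x : R) : normc x%:C = `|x|.
Proof. by rewrite /normc /= expr0n /= addr0 sqrtr_sqr. Qed.

Lemma normc_Re z : `|Re z| <= normc z.
Proof.
case: z => x y; rewrite /normc /= -sqrtr_sqr ler_sqrt ?lerDl ?sqr_ge0 //.
by rewrite addr_ge0 ?sqr_ge0.
Qed.

Lemma normc_Im z : `|Im z| <= normc z.
Proof.
case: z => x y; rewrite /normc /= -sqrtr_sqr ler_sqrt ?lerDr ?sqr_ge0 //.
by rewrite addr_ge0 ?sqr_ge0.
Qed.

Lemma normc_leReIm z : normc z <= `|Re z| + `|Im z|.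
Proof.
case: z => x y.
have -> : x +i* y = x%:C + 'i * y%:C by simpc.
rewrite (le_trans (le_normcD _ _)) // normcM !normc_real.
by rewrite /normc /= expr0n expr1n add0r sqrtr1 mul1r; simpc.
Qed.

Lemma sqr_normc_def z : normc z ^+ 2 = Re z ^+ 2 + Im z ^+ 2.
Proof. by case: z => x y; rewrite /normc sqr_sqrtr // addr_ge0 ?sqr_ge0. Qed.

Lemma norm_normc z : `|z| = (normc z)%:C.
Proof. by rewrite normc_def; case: z. Qed.

End Normc.

(** * Complex continuity and differentiability *)

Section ComplexDifferentiability.
Context {R : realType}.
Local Notation C := R[i].
Implicit Types (f g : C -> C) (z w d : C).

(** Estimates are stated with the real-valued [normc], since the norm of [R[i]] takes its values in
    [R[i]]. *)
Definition cont_at f z := forall e : R, 0 < e -> exists2 d : R, 0 < d &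
  forall w, normc (w - z) < d -> normc (f w - f z) < e.

Lemma cont_at_ext f g z : f =1 g -> cont_at f z -> cont_at g z.
Proof. by move=> /funext ->. Qed.

Lemma cont_at_near f g z (r : R) : 0 < r ->
  (forall w, normc (w - z) < r -> f w = g w) -> cont_at f z -> cont_at g z.
Proof.
move=> r0 fg fz e /fz [s s0 Hs].
exists (Num.min r s) => [|w]; first by rewrite lt_min r0.
rewrite lt_min => /andP[wr ws]; rewrite -!fg //; first exact: Hs.
by rewrite subrr normc0.
Qed.

Lemma cont_at_cst (c : C) z : cont_at (fun=> c) z.
Proof. by move=> e e0; exists 1 => // w _; rewrite subrr normc0. Qed.

Lemma cont_at_id z : cont_at id z.
Proof. by move=> e e0; exists e. Qed.

Lemma cont_atN f z : cont_at f z -> cont_at (fun w => - f w) z.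
Proof.
move=> fz e /fz [d d0 H]; exists d => // w /H.
by rewrite -normcN opprD !opprK.
Qed.

Lemma cont_atD f g z : cont_at f z -> cont_at g z ->
  cont_at (fun w => f w + g w) z.
Proof.
move=> fz gz e e0; have e2 : 0 < e / 2 by rewrite divr_gt0.
have [r r0 Hr] := fz _ e2; have [s s0 Hs] := gz _ e2.
exists (Num.min r s) => [|w]; first by rewrite lt_min r0.
rewrite lt_min => /andP[/Hr wr /Hs ws].
have -> : f w + g w - (f z + g z) = (f w - f z) + (g w - g z) by ring.
by rewrite (le_lt_trans (le_normcD _ _)) // (splitr e) ltrD.
Qed.

Lemma cont_atB f g z : cont_at f z -> cont_at g z ->
  cont_at (fun w => f w - g w) z.
Proof. by move=> fz gz; apply: cont_atD => //; apply: cont_atN. Qed.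

Lemma cont_atM f g z : cont_at f z -> cont_at g z ->
  cont_at (fun w => f w * g w) z.
Proof.
move=> fz gz e e0; pose m := 1 + normc (f z) + normc (g z).
have m0 : 0 < m by rewrite !ltr_wpDr ?normc_ge0.
have e1 : 0 < Num.min 1 (e / m) by rewrite lt_min ltr01 divr_gt0.
have [r r0 Hr] := fz _ e1; have [s s0 Hs] := gz _ e1.
exists (Num.min r s) => [|w]; first by rewrite lt_min r0.
rewrite lt_min => /andP[/Hr + /Hs]; rewrite !lt_min.
rewrite !ltr_pdivlMr // => /andP[f1 fm] /andP[g1 gm].
have -> : f w * g w - f z * g z = (f w - f z) * (g w - g z)
    + ((f w - f z) * g z + f z * (g w - g z)) by ring.
apply: le_lt_trans (le_normcD _ _) _.
apply: le_lt_trans (lerD (lexx _) (le_normcD _ _)) _; rewrite !normcM.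
have := normc_ge0 (f w - f z); have := normc_ge0 (g w - g z).
have := normc_ge0 (f z); have := normc_ge0 (g z).
move: fm gm f1 g1; rewrite /m.
set a := normc (f w - f z); set b := normc (g w - g z).
set c := normc (f z); set d := normc (g z) => fm gm f1 g1 d0 c0 b0 a0.
have [ab|ba] := leP a b.
  by apply: le_lt_trans gm; nra.
by apply: le_lt_trans fm; nra.
Qed.

Lemma cont_atV f z : f z != 0 -> cont_at f z -> cont_at (fun w => (f w)^-1) z.
Proof.
rewrite -normc_gt0 => f0 fz e e0.
have h : 0 < Num.min (normc (f z) / 2) (e * normc (f z) ^+ 2 / 2).
  by rewrite lt_min !divr_gt0 // mulr_gt0 // exprn_gt0.
have [d d0 H] := fz _ h; exists d => // w /H; rewrite lt_min => /andP[h1 h2].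
have h3 : normc (f z) / 2 < normc (f w).
  by have := normc_triB (f z) (f w); rewrite normcB; lra.
have fw0 : 0 < normc (f w) by apply: lt_trans h3; rewrite divr_gt0.
have -> : (f w)^-1 - (f z)^-1 = (f z - f w) / (f w * f z).
  by field; rewrite -!normc_gt0 f0 fw0.
rewrite normcM normcV normcM normcB ltr_pdivrMr ?mulr_gt0 //.
apply: lt_le_trans h2 _; rewrite -!mulrA ler_pM2l //.
by rewrite [leRHS]mulrC ler_pM2l // ltW.
Qed.

Lemma cont_at_comp f g z : cont_at f z -> cont_at g (f z) ->
  cont_at (g \o f) z.
Proof. by move=> fz gz e /gz [d /fz [r r0 Hr] Hd]; exists r => // w /Hr /Hd. Qed.

(* Carathéodory's form of [f' z = d]: the slope extends continuously. *)
Definition cdiff f z d := exists p : C -> C,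
  [/\ cont_at p z, p z = d & forall w, f w - f z = p w * (w - z)].

Lemma cdiff_ext f g z d : f =1 g -> cdiff f z d -> cdiff g z d.
Proof. by move=> /funext ->. Qed.

Lemma cdiff_cont f z d : cdiff f z d -> cont_at f z.
Proof.
move=> [p [pz _ fE]].
apply: (@cont_at_ext (fun w => f z + p w * (w - z))).
  by move=> w; rewrite -fE; ring.
apply: cont_atD; first exact: cont_at_cst.
apply: cont_atM => //; apply: cont_atB; [exact: cont_at_id|exact: cont_at_cst].
Qed.

Lemma cdiff_cst (c : C) z : cdiff (fun=> c) z 0.
Proof.
by exists (fun=> 0); split=> [|//|w]; [exact: cont_at_cst|rewrite subrr mul0r].
Qed.

Lemma cdiff_id z : cdiff id z 1.
Proof. by exists (fun=> 1); split=> [|//|w]; [exact: cont_at_cst|rewrite mul1r]. Qed.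

Lemma cdiffD f g z d e : cdiff f z d -> cdiff g z e ->
  cdiff (fun w => f w + g w) z (d + e).
Proof.
move=> [p [pz pd fE]] [q [qz qe gE]]; exists (fun w => p w + q w); split.
- exact: cont_atD.
- by rewrite pd qe.
- by move=> w; rewrite mulrDl -fE -gE; ring.
Qed.

Lemma cdiffN f z d : cdiff f z d -> cdiff (fun w => - f w) z (- d).
Proof.
move=> [p [pz pd fE]]; exists (fun w => - p w); split.
- exact: cont_atN.
- by rewrite pd.
- by move=> w; rewrite mulNr -fE; ring.
Qed.

Lemma cdiffB f g z d e : cdiff f z d -> cdiff g z e ->
  cdiff (fun w => f w - g w) z (d - e).
Proof. by move=> fz gz; apply: cdiffD => //; apply: cdiffN. Qed.

Lemma cdiffM f g z d e : cdiff f z d -> cdiff g z e ->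
  cdiff (fun w => f w * g w) z (d * g z + f z * e).
Proof.
move=> fz gz; have gc := cdiff_cont gz.
move: fz gz => [p [pz pd fE]] [q [qz qe gE]].
exists (fun w => p w * g w + f z * q w); split.
- apply: cont_atD; apply: cont_atM => //; exact: cont_at_cst.
- by rewrite pd qe.
- move=> w; rewrite mulrDl -(mulrA (f z)) -gE.
  by rewrite mulrAC -fE; ring.
Qed.

Lemma cdiffZ (c : C) f z d : cdiff f z d -> cdiff (fun w => c * f w) z (c * d).
Proof.
by move=> /(cdiffM (cdiff_cst c z)); rewrite mul0r add0r.
Qed.

(** Carathéodory's slope is a global function, so away from [z] it is redefined as the difference
    quotient of [g]; near [z] it is still [p]. *)
Lemma cdiff_near f g z d (r : R) : 0 < r ->
  (forall w, normc (w - z) < r -> f w = g w) -> cdiff f z d -> cdiff g z d.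
Proof.
move=> r0 fg [p [pz pd fE]].
have fgz : f z = g z by apply: fg; rewrite subrr normc0.
exists (fun w => if w == z then d else (g w - g z) / (w - z)); split.
- apply: (@cont_at_near p _ _ r) => // w wz.
  case: eqVneq => [-> //|wz0].
  by rewrite -fg // -fgz fE mulfK // subr_eq0.
- by rewrite eqxx.
- move=> w; case: eqVneq => [->|wz0]; first by rewrite !subrr mulr0.
  by rewrite divfK // subr_eq0.
Qed.

Lemma cdiffV f z d : f z != 0 -> cdiff f z d ->
  cdiff (fun w => (f w)^-1) z (- d / f z ^+ 2).
Proof.
move=> f0 fz; have fc := cdiff_cont fz.
move: (fz) => [p [pz pd fE]].
have [r r0 Hr] : exists2 r : R, 0 < r & forall w, normc (w - z) < r -> f w != 0.
  have fz0 : 0 < normc (f z) by rewrite normc_gt0.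
  have [r r0 Hr] := fc _ fz0; exists r => // w /Hr; apply: contraTneq => ->.
  by rewrite sub0r normcN ltxx.
exists (fun w => if w == z then - d / f z ^+ 2 else ((f w)^-1 - (f z)^-1) / (w - z)).
split.
- apply: (@cont_at_near (fun w => - p w * ((f w)^-1 * (f z)^-1)) _ _ r) => //.
    move=> w wz; case: eqVneq => [->|wz0]; first by rewrite pd expr2 invfM.
    have w0 : w - z != 0 by rewrite subr_eq0.
    have -> : p w = (f w - f z) / (w - z) by rewrite fE mulfK.
    have := Hr _ wz => fw; field.
    by rewrite f0 w0 fw.
  apply: cont_atM; first exact: cont_atN.
  apply: cont_atM; [exact: cont_atV|exact: cont_at_cst].
- by rewrite eqxx.
- move=> w; case: eqVneq => [->|wz0]; first by rewrite !subrr mulr0.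
  by rewrite divfK // subr_eq0.
Qed.

Lemma cdiff_comp f g z d e : cdiff f z d -> cdiff g (f z) e ->
  cdiff (g \o f) z (e * d).
Proof.
move=> fz; have fc := cdiff_cont fz.
move: fz => [p [pz pd fE]] [q [qz qe gE]].
exists (fun w => q (f w) * p w); split.
- by apply: cont_atM => //; apply: (@cont_at_comp f q).
- by rewrite pd qe.
- by move=> w /=; rewrite gE fE mulrA.
Qed.

Lemma cdiff_uniq f z d e : cdiff f z d -> cdiff f z e -> d = e.
Proof.
move=> [p [pz pd fE]] [q [qz qe fE']].
apply/eqP; rewrite -subr_eq0; apply: contraT; rewrite -normc_gt0 => de0.
have h0 : 0 < normc (d - e) / 2 by rewrite divr_gt0.
have [r r0 Hr] := pz _ h0; have [s s0 Hs] := qz _ h0.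
(* A real increment below both radii: at [z + t] the two slopes equal the same difference
   quotient. *)
pose t := Num.min r s / 2.
have t0 : 0 < t by rewrite divr_gt0 // lt_min r0.
have tr : t < r.
  by rewrite ltr_pdivrMr // (le_lt_trans (_ : _ <= r)) ?ge_min ?lexx // ltr_pMr // ltr1n.
have ts : t < s.
  by rewrite ltr_pdivrMr // (le_lt_trans (_ : _ <= s)) ?ge_min ?lexx ?orbT // ltr_pMr // ltr1n.
have nt : normc (z + t%:C - z) = t by rewrite addrC addKr normc_real gtr0_norm.
have := Hr (z + t%:C); have := Hs (z + t%:C); rewrite nt => /(_ ts) + /(_ tr).
have -> : p (z + t%:C) = q (z + t%:C).
  apply: (@mulIf _ (z + t%:C - z)); last by rewrite -fE -fE'.
  by rewrite -normc_gt0 nt.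
rewrite pd qe => A B.
have := le_normcD (q (z + t%:C) - e) (d - q (z + t%:C)).
rewrite (normcB d) addrC addrA subrK => AB.
suff : normc (d - e) < normc (d - e) by rewrite ltxx.
by rewrite (le_lt_trans AB) // [ltRHS](splitr (normc (d - e))) ltrD.
Qed.

Lemma cdiffP f z d : cdiff f z d -> forall e : R, 0 < e ->
  exists2 r : R, 0 < r & forall w, normc (w - z) < r ->
    normc (f w - f z - d * (w - z)) <= e * normc (w - z).
Proof.
move=> [p [pz pd fE]] e /pz [r r0 Hr]; exists r => // w /Hr.
rewrite fE -mulrBl -pd normcM => /ltW pe.
by rewrite ler_wpM2r ?normc_ge0.
Qed.

Lemma derivable_cdiff f z : derivable (f : C^o -> C^o) z 1 ->
  cdiff f z (derive1 (f : C^o -> C^o) z).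
Proof.
move=> fz; set d := derive1 _ _.
exists (fun w => if w == z then d else (f w - f z) / (w - z)); split.
- move=> e e0; rewrite eqxx.
  have e0' : (0 : C) < e%:C by rewrite ltcR.
  have : h^-1 *: ((f (h + z) : C^o) - f z) @[h --> (0 : C^o)^'] --> (d : C^o).
    move: fz; rewrite /d derive1E /derivable /derive.
    under eq_fun do rewrite scaler1.
    by [].
  move=> /cvgrPdist_lt /(_ _ e0') /nbhs_ballP [r /= r0 Hr].
  (* Balls of [R[i]] have radii in [R[i]]; a positive one is real. *)
  have [rI rR] : Im r = 0 /\ 0 < Re r.
    by move: r0; rewrite ltcE /= => /andP[/eqP-> ->].
  exists (Re r) => // w wz; case: eqVneq => [_|wz0]; first by rewrite subrr normc0.
  have w0 : w - z != 0 by rewrite subr_eq0.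
  have := Hr (w - z); rewrite /ball /= sub0r normrN !norm_normc.
  rewrite ltcE /= rI eqxx wz w0 subrK => /(_ isT isT).
  by rewrite ltcR normcB mulrC.
- by rewrite eqxx.
- move=> w; case: eqVneq => [->|wz0]; first by rewrite !subrr mulr0.
  by rewrite divfK // subr_eq0.
Qed.

Lemma cdiff_derivable f z d : cdiff f z d ->
  derivable (f : C^o -> C^o) z 1 /\ derive1 (f : C^o -> C^o) z = d.
Proof.
move=> [p [pz pd fE]].
have H : h^-1 *: ((f (h *: 1 + z) : C^o) - f z) @[h --> (0 : C^o)^'] --> (d : C^o).
  apply: (proj2 (@cvgrPdist_lt C C^o C^o _ (dnbhs_filter (0 : C^o)) _ _)) => e e0.
  have [eI eR] : Im e = 0 /\ 0 < Re e.
    by move: e0; rewrite ltcE /= => /andP[/eqP-> ->].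
  have [r r0 Hr] := pz _ eR.
  apply/nbhs_ballP; exists r%:C; first by rewrite /= ltcR.
  move=> h; rewrite /ball /= sub0r normrN !norm_normc ltcR => hr h0.
  rewrite /GRing.scale /= mulr1 fE addrK mulrC mulfK //.
  rewrite ltcE /= eI eqxx /= normcB -pd.
  by apply: Hr; rewrite addrK.
split; first by apply/cvg_ex; exists d.
by rewrite derive1E; apply/cvg_lim.
Qed.

End ComplexDifferentiability.

(** * Mean value inequalities and primitives on the real line *)

Section RealIntegral.
Context {R : realType}.
Implicit Types (f g : R -> R) (a b x t : R).

Lemma is_derive_le f (df : R -> R) a b M : a <= b ->
  (forall t, a <= t <= b -> is_derive t 1 f (df t)) ->
  (forall t, a <= t <= b -> df t <= M) -> f b - f a <= M * (b - a).
Proof.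
move=> ab fd dM; have [||c] := @MVT_segment R f df a b ab.
- by move=> x; rewrite in_itv /= => /andP[/ltW ax /ltW xb]; apply: fd; rewrite ax.
- apply: derivable_within_continuous => x; rewrite in_itv /= => xab.
  by have := fd x xab; case.
- rewrite in_itv /= => cab ->.
  by rewrite ler_wpM2r ?subr_ge0 // dM.
Qed.

Lemma is_derive_ge f (df : R -> R) a b m : a <= b ->
  (forall t, a <= t <= b -> is_derive t 1 f (df t)) ->
  (forall t, a <= t <= b -> m <= df t) -> m * (b - a) <= f b - f a.
Proof.
move=> ab fd dM.
have H := @is_derive_le (fun t => - f t) (fun t => - df t) a b (- m) ab.
suff : - f b - (- f a) <= - m * (b - a) by lra.
apply: H => t tab; last by rewrite lerN2 dM.
by have := fd t tab => ft; apply: is_deriveN.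
Qed.

Lemma continuous_realP f x : {for x, continuous f} <->
  forall e, 0 < e -> exists2 d, 0 < d &
    forall t, `|t - x| < d -> `|f t - f x| < e.
Proof.
split=> [fx e e0|H].
- move/cvgrPdist_lt: fx => /(_ _ e0) /nbhs_ballP [d /= d0 Hd].
  exists d => // t tx; rewrite distrC; apply: Hd.
  by rewrite /ball /= distrC.
- apply/(@cvgrPdist_lt _ _ _ (nbhs x)) => e /H [d d0 Hd].
  apply/nbhs_ballP; exists d => //= t; rewrite /ball /= => tx.
  by rewrite distrC; apply: Hd; rewrite distrC.
Qed.

Lemma is_derive_realP f x df : is_derive x 1 f df <-> forall e, 0 < e ->
  exists2 d, 0 < d & forall t, `|t - x| < d ->
    `|f t - f x - df * (t - x)| <= e * `|t - x|.
Proof.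
split=> [/is_derive1_caratheodory [g [gE /continuous_realP gx gd]] e e0|H].
- have [d d0 Hd] := gx _ e0; exists d => // t /Hd.
  rewrite gE -mulrBl -gd normrM => /ltW h.
  by rewrite ler_wpM2r.
- apply/is_derive1_caratheodory.
  exists (fun t => if t == x then df else (f t - f x) / (t - x)); split.
  + move=> t; case: eqVneq => [->|tx]; first by rewrite !subrr mulr0.
    by rewrite divfK // subr_eq0.
  + apply/continuous_realP => e e0; rewrite eqxx.
    have e2 : 0 < e / 2 by rewrite divr_gt0.
    have [d d0 Hd] := H _ e2; exists d => // t /Hd.
    case: eqVneq => [_ _|tx h]; first by rewrite subrr normr0.
    have tx0 : t - x != 0 by rewrite subr_eq0.
    have tx1 : 0 < `|t - x| by rewrite normr_gt0.
    have -> : (f t - f x) / (t - x) - df = (f t - f x - df * (t - x)) / (t - x).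
      by field.
    rewrite normrM normfV ltr_pdivrMr //; apply: le_lt_trans h _.
    by rewrite ltr_pM2r // ltr_pdivrMr // ltr_pMr // ltr1n.
  + by rewrite eqxx.
Qed.

Lemma continuous_integrable f a b : continuous f ->
  lebesgue_measure.-integrable `[a, b] (EFin \o f).
Proof.
move=> fc; apply: continuous_compact_integrable; first exact: segment_compact.
exact: continuous_subspaceT.
Qed.

(** The candidate is the oriented integral from 0 to [t], split in two because an integral over a
    set has no orientation. The fundamental theorem differentiates an integral with a fixed left
    end, so near each [t] the candidate is rewritten with a left end [a] below 0 and [t], which
    changes it by a constant. *)
Lemma ex_primitive f : continuous f ->
  exists P : R -> R, forall t, is_derive t 1 P (f t).
Proof.
move=> fc; pose mu : measure _ _ := @lebesgue_measure R.
have fi a b := @continuous_integrable f a b fc.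
exists (fun t => \int[mu]_(s in `]0, t]) f s - \int[mu]_(s in `]t, 0]) f s).
move=> t; pose a : R := - `|t| - 1.
have a0 : a < 0 by have := normr_ge0 t; rewrite /a; lra.
have ta : a < t by have := ler_norm (- t); rewrite normrN /a; lra.
have PE : forall s : R, a < s -> \int[mu]_(x in `[a, s]) f x - \int[mu]_(x in `[a, 0]) f x
    = \int[mu]_(x in `]0, s]) f x - \int[mu]_(x in `]s, 0]) f x.
  move=> s sa; have [s0|s0] := leP 0 s.
    rewrite (@Rintegral_itvB _ f (BLeft a) (BRight s) 0) ?bnd_simp // ?ltW //.
    have -> : `]s, 0]%classic = set0 by apply: set_itv_ge; rewrite bnd_simp -leNgt.
    by rewrite Rintegral_set0 subr0.
  have -> : `]0, s]%classic = set0.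
    by apply: set_itv_ge; rewrite bnd_simp -leNgt ltW.
  rewrite Rintegral_set0 sub0r.
  rewrite -(@Rintegral_itvB _ f (BLeft a) (BRight 0) s) ?bnd_simp // ?ltW //.
  by rewrite opprB.
have [] := @continuous_FTC1_closed R f a t (t + 1) _ (fi _ _) ta (fc t).
  by rewrite ltrDl.
set F := (fun x => _) => dF F'.
have FD : is_derive t 1 F (f t).
  by rewrite -F' derive1E; exact: (derivableP dF).
apply/is_derive_realP => e e0.
have [d d0 Hd] := (is_derive_realP _ _ _).1 FD e e0.
exists (Num.min d (t - a)); first by rewrite lt_min d0 subr_gt0.
move=> s; rewrite lt_min => /andP[sd sa].
have as_ : a < s by have := ler_norm (t - s); rewrite distrC; lra.
rewrite -(PE s as_) -(PE t ta) -/(F s) -/(F t) -/(F 0).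
by rewrite [X in `|X - _|](_ : _ = F s - F t) ?Hd //; ring.
Qed.

End RealIntegral.

(** * Integrals along curves in the plane *)

Section Curves.
Context {R : realType}.
Local Notation C := R[i].
Local Notation I := (0 +i* 1 : C).
Implicit Types (p q : R -> C) (a b s t M : R) (F G : C -> C) (z w c d : C).

Definition rcont p t := forall e, 0 < e -> exists2 r, 0 < r &
  forall s, `|s - t| < r -> normc (p s - p t) < e.

Definition rderiv p t d :=
  is_derive t 1 (fun s => Re (p s)) (Re d) /\
  is_derive t 1 (fun s => Im (p s)) (Im d).

Lemma cReB z w : Re (z - w) = Re z - Re w.
Proof. by case: z => ? ?; case: w. Qed.

Lemma cImB z w : Im (z - w) = Im z - Im w.
Proof. by case: z => ? ?; case: w. Qed.

Lemma cReD z w : Re (z + w) = Re z + Re w.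
Proof. by case: z => ? ?; case: w. Qed.

Lemma cImD z w : Im (z + w) = Im z + Im w.
Proof. by case: z => ? ?; case: w. Qed.

Lemma cReM z w : Re (z * w) = Re z * Re w - Im z * Im w.
Proof. by case: z => ? ?; case: w. Qed.

Lemma cImM z w : Im (z * w) = Re z * Im w + Im z * Re w.
Proof. by case: z => x y; case: w => u v /=. Qed.

Lemma ReIm_eq z w : Re z = Re w -> Im z = Im w -> z = w.
Proof. by case: z => ? ?; case: w => ? ? /= -> ->. Qed.

Lemma rcont_Re p : (forall t, rcont p t) -> continuous (fun s => Re (p s)).
Proof.
move=> pc t; apply/continuous_realP => e /(pc t) [r r0 H].
by exists r => // s /H; apply: le_lt_trans; rewrite -cReB normc_Re.
Qed.

Lemma rcont_Im p : (forall t, rcont p t) -> continuous (fun s => Im (p s)).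
Proof.
move=> pc t; apply/continuous_realP => e /(pc t) [r r0 H].
by exists r => // s /H; apply: le_lt_trans; rewrite -cImB normc_Im.
Qed.

Lemma ex_cprimitive p : (forall t, rcont p t) ->
  exists P, forall t, rderiv P t (p t).
Proof.
move=> pc; have [u Hu] := ex_primitive (rcont_Re pc).
have [v Hv] := ex_primitive (rcont_Im pc).
by exists (fun t => u t +i* v t) => t; split; [exact: Hu|exact: Hv].
Qed.

Definition prim p : R -> C := xget (fun=> 0) [set P | forall t, rderiv P t (p t)].

(** Being a difference of values of one chosen primitive, the integral is additive in its bounds and
    changes sign with them by mere algebra, whether or not [p] is continuous. *)
Definition cint p a b : C := prim p b - prim p a.

Lemma primP p : (forall t, rcont p t) -> forall t, rderiv (prim p) t (p t).
Proof.
move=> pc; have [P HP] := ex_cprimitive pc.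
by apply: (@xgetPex _ (fun=> 0) [set P | forall t, rderiv P t (p t)]); exists P.
Qed.

Lemma rderivD p q t c d : rderiv p t c -> rderiv q t d ->
  rderiv (fun s => p s + q s) t (c + d).
Proof.
move=> [pr pi] [qr qi]; split.
- rewrite (_ : (fun s => _) = (fun s => Re (p s)) + (fun s => Re (q s))).
    by rewrite cReD; apply: is_deriveD.
  by apply/funext => s; rewrite cReD.
- rewrite (_ : (fun s => _) = (fun s => Im (p s)) + (fun s => Im (q s))).
    by rewrite cImD; apply: is_deriveD.
  by apply/funext => s; rewrite cImD.
Qed.

Lemma rderivZ (k : C) p t d : rderiv p t d -> rderiv (fun s => k * p s) t (k * d).
Proof.
move=> [pr pi]; split.
- rewrite (_ : (fun s => _) =
    (Re k \*: (fun s => Re (p s))) - (Im k \*: (fun s => Im (p s)))).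
    by rewrite cReM; apply: is_deriveB; apply: is_deriveZ.
  by apply/funext => s; rewrite cReM.
- rewrite (_ : (fun s => _) =
    (Re k \*: (fun s => Im (p s))) + (Im k \*: (fun s => Re (p s)))).
    by rewrite cImM; apply: is_deriveD; apply: is_deriveZ.
  by apply/funext => s; rewrite cImM.
Qed.

(** The real mean value inequality is applied to each coordinate and the two bounds are added; this
    is the origin of the factor 2 that later constants inherit. *)
Lemma rderiv_bound p q a b M : a <= b ->
  (forall t, a <= t <= b -> rderiv p t (q t)) ->
  (forall t, a <= t <= b -> normc (q t) <= M) ->
  normc (p b - p a) <= 2 * M * (b - a).
Proof.
move=> ab pq qM.
have qR t : a <= t <= b -> - M <= Re (q t) <= M.
  by move=> /qM h; rewrite -ler_norml (le_trans (normc_Re _)).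
have qI t : a <= t <= b -> - M <= Im (q t) <= M.
  by move=> /qM h; rewrite -ler_norml (le_trans (normc_Im _)).
have hR : `|Re (p b - p a)| <= M * (b - a).
  rewrite ler_norml cReB -mulNr; apply/andP; split.
    apply: (@is_derive_ge _ (fun s => Re (p s)) (fun s => Re (q s))) => // t.
      by move=> /pq [].
    by move=> /qR /andP[].
  apply: (@is_derive_le _ (fun s => Re (p s)) (fun s => Re (q s))) => // t.
    by move=> /pq [].
  by move=> /qR /andP[].
have hI : `|Im (p b - p a)| <= M * (b - a).
  rewrite ler_norml cImB -mulNr; apply/andP; split.
    apply: (@is_derive_ge _ (fun s => Im (p s)) (fun s => Im (q s))) => // t.
      by move=> /pq [].
    by move=> /qI /andP[].
  apply: (@is_derive_le _ (fun s => Im (p s)) (fun s => Im (q s))) => // t.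
    by move=> /pq [].
  by move=> /qI /andP[].
by apply: le_trans (normc_leReIm _) _; lra.
Qed.

(** The difference of two primitives has derivative 0, so [rderiv_bound] with bound 0 makes it
    constant. *)
Lemma cint_unique p q a b : a <= b -> (forall t, rcont p t) ->
  (forall t, a <= t <= b -> rderiv q t (p t)) -> cint p a b = q b - q a.
Proof.
move=> ab pc qp.
pose r := fun s => prim p s + (-1) * q s.
have H := @rderiv_bound r (fun s => p s + (-1) * p s) a b 0 ab.
have : normc (r b - r a) <= 0.
  apply: le_trans (H _ _) _; last by rewrite mulr0 mul0r.
  - by move=> t tab; apply: rderivD; [exact: primP|apply: rderivZ; exact: qp].
  - by move=> t _; rewrite mulN1r subrr normc0.
rewrite le_eqVlt ltNge normc_ge0 orbF => /eqP /eq0_normc.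
rewrite /r /cint => h; apply/eqP; rewrite -subr_eq0 -h; apply/eqP; ring.
Qed.

Lemma cint_unique_all p q a b : (forall t, rcont p t) ->
  (forall t, rderiv q t (p t)) -> cint p a b = q b - q a.
Proof.
move=> pc qp; have [ab|ba] := leP a b; first by apply: cint_unique => // t _.
have := @cint_unique p q b a (ltW ba) pc (fun t _ => qp t).
by rewrite /cint => /(congr1 -%R); rewrite !opprB.
Qed.

Lemma rcontD p q t : rcont p t -> rcont q t -> rcont (fun s => p s + q s) t.
Proof.
move=> fz gz e e0; have e2 : 0 < e / 2 by rewrite divr_gt0.
have [r r0 Hr] := fz _ e2; have [s s0 Hs] := gz _ e2.
exists (Num.min r s) => [|w]; first by rewrite lt_min r0.
rewrite lt_min => /andP[/Hr wr /Hs ws].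
have -> : p w + q w - (p t + q t) = (p w - p t) + (q w - q t) by ring.
by rewrite (le_lt_trans (le_normcD _ _)) // (splitr e) ltrD.
Qed.

Lemma rcontZ c p t : rcont p t -> rcont (fun s => c * p s) t.
Proof.
move=> pc e e0; have m0 : 0 < 1 + normc c by rewrite ltr_wpDr ?normc_ge0.
have [r r0 H] := pc _ (divr_gt0 e0 m0); exists r => // s /H.
rewrite -mulrBr normcM ltr_pdivlMr // mulrC; apply: le_lt_trans.
by rewrite ler_wpM2r ?normc_ge0 // lerDr.
Qed.

Lemma cintD p q a b : (forall t, rcont p t) -> (forall t, rcont q t) ->
  cint (fun s => p s + q s) a b = cint p a b + cint q a b.
Proof.
move=> pc qc; rewrite (@cint_unique_all _ (fun s => prim p s + prim q s)).
- by rewrite /cint; ring.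
- by move=> t; apply: rcontD.
- by move=> t; apply: rderivD; apply: primP.
Qed.

Lemma cintZ c p a b : (forall t, rcont p t) ->
  cint (fun s => c * p s) a b = c * cint p a b.
Proof.
move=> pc; rewrite (@cint_unique_all _ (fun s => c * prim p s)).
- by rewrite /cint; ring.
- by move=> t; apply: rcontZ.
- by move=> t; apply: rderivZ; apply: primP.
Qed.

Lemma cint_eq p q a b : a <= b ->
  (forall t, rcont p t) -> (forall t, rcont q t) ->
  (forall t, a <= t <= b -> p t = q t) -> cint p a b = cint q a b.
Proof.
move=> ab pc qc pq; apply: cint_unique => // t tab; rewrite pq //.
exact: primP.
Qed.

Lemma cint_bound p a b M : a <= b -> (forall t, rcont p t) ->
  (forall t, a <= t <= b -> normc (p t) <= M) ->
  normc (cint p a b) <= 2 * M * (b - a).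
Proof. by move=> ab pc; apply: rderiv_bound => // t _; apply: primP. Qed.

Lemma cdiff_line F z e t d : cdiff F (z + t%:C * e) d ->
  rderiv (fun s => F (z + s%:C * e)) t (d * e).
Proof.
move=> [p [pc pd FE]].
have E s : F (z + s%:C * e) - F (z + t%:C * e) =
    p (z + s%:C * e) * e * (s - t)%:C.
  by rewrite FE (_ : (s - t)%:C = s%:C - t%:C) ?rmorphB //; ring.
have H (x : R) : 0 < x -> exists2 r, 0 < r & forall s, `|s - t| < r ->
    normc (p (z + s%:C * e) * e - d * e) < x.
  move=> x0; have m0 : 0 < 1 + normc e by rewrite ltr_wpDr ?normc_ge0.
  have [r r0 Hr] := pc _ (divr_gt0 x0 m0).
  exists (r / (1 + normc e)); first exact: divr_gt0.
  move=> s; rewrite ltr_pdivlMr // => sr.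
  rewrite -mulrBl normcM -pd.
  have := Hr (z + s%:C * e).
  rewrite (_ : z + _ - _ = (s - t)%:C * e); last by rewrite rmorphB /=; ring.
  rewrite normcM normc_real ltr_pdivlMr // => h.
  apply: le_lt_trans (h _); first by rewrite ler_wpM2l ?normc_ge0 // lerDr.
  by apply: le_lt_trans sr; rewrite ler_wpM2l // lerDr.
split; apply/is_derive1_caratheodory.
- exists (fun s => Re (p (z + s%:C * e) * e)); split.
  + move=> s; rewrite -cReB E; set u := p _ * e.
    by case: u => x y /=; rewrite mulr0 subr0.
  + apply/continuous_realP => x /H [r r0 Hr]; exists r => // s /Hr.
    by rewrite pd -cReB; apply: le_lt_trans; exact: normc_Re.
  + by rewrite pd.
- exists (fun s => Im (p (z + s%:C * e) * e)); split.
  + move=> s; rewrite -cImB E; set u := p _ * e.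
    by case: u => x y /=; rewrite mulr0 add0r.
  + apply/continuous_realP => x /H [r r0 Hr]; exists r => // s /Hr.
    by rewrite pd -cImB; apply: le_lt_trans; exact: normc_Im.
  + by rewrite pd.
Qed.

Lemma cont_at_line F z e t : cont_at F (z + t%:C * e) ->
  rcont (fun s => F (z + s%:C * e)) t.
Proof.
move=> Fc x x0; have m0 : 0 < 1 + normc e by rewrite ltr_wpDr ?normc_ge0.
have [r r0 Hr] := Fc _ x0.
exists (r / (1 + normc e)); first exact: divr_gt0.
move=> s; rewrite ltr_pdivlMr // => sr; apply: Hr.
rewrite (_ : z + _ - _ = (s - t)%:C * e); last by rewrite rmorphB /=; ring.
by rewrite normcM normc_real; apply: le_lt_trans sr; rewrite ler_wpM2l // lerDr.
Qed.

Lemma hlineE s y : s +i* y = (0 +i* y) + s%:C * 1 :> C.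
Proof. by apply: ReIm_eq; rewrite /= ?mulr1 ?mul0r ?mulr0 ?subr0 ?addr0 ?add0r. Qed.

Lemma vlineE s x : x +i* s = (x +i* 0) + s%:C * I :> C.
Proof. by apply: ReIm_eq; rewrite /= ?mulr1 ?mul0r ?mulr0 ?subr0 ?addr0 ?add0r. Qed.

Lemma cdiff_hline F t y d : cdiff F (t +i* y) d ->
  rderiv (fun s => F (s +i* y)) t d.
Proof.
rewrite hlineE => /cdiff_line; rewrite mulr1.
by rewrite (_ : (fun s => _) = fun s => F (s +i* y)) //; apply/funext => s; rewrite -hlineE.
Qed.

Lemma cdiff_vline F t x d : cdiff F (x +i* t) d ->
  rderiv (fun s => F (x +i* s)) t (I * d).
Proof.
rewrite vlineE => /cdiff_line; rewrite mulrC.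
by rewrite (_ : (fun s => _) = fun s => F (x +i* s)) //; apply/funext => s; rewrite -vlineE.
Qed.

Lemma cont_at_hline F t y : cont_at F (t +i* y) -> rcont (fun s => F (s +i* y)) t.
Proof.
rewrite hlineE => /cont_at_line.
by rewrite (_ : (fun s => _) = fun s => F (s +i* y)) //; apply/funext => s; rewrite -hlineE.
Qed.

Lemma cont_at_vline F t x : cont_at F (x +i* t) -> rcont (fun s => F (x +i* s)) t.
Proof.
rewrite vlineE => /cont_at_line.
by rewrite (_ : (fun s => _) = fun s => F (x +i* s)) //; apply/funext => s; rewrite -vlineE.
Qed.

End Curves.

Lemma exp2_unbounded (R : realType) (x e : R) : 0 < e -> exists n, x / 2 ^+ n < e.
Proof.
move=> e0; have [n Hn] : exists n, x / e < n%:R.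
  have [x0|x0] := leP 0 (x / e).
    by exists (Num.bound (x / e)); exact: archi_boundP.
  by exists 0%N; exact: lt_le_trans x0 _.
exists n; rewrite ltr_pdivrMr ?exprn_gt0 // mulrC -ltr_pdivrMr //.
apply: lt_trans Hn _; rewrite -natrX ltr_nat; exact: ltn_expl.
Qed.

(** * Cauchy's theorem on squares *)

Section Bisection.
Context {R : realType}.
Variables (P : R -> R -> R -> R -> Prop) (x0 x1 y0 y1 : R).
Hypotheses (x01 : x0 <= x1) (y01 : y0 <= y1).
Hypothesis glue : forall a b c d,
  x0 <= a -> a <= b -> b <= x1 -> y0 <= c -> c <= d -> d <= y1 ->
  P a ((a + b) / 2) c ((c + d) / 2) -> P ((a + b) / 2) b c ((c + d) / 2) ->
  P a ((a + b) / 2) ((c + d) / 2) d -> P ((a + b) / 2) b ((c + d) / 2) d ->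
  P a b c d.
Hypothesis localP : forall x y, x0 <= x <= x1 -> y0 <= y <= y1 ->
  exists2 r, 0 < r & forall a b c d,
    x0 <= a -> a <= x <= b -> b <= x1 -> y0 <= c -> c <= y <= d -> d <= y1 ->
    b - a < r -> d - c < r -> P a b c d.

Let rect := (R * R * R * R)%type.
Let valid (s : rect) := let: (a, b, c, d) := s in
  [/\ x0 <= a, a <= b, b <= x1 & [/\ y0 <= c, c <= d & d <= y1]].
Let bad (s : rect) := valid s /\ let: (a, b, c, d) := s in ~ P a b c d.
Let child (s t : rect) := let: (a, b, c, d) := s in let: (a', b', c', d') := t in
  [/\ a <= a', b' <= b, c <= c', d' <= d &
      b' - a' = (b - a) / 2 /\ d' - c' = (d - c) / 2].

Let bad_child s : bad s -> exists t, bad t /\ child s t.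
Proof.
case: s => [[[a b] c] d] [[h1 h2 h3 [h4 h5 h6]]] nP.
pose m := (a + b) / 2; pose n := (c + d) / 2.
have [am mb] : a <= m /\ m <= b by rewrite /m; lra.
have [cn nd] : c <= n /\ n <= d by rewrite /n; lra.
have : ~ [/\ P a m c n, P m b c n, P a m n d & P m b n d].
  by move=> [] *; apply: nP; apply: glue.
have E : m - a = (b - a) / 2 /\ b - m = (b - a) / 2 by rewrite /m; lra.
have E' : n - c = (d - c) / 2 /\ d - n = (d - c) / 2 by rewrite /n; lra.
have h7 := le_trans h1 am; have h8 := le_trans mb h3.
have h9 := le_trans h4 cn; have h10 := le_trans nd h6.
case: E E' => e1 e2 [e3 e4].
have [p1|] := pselect (P a m c n); last by exists (a, m, c, n).
have [p2|] := pselect (P m b c n); last by exists (m, b, c, n).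
have [p3|] := pselect (P a m n d); last by exists (a, m, n, d).
have [p4|] := pselect (P m b n d); last by exists (m, b, n, d).
by move=> [].
Qed.

(** If the property failed, [glue] would give a failing quarter, and so on; the nested rectangles
    shrink to a point, whose coordinates are the suprema of the left and lower ends, and [localP] at
    that point is contradicted. The principle yields both Goursat's theorem and the boundedness of
    continuous functions on squares. *)
Lemma rect_bisection : P x0 x1 y0 y1.
Proof.
apply: contrapT => nP.
have bad0 : bad (x0, x1, y0, y1) by [].
have /choice [next Hnext] : forall s, exists t, bad s -> bad t /\ child s t.
  move=> s; have [/bad_child [t Ht]|nb] := pselect (bad s); first by exists t.
  by exists s.
pose S n := iter n next (x0, x1, y0, y1).
have badS n : bad (S n) by elim: n => [//|n IH]; exact: (Hnext _ IH).1.
pose a n := (S n).1.1.1; pose b n := (S n).1.1.2.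
pose c n := (S n).1.2; pose d n := (S n).2.
have SE n : S n = (a n, b n, c n, d n) by rewrite /a /b /c /d; case: (S n) => [[[]]].
have childS n : child (S n) (S n.+1) := (Hnext _ (badS n)).2.
have H n : [/\ x0 <= a n, a n <= b n, b n <= x1 & [/\ y0 <= c n, c n <= d n & d n <= y1]].
  by have := (badS n).1; rewrite SE.
have mono n k : [/\ a n <= a (n + k)%N, b (n + k)%N <= b n,
    c n <= c (n + k)%N & d (n + k)%N <= d n].
  elim: k => [|k [h1 h2 h3 h4]]; first by rewrite addn0.
  have := childS (n + k)%N; rewrite !SE -addnS => -[g1 g2 g3 g4 _].
  by split; [exact: le_trans h1 g1|exact: le_trans g2 h2|
    exact: le_trans h3 g3|exact: le_trans g4 h4].
have ab n m : a n <= b m.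
  have [h1 _ _ _] := mono n m; have [_ h2 _ _] := mono m n.
  rewrite addnC in h2; have [_ h3 _ _] := H (n + m)%N.
  exact: le_trans (le_trans h1 h3) h2.
have cd n m : c n <= d m.
  have [_ _ h1 _] := mono n m; have [_ _ _ h2] := mono m n.
  rewrite addnC in h2; have [_ _ _ [_ h3 _]] := H (n + m)%N.
  exact: le_trans (le_trans h1 h3) h2.
have wd n : b n - a n = (x1 - x0) / 2 ^+ n /\ d n - c n = (y1 - y0) / 2 ^+ n.
  elim: n => [|n [h1 h2]]; first by rewrite !expr0 !divr1.
  have := childS n; rewrite !SE => -[_ _ _ _ [-> ->]].
  by rewrite h1 h2 exprSr invfM !mulrA.
pose x := sup (range a); pose y := sup (range c).
have xP n : a n <= x <= b n.
  apply/andP; split.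
    apply: ub_le_sup; last by exists n.
    by exists (b n) => _ [m _ <-].
  by apply: ge_sup; [exists (a 0%N), 0%N|move=> _ [m _ <-]].
have yP n : c n <= y <= d n.
  apply/andP; split.
    apply: ub_le_sup; last by exists n.
    by exists (d n) => _ [m _ <-].
  by apply: ge_sup; [exists (c 0%N), 0%N|move=> _ [m _ <-]].
have [r r0 Hr] := localP (xP 0%N) (yP 0%N).
have [n1 Hn1] := exp2_unbounded (x1 - x0) r0.
have [n2 Hn2] := exp2_unbounded (y1 - y0) r0.
pose n := (n1 + n2)%N.
have [_] := badS n; rewrite SE.
have small (z : R) n' : 0 <= z -> (n' <= n)%N -> z / 2 ^+ n <= z / 2 ^+ n'.
  move=> z0 n'n; rewrite ler_wpM2l // lef_pV2 ?posrE ?exprn_gt0 //.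
  by rewrite ler_weXn2l // ler1n.
have [w1 w2] := wd n.
apply; apply: Hr => //.
- by have [] := H n.
- by have [] := H n.
- by have [_ _ _ []] := H n.
- by have [_ _ _ []] := H n.
- rewrite w1; apply: le_lt_trans Hn1; apply: small; first by rewrite subr_ge0.
  exact: leq_addr.
- rewrite w2; apply: le_lt_trans Hn2; apply: small; first by rewrite subr_ge0.
  exact: leq_addl.
Qed.

End Bisection.

(** * Contour integrals over rectangles and Goursat's theorem *)

Section RectangleIntegral.
Context {R : realType}.
Local Notation C := R[i].
Local Notation I := (0 +i* 1 : C).
Implicit Types (a b s t M x y : R) (F G H : C -> C) (z w c d : C).

(** The boundary is run counterclockwise, with dz = [I] dt on the vertical sides. *)
Definition rint G x0 x1 y0 y1 : C :=
  cint (fun s => G (s +i* y0)) x0 x1 + I * cint (fun t => G (x1 +i* t)) y0 y1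
  - cint (fun s => G (s +i* y1)) x0 x1 - I * cint (fun t => G (x0 +i* t)) y0 y1.

(** Continuity is asked on the full lines carrying the sides, because [primP] wants curves
    continuous on all of [R]. *)
Definition bdcont G x0 x1 y0 y1 :=
  [/\ forall t, rcont (fun s => G (s +i* y0)) t,
      forall t, rcont (fun s => G (x1 +i* s)) t,
      forall t, rcont (fun s => G (s +i* y1)) t &
      forall t, rcont (fun s => G (x0 +i* s)) t].

Definition on_bd x0 x1 y0 y1 (P : C -> Prop) :=
  (forall s, x0 <= s <= x1 -> P (s +i* y0) /\ P (s +i* y1)) /\
  (forall t, y0 <= t <= y1 -> P (x0 +i* t) /\ P (x1 +i* t)).

Lemma bdcontP G x0 x1 y0 y1 : (forall z, cont_at G z) -> bdcont G x0 x1 y0 y1.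
Proof.
by move=> Gc; split=> t; first [exact: cont_at_hline|exact: cont_at_vline].
Qed.

Lemma bdcontZ c G x0 x1 y0 y1 : bdcont G x0 x1 y0 y1 ->
  bdcont (fun z => c * G z) x0 x1 y0 y1.
Proof. by move=> [g1 g2 g3 g4]; split=> t; apply: rcontZ. Qed.

Lemma rint_splitx G x0 x1 x2 y0 y1 :
  rint G x0 x2 y0 y1 = rint G x0 x1 y0 y1 + rint G x1 x2 y0 y1.
Proof. by rewrite /rint /cint; ring. Qed.

Lemma rint_splity G x0 x1 y0 y1 y2 :
  rint G x0 x1 y0 y2 = rint G x0 x1 y0 y1 + rint G x0 x1 y1 y2.
Proof. by rewrite /rint /cint; ring. Qed.

Lemma rintD F G x0 x1 y0 y1 : bdcont F x0 x1 y0 y1 -> bdcont G x0 x1 y0 y1 ->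
  rint (fun z => F z + G z) x0 x1 y0 y1 = rint F x0 x1 y0 y1 + rint G x0 x1 y0 y1.
Proof. by move=> [f1 f2 f3 f4] [g1 g2 g3 g4]; rewrite /rint !cintD //; ring. Qed.

Lemma rintZ c G x0 x1 y0 y1 : bdcont G x0 x1 y0 y1 ->
  rint (fun z => c * G z) x0 x1 y0 y1 = c * rint G x0 x1 y0 y1.
Proof. by move=> [g1 g2 g3 g4]; rewrite /rint !cintZ //; ring. Qed.

Lemma rint_eq F G x0 x1 y0 y1 : x0 <= x1 -> y0 <= y1 ->
  bdcont F x0 x1 y0 y1 -> bdcont G x0 x1 y0 y1 ->
  on_bd x0 x1 y0 y1 (fun z => F z = G z) ->
  rint F x0 x1 y0 y1 = rint G x0 x1 y0 y1.
Proof.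
move=> x01 y01 [f1 f2 f3 f4] [g1 g2 g3 g4] [hh vv]; rewrite /rint.
congr (_ + _ * _ - _ - _ * _); apply: cint_eq => // t h.
- by have [] := hh t h.
- by have [] := vv t h.
- by have [] := hh t h.
- by have [] := vv t h.
Qed.

Lemma rint_bound G x0 x1 y0 y1 M : x0 <= x1 -> y0 <= y1 ->
  bdcont G x0 x1 y0 y1 -> on_bd x0 x1 y0 y1 (fun z => normc (G z) <= M) ->
  normc (rint G x0 x1 y0 y1) <= 4 * M * ((x1 - x0) + (y1 - y0)).
Proof.
move=> x01 y01 [g1 g2 g3 g4] [hh vv]; rewrite /rint.
have nI z : normc (I * z) = normc z.
  by rewrite normcM /normc /= expr0n expr1n add0r sqrtr1 mul1r.
have := @cint_bound _ _ x0 x1 M x01 g1 (fun t h => (hh t h).1).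
have := @cint_bound _ _ x0 x1 M x01 g3 (fun t h => (hh t h).2).
have := @cint_bound _ _ y0 y1 M y01 g4 (fun t h => (vv t h).1).
have := @cint_bound _ _ y0 y1 M y01 g2 (fun t h => (vv t h).2).
rewrite -[in X in X -> _]nI -[in X in _ -> X -> _]nI.
rewrite -[in X in _ -> _ -> X -> _]normcN -[in X in _ -> X -> _ -> _]normcN.
set A := cint (fun s => G (s +i* y0)) _ _; set B := I * _; set D := - cint _ _ _; set E := - (I * _).
move=> h1 h2 h3 h4.
have := le_normcD (A + B + D) E; have := le_normcD (A + B) D.
have := le_normcD A B; lra.
Qed.

Lemma rint_primitive F G x0 x1 y0 y1 : x0 <= x1 -> y0 <= y1 ->
  bdcont G x0 x1 y0 y1 -> on_bd x0 x1 y0 y1 (fun z => cdiff F z (G z)) ->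
  rint G x0 x1 y0 y1 = 0.
Proof.
move=> x01 y01 [g1 g2 g3 g4] [hh vv]; rewrite /rint.
rewrite (@cint_unique _ _ (fun s => F (s +i* y0)) x0 x1 x01 g1); last first.
  by move=> t /hh [h _]; exact: cdiff_hline.
rewrite (@cint_unique _ _ (fun s => F (s +i* y1)) x0 x1 x01 g3); last first.
  by move=> t /hh [_ h]; exact: cdiff_hline.
rewrite -!cintZ //.
rewrite (@cint_unique _ _ (fun s => F (x1 +i* s)) y0 y1 y01); first last.
- by move=> t /vv [_ h]; exact: cdiff_vline.
- by move=> t; exact: rcontZ.
rewrite (@cint_unique _ _ (fun s => F (x0 +i* s)) y0 y1 y01); first last.
- by move=> t /vv [h _]; exact: cdiff_vline.
- by move=> t; exact: rcontZ.
ring.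
Qed.

Lemma rint_affine c d x0 x1 y0 y1 : x0 <= x1 -> y0 <= y1 ->
  rint (fun z => c + d * z) x0 x1 y0 y1 = 0.
Proof.
move=> x01 y01; pose F z := c * z + (d / 2) * (z * z).
have FD z : cdiff F z (c + d * z).
  rewrite (_ : c + d * z = c * 1 + (d / 2) * (1 * z + z * 1)); last by field.
  apply: cdiffD; apply: cdiffZ; first exact: cdiff_id.
  by apply: cdiffM; exact: cdiff_id.
apply: (@rint_primitive F) => //.
apply: bdcontP => z; apply: cont_atD; first exact: cont_at_cst.
by apply: cont_atM; [exact: cont_at_cst|exact: cont_at_id].
Qed.

(** A bound of the integral by e times the sum of the squared side lengths is stable under gluing
    four quarters. It holds for small rectangles around a point because [G] is affine there up to a
    small error and affine functions integrate to 0. *)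
Lemma goursat G x0 x1 y0 y1 : x0 <= x1 -> y0 <= y1 ->
  (forall z, cont_at G z) ->
  (forall x y, x0 <= x <= x1 -> y0 <= y <= y1 -> exists d, cdiff G (x +i* y) d) ->
  rint G x0 x1 y0 y1 = 0.
Proof.
move=> x01 y01 Gc Gd; apply: eq0_normc; apply/eqP; rewrite eq_le normc_ge0 andbT.
apply/ler_addgt0Pr => e e0; rewrite add0r.
pose S := (x1 - x0) ^+ 2 + (y1 - y0) ^+ 2 + 1.
have S0 : 0 < S by rewrite ltr_wpDl // addr_ge0 ?sqr_ge0.
suff : normc (rint G x0 x1 y0 y1) <= e / S * ((x1 - x0) ^+ 2 + (y1 - y0) ^+ 2).
  move=> h; apply: le_trans h _; rewrite -mulrA ger_pMr // mulrC ler_pdivrMr //.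
  by rewrite mul1r lerDl.
have : 0 < e / S by rewrite divr_gt0.
move: (e / S) => {e0}e1 e0; move: e1 e0 => {S S0}{}e e0.
apply: (@rect_bisection _ (fun x0 x1 y0 y1 => normc (rint G x0 x1 y0 y1) <=
  e * ((x1 - x0) ^+ 2 + (y1 - y0) ^+ 2)) x0 x1 y0 y1 x01 y01).
- move=> a b c d _ _ _ _ _ _ h1 h2 h3 h4.
  rewrite (rint_splity G a b c ((c + d) / 2) d).
  rewrite !(rint_splitx G a ((a + b) / 2) b).
  apply: le_trans (le_normcD _ _) _.
  apply: le_trans (lerD (le_normcD _ _) (le_normcD _ _)) _.
  apply: le_trans (lerD (lerD h1 h2) (lerD h3 h4)) _.
  rewrite -!mulrDr ler_pM2l //.
  by rewrite le_eqVlt; apply/orP; left; apply/eqP; field.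
- move=> x y xP yP; have [D GD] := Gd x y xP yP.
  (* For side lengths u and v, [rint_bound] with the bound e / 8 (u + v) gives e (u + v)^2 / 2,
     which is at most e (u^2 + v^2). *)
  have e8 : 0 < e / 8 by rewrite divr_gt0.
  have [r r0 Hr] := cdiffP GD e8.
  exists (r / 2); first by rewrite divr_gt0.
  move=> a b c d ax axb bx cy cyd dy ba dc.
  pose z0 := x +i* y.
  pose L z := (G z0 - D * z0) + D * z.
  pose E z := G z + (-1) * L z.
  have Lc z : cont_at L z.
    apply: cont_atD; first exact: cont_at_cst.
    by apply: cont_atM; [exact: cont_at_cst|exact: cont_at_id].
  have ab : a <= b by case/andP: axb => ? /(le_trans _); apply.
  have cd : c <= d by case/andP: cyd => ? /(le_trans _); apply.
  have -> : rint G a b c d = rint E a b c d.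
    rewrite rintD; [|exact: bdcontP|by apply: bdcontZ; exact: bdcontP].
    by rewrite rintZ ?rint_affine ?mulr0 ?addr0 //; exact: bdcontP.
  have Eb (s t : R) : a <= s <= b -> c <= t <= d ->
      normc (E (s +i* t)) <= e / 8 * ((b - a) + (d - c)).
    move=> /andP[as_ sb] /andP[ct td]; move: axb cyd => /andP[ax' xb] /andP[cy' yd].
    have dist : normc ((s +i* t) - z0) <= (b - a) + (d - c).
      apply: le_trans (normc_leReIm _) _; rewrite cReB cImB /=.
      by apply: lerD; rewrite ler_norml; lra.
    have -> : E (s +i* t) = G (s +i* t) - G z0 - D * ((s +i* t) - z0).
      by rewrite /E /L; ring.
    apply: le_trans (Hr _ _) _; last by rewrite ler_pM2l.
    by apply: le_lt_trans dist _; lra.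
  apply: le_trans (@rint_bound E a b c d (e / 8 * ((b - a) + (d - c))) ab cd _ _) _.
  + apply: bdcontP => z; apply: cont_atD => //.
    by apply: cont_atM => //; exact: cont_at_cst.
  + by split=> s sP; split; apply: Eb; rewrite ?lexx ?ab ?cd.
  + have : 0 <= ((b - a) - (d - c)) ^+ 2 := sqr_ge0 _.
    move: (b - a) (d - c) => u v uv.
    rewrite [leLHS](_ : _ = e * ((u + v) ^+ 2 / 2)); last by field.
    by rewrite ler_pM2l //; nra.
Qed.

End RectangleIntegral.

(** * Cauchy transforms over squares centred at the origin *)

Section Squares.
Context {R : realType}.
Local Notation C := R[i].
Local Notation I := (0 +i* 1 : C).
Implicit Types (r s t M : R) (f g G psi : C -> C) (z w a b c d : C).

(** The norm whose spheres are the contours of integration. *)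
Definition sqn z : R := Num.max `|Re z| `|Im z|.

Lemma sqn_le z r : (sqn z <= r) = (`|Re z| <= r) && (`|Im z| <= r).
Proof. by rewrite /sqn ge_max. Qed.

Lemma sqn_lt z r : (sqn z < r) = (`|Re z| < r) && (`|Im z| < r).
Proof. by rewrite /sqn gt_max. Qed.

Lemma sqn_ge0 z : 0 <= sqn z.
Proof. by rewrite /sqn le_max normr_ge0. Qed.

Lemma sqn0 : sqn 0 = 0.
Proof. by rewrite /sqn /= normr0 maxxx. Qed.

Lemma sqn_le_normc z : sqn z <= normc z.
Proof. by rewrite sqn_le normc_Re normc_Im. Qed.

Lemma normc_le_sqn z : normc z <= 2 * sqn z.
Proof.
have := lexx (sqn z); rewrite {1}sqn_le => /andP[h1 h2].
by have := normc_leReIm z; lra.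
Qed.

Lemma sqnD z w : sqn (z + w) <= sqn z + sqn w.
Proof.
have := lexx (sqn z); rewrite {1}sqn_le => /andP[h1 h2].
have := lexx (sqn w); rewrite {1}sqn_le => /andP[h3 h4].
rewrite sqn_le cReD cImD; apply/andP; split.
  by apply: le_trans (ler_normD _ _) _; apply: lerD.
by apply: le_trans (ler_normD _ _) _; apply: lerD.
Qed.

Lemma sqnB z w : sqn (z - w) = sqn (w - z).
Proof. by rewrite /sqn !cReB !cImB distrC (distrC (Im z)). Qed.

Lemma sqn_triB z w : sqn z - sqn w <= sqn (z - w).
Proof. by rewrite lerBlDr -{1}(subrK w z) sqnD. Qed.

(** The four full lines that carry the sides, to match [bdcont]. *)
Definition on_lines z r := `|Re z| = r \/ `|Im z| = r.

Definition lcont G r := forall z, on_lines z r -> cont_at G z.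

Definition sint G r : C := rint G (- r) r (- r) r.

Lemma lcont_bdcont G r : 0 <= r -> lcont G r -> bdcont G (- r) r (- r) r.
Proof.
move=> r0 Gr; split=> t.
- by apply: cont_at_hline; apply: Gr; right; rewrite /= normrN ger0_norm.
- by apply: cont_at_vline; apply: Gr; left; rewrite /= ger0_norm.
- by apply: cont_at_hline; apply: Gr; right; rewrite /= ger0_norm.
- by apply: cont_at_vline; apply: Gr; left; rewrite /= normrN ger0_norm.
Qed.

Lemma on_bd_sqn r (P : C -> Prop) : 0 <= r -> (forall z, sqn z = r -> P z) ->
  on_bd (- r) r (- r) r P.
Proof.
move=> r0 H; split=> s; rewrite -ler_norml => sr; split; apply: H;
  rewrite /sqn /= ?normrN (ger0_norm r0); first [by apply/max_idPr|by apply/max_idPl].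
Qed.

Lemma on_lines_sqn z r : on_lines z r -> r <= sqn z.
Proof. by rewrite /sqn le_max => -[->|->]; rewrite lexx ?orbT. Qed.

Lemma sint_bound G r M : 0 <= r -> lcont G r ->
  (forall z, sqn z = r -> normc (G z) <= M) -> normc (sint G r) <= 16 * M * r.
Proof.
move=> r0 Gc GM.
have := @rint_bound _ G (- r) r (- r) r M; rewrite -/(sint G r).
have rr : - r <= r by lra.
move=> /(_ rr rr (lcont_bdcont r0 Gc) (on_bd_sqn r0 GM)); lra.
Qed.

Lemma sintD f g r : 0 <= r -> lcont f r -> lcont g r ->
  sint (fun z => f z + g z) r = sint f r + sint g r.
Proof. by move=> r0 fc gc; rewrite /sint rintD //; exact: lcont_bdcont. Qed.

Lemma sintZ c f r : 0 <= r -> lcont f r ->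
  sint (fun z => c * f z) r = c * sint f r.
Proof. by move=> r0 fc; rewrite /sint rintZ //; exact: lcont_bdcont. Qed.

Lemma sint_eq f g r : 0 <= r -> lcont f r -> lcont g r ->
  (forall z, sqn z = r -> f z = g z) -> sint f r = sint g r.
Proof.
move=> r0 fc gc fg; rewrite /sint; have rr : - r <= r by lra.
by apply: rint_eq => //; [exact: lcont_bdcont|exact: lcont_bdcont|exact: on_bd_sqn].
Qed.

(** Transfers a kernel identity on the boundary to the integrals; the difference quotients of Cauchy
    transforms are computed through it. *)
Lemma sint_sub f g h c r : 0 <= r -> lcont f r -> lcont g r -> lcont h r ->
  (forall z, sqn z = r -> f z - g z = c * h z) ->
  sint f r - sint g r = c * sint h r.
Proof.
move=> r0 fc gc hc E; rewrite -sintZ // -mulN1r -sintZ //.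
have cM k (k' : C) : lcont k r -> lcont (fun z => k' * k z) r.
  by move=> kc z zr; apply: cont_atM; [exact: cont_at_cst|exact: kc].
have gc' := cM _ (-1) gc; rewrite -sintD //; apply: sint_eq => //.
- by move=> z zr; apply: cont_atD; [exact: fc|exact: gc'].
- exact: cM.
- by move=> z zr; rewrite mulN1r E.
Qed.

Lemma sqnE (x y : R) r : (sqn (x +i* y) <= r) = (- r <= x <= r) && (- r <= y <= r).
Proof. by rewrite sqn_le /= !ler_norml. Qed.

(** Cauchy's theorem with a point [a] at which only continuity is known. Around [a] a square of half
    side [h] is cut out: the remaining pieces vanish by Goursat, and the small one tends to 0 with
    [h]. It is meant for difference quotients at [a]. *)
Lemma sint_except G a r : (forall z, cont_at G z) -> sqn a < r ->
  (forall z, sqn z <= r -> z != a -> exists d, cdiff G z d) -> sint G r = 0.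
Proof.
move=> Gc ar Gd; apply: eq0_normc; apply/eqP; rewrite eq_le normc_ge0 andbT.
apply/ler_addgt0Pr => e e0; rewrite add0r.
have [u u0 Hu] := Gc a _ ltr01.
pose M := normc (G a) + 1.
have M0 : 0 < M by rewrite ltr_wpDl ?normc_ge0.
(* The three terms keep the small square inside the large one, keep [G] bounded by [M] on it, and
   make its contribution, at most 16 M h, no larger than [e]. *)
pose h := Num.min (Num.min ((r - sqn a) / 2) (u / 4)) (e / (16 * M)).
have h0 : 0 < h.
  by rewrite !lt_min !divr_gt0 ?subr_gt0 ?mulr_gt0.
have [h1 [h2 h3]] : h <= (r - sqn a) / 2 /\ h <= u / 4 /\ h <= e / (16 * M).
  by rewrite /h !ge_min !lexx !orbT.
have hM : 16 * M * h <= e by rewrite mulrC -ler_pdivlMr ?mulr_gt0.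
move: (ltW ar) Hu; rewrite sqn_le; case E: a => [a1 a2] /= /andP[].
rewrite !ler_norml => /andP[a1l a1r] /andP[a2l a2r] Hu.
have : `|a1| <= sqn a /\ `|a2| <= sqn a.
  by have := lexx (sqn a); rewrite {1}sqn_le E /= => /andP[].
rewrite !ler_norml => -[/andP[b1 b2] /andP[b3 b4]].
have notin (x y : R) : x != a1 \/ y != a2 -> x +i* y != a.
  by rewrite E eq_complex negb_and /= => -[->|->]; rewrite ?orbT.
have GG x0 x1 y0 y1 : x0 <= x1 -> y0 <= y1 -> - r <= x0 -> x1 <= r -> - r <= y0 ->
    y1 <= r -> (forall x y, x0 <= x <= x1 -> y0 <= y <= y1 -> x != a1 \/ y != a2) ->
    rint G x0 x1 y0 y1 = 0.
  move=> x01 y01 g1 g2 g3 g4 na; apply: goursat => // x y xP yP.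
  apply: Gd; last by apply: notin; exact: na.
  by rewrite sqnE; lra.
rewrite /sint (rint_splitx G (- r) (a1 - h) r) (rint_splitx G (a1 - h) (a1 + h) r).
rewrite (rint_splity G (a1 - h) (a1 + h) (- r) (a2 - h) r).
rewrite (rint_splity G (a1 - h) (a1 + h) (a2 - h) (a2 + h) r).
rewrite (GG (- r) (a1 - h)); try lra; last first.
  by move=> x y /andP[_ xh] _; left; rewrite lt_eqF //; lra.
rewrite (GG (a1 + h) r); try lra; last first.
  by move=> x y /andP[xh _] _; left; rewrite gt_eqF //; lra.
rewrite (GG _ _ (- r) (a2 - h)); try lra; last first.
  by move=> x y _ /andP[_ xh]; right; rewrite lt_eqF //; lra.
rewrite (GG _ _ (a2 + h) r); try lra; last first.
  by move=> x y _ /andP[xh _]; right; rewrite gt_eqF //; lra.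
rewrite !add0r !addr0.
apply: le_trans (@rint_bound _ G _ _ _ _ M _ _ _ _) _; try lra.
- exact: bdcontP.
- have Hb x y : a1 - h <= x <= a1 + h -> a2 - h <= y <= a2 + h ->
      normc (G (x +i* y)) <= M.
    move=> xP yP; have : normc (x +i* y - a) < u.
      apply: le_lt_trans (normc_leReIm _) _; rewrite E cReB cImB /=.
      have : `|x - a1| <= h /\ `|y - a2| <= h by rewrite !ler_norml; lra.
      lra.
    rewrite E => /Hu; have := normc_triB (G (x +i* y)) (G a); rewrite /M E; lra.
  by split=> s sP; split; apply: Hb => //; lra.
Qed.

Lemma lcontM f g r : lcont f r -> lcont g r -> lcont (fun z => f z * g z) r.
Proof. by move=> fc gc z zr; apply: cont_atM; [exact: fc|exact: gc]. Qed.

Lemma lcont_inv a r : sqn a < r -> lcont (fun z => (z - a)^-1) r.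
Proof.
move=> ar z zr; apply: cont_atV.
  rewrite subr_eq0; apply: contraTneq ar => <-.
  by rewrite -leNgt; exact: on_lines_sqn.
by apply: cont_atB; [exact: cont_at_id|exact: cont_at_cst].
Qed.

(** The Cauchy transform of the boundary values of [psi], without the factor 1 / (2 pi i). [ktrans2]
    is its formal derivative in [a]. *)
Definition ktrans psi r a := sint (fun z => psi z * (z - a)^-1) r.

Definition ktrans2 psi r a := sint (fun z => psi z * ((z - a)^-1 * (z - a)^-1)) r.

Lemma lcont_k psi r a : sqn a < r -> lcont psi r ->
  lcont (fun z => psi z * (z - a)^-1) r.
Proof. by move=> ar pc; apply: lcontM => //; exact: lcont_inv. Qed.

Lemma lcont_k2 psi r a : sqn a < r -> lcont psi r ->
  lcont (fun z => psi z * ((z - a)^-1 * (z - a)^-1)) r.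
Proof. by move=> ar pc; do ?apply: lcontM => //; exact: lcont_inv. Qed.

Lemma dist_bd a r z : sqn z = r -> r - sqn a <= normc (z - a).
Proof. by move=> <-; apply: le_trans (sqn_triB _ _) (sqn_le_normc _). Qed.

Lemma bd_neq a r z : sqn a < r -> sqn z = r -> z - a != 0.
Proof.
move=> ar zr; rewrite -normc_gt0; apply: lt_le_trans (dist_bd a zr).
by rewrite subr_gt0.
Qed.

Lemma kernel_bound a b r z : sqn a < r -> normc (b - a) < (r - sqn a) / 2 ->
  sqn z = r -> [/\ normc (z - a)^-1 <= 2 / (r - sqn a),
    normc (z - b)^-1 <= 2 / (r - sqn a) & sqn b < r].
Proof.
move=> ar ba zr; have d0 : 0 < r - sqn a by rewrite subr_gt0.
have h1 := dist_bd a zr.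
have h2 : (r - sqn a) / 2 <= normc (z - b).
  have -> : z - b = (z - a) - (b - a) by ring.
  by have := normc_triB (z - a) (b - a); lra.
have inv_le w : (r - sqn a) / 2 <= normc w -> normc w^-1 <= 2 / (r - sqn a).
  move=> h; rewrite normcV -[2 / _]invf_div lef_pV2 // posrE ?divr_gt0 //.
  by apply: lt_le_trans h; rewrite divr_gt0.
split.
- by apply: inv_le; lra.
- exact: inv_le.
- have := sqn_triB b a; have := sqn_le_normc (b - a); lra.
Qed.

Lemma cont_at_lip f z (r L : R) : 0 < r ->
  (forall w, normc (w - z) < r -> normc (f w - f z) <= L * normc (w - z)) ->
  cont_at f z.
Proof.
move=> r0 fL e e0; have L0 : 0 < `|L| + 1 by rewrite ltr_wpDl.
exists (Num.min r (e / (`|L| + 1))); first by rewrite lt_min r0 divr_gt0.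
move=> w; rewrite lt_min ltr_pdivlMr // => /andP[/fL wr we].
apply: le_lt_trans wr _; apply: le_lt_trans we; rewrite mulrC.
rewrite ler_wpM2l ?normc_ge0 //; have := ler_norm L; lra.
Qed.

Lemma ktrans_cont psi r a M : sqn a < r -> lcont psi r ->
  (forall z, sqn z = r -> normc (psi z) <= M) -> cont_at (ktrans psi r) a.
Proof.
move=> ar pc pM; have d0 : 0 < r - sqn a by rewrite subr_gt0.
have r0 : 0 <= r := le_trans (sqn_ge0 a) (ltW ar).
pose B := 2 / (r - sqn a).
apply: (@cont_at_lip _ a ((r - sqn a) / 2) (16 * (M * (B * B)) * r)).
  by rewrite divr_gt0.
move=> b ba; have br : sqn b < r.
  have := sqn_triB b a; have := sqn_le_normc (b - a); lra.
pose k z := psi z * (z - a)^-1 * (z - b)^-1.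
have kc : lcont k r by apply: lcont_k => //; exact: lcont_k.
have -> : ktrans psi r b - ktrans psi r a = (b - a) * sint k r.
  apply: sint_sub; [exact: r0|exact: (lcont_k br pc)|exact: (lcont_k ar pc)|exact: kc|].
  by move=> z zr; rewrite /k; field; rewrite !(@bd_neq _ r).
rewrite normcM mulrC ler_wpM2r ?normc_ge0 //.
apply: sint_bound => // z zr.
have [k1 k2 _] := kernel_bound ar ba zr.
rewrite /k !normcM -mulrA; apply: ler_pM => //; rewrite ?mulr_ge0 ?normc_ge0 //.
  exact: pM.
by apply: ler_pM => //; exact: normc_ge0.
Qed.

Lemma ktrans2_cont psi r a M : sqn a < r -> lcont psi r ->
  (forall z, sqn z = r -> normc (psi z) <= M) -> cont_at (ktrans2 psi r) a.
Proof.
move=> ar pc pM; have d0 : 0 < r - sqn a by rewrite subr_gt0.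
have r0 : 0 <= r := le_trans (sqn_ge0 a) (ltW ar).
pose B := 2 / (r - sqn a).
apply: (@cont_at_lip _ a ((r - sqn a) / 2) (16 * (M * (B * B * (B + B))) * r)).
  by rewrite divr_gt0.
move=> b ba; have br : sqn b < r.
  have := sqn_triB b a; have := sqn_le_normc (b - a); lra.
pose k z := psi z * ((z - a)^-1 * (z - b)^-1 * ((z - a)^-1 + (z - b)^-1)).
have kc : lcont k r.
  apply: lcontM => //; apply: lcontM; first by apply: lcontM; exact: lcont_inv.
  by move=> z zr; apply: cont_atD; exact: (lcont_inv _ zr).
have -> : ktrans2 psi r b - ktrans2 psi r a = (b - a) * sint k r.
  apply: sint_sub; [exact: r0|exact: (lcont_k2 br pc)|exact: (lcont_k2 ar pc)|exact: kc|].
  by move=> z zr; rewrite /k; field; rewrite !(@bd_neq _ r).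
rewrite normcM mulrC ler_wpM2r ?normc_ge0 //.
apply: sint_bound => // z zr.
have [k1 k2 _] := kernel_bound ar ba zr.
have n0 := @normc_ge0 R.
rewrite /k !normcM; apply: ler_pM; rewrite ?mulr_ge0 //.
  exact: pM.
apply: ler_pM; rewrite ?mulr_ge0 //; first by apply: ler_pM.
by apply: le_trans (le_normcD _ _) _; apply: lerD.
Qed.

Lemma cdiff_of_near f (p : C -> C) z (r : R) : 0 < r ->
  (forall w, normc (w - z) < r -> f w - f z = p w * (w - z)) ->
  cont_at p z -> cdiff f z (p z).
Proof.
move=> r0 H pc.
have [q [qc qz qE]] : cdiff (fun w => f z + p w * (w - z)) z (p z).
  exists p; split=> // w; ring.
apply: (@cdiff_near _ (fun w => f z + p w * (w - z)) _ _ _ r) => //.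
  by move=> w /H <-; ring.
by exists q.
Qed.

(** The difference quotient between [a] and [b] is the transform at [b] of psi / (z - a), so
    differentiability reduces to the continuity of another transform. *)
Lemma ktrans_cdiff psi r a M : sqn a < r -> lcont psi r ->
  (forall z, sqn z = r -> normc (psi z) <= M) ->
  cdiff (ktrans psi r) a (ktrans2 psi r a).
Proof.
move=> ar pc pM; have d0 : 0 < r - sqn a by rewrite subr_gt0.
have r0 : 0 <= r := le_trans (sqn_ge0 a) (ltW ar).
pose psi1 z := psi z * (z - a)^-1.
have p1c : lcont psi1 r by exact: lcont_k.
have -> : ktrans2 psi r a = ktrans psi1 r a.
  rewrite /ktrans2 /ktrans; congr (sint _ _); apply/funext => z.
  by rewrite /psi1 mulrA.
apply: (@cdiff_of_near _ (ktrans psi1 r) a ((r - sqn a) / 2)).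
- by rewrite divr_gt0.
- move=> b ba; have br : sqn b < r.
    have := sqn_triB b a; have := sqn_le_normc (b - a); lra.
  rewrite mulrC; apply: sint_sub;
    [exact: r0|exact: (lcont_k br pc)|exact: (lcont_k ar pc)|exact: (lcont_k br p1c)|].
  by move=> z zr; rewrite /psi1; field; rewrite !(@bd_neq _ r).
- apply: (@ktrans_cont _ _ _ (M * (2 / (r - sqn a)))) => // z zr.
  have aa : normc (a - a) < (r - sqn a) / 2 by rewrite subrr normc0 divr_gt0.
  have [k1 _ _] := kernel_bound ar aa zr.
  by rewrite /psi1 normcM; apply: ler_pM; rewrite ?normc_ge0 ?pM.
Qed.

(** The slope comes from 1/(z-b)^2 - 1/(z-a)^2 = (b-a) (1/((z-a)(z-b)^2) + 1/((z-a)^2 (z-b))). This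
    second differentiation is what makes derivatives of holomorphic functions holomorphic. *)
Lemma ktrans2_cdiff psi r a M : sqn a < r -> lcont psi r ->
  (forall z, sqn z = r -> normc (psi z) <= M) ->
  exists d, cdiff (ktrans2 psi r) a d.
Proof.
move=> ar pc pM; have d0 : 0 < r - sqn a by rewrite subr_gt0.
have r0 : 0 <= r := le_trans (sqn_ge0 a) (ltW ar).
pose psi1 z := psi z * (z - a)^-1.
have p1c : lcont psi1 r by exact: lcont_k.
pose psi2 z := psi z * ((z - a)^-1 * (z - a)^-1).
have p2c : lcont psi2 r by exact: lcont_k2.
pose p b := ktrans2 psi1 r b + ktrans psi2 r b.
exists (p a); apply: (@cdiff_of_near _ p a ((r - sqn a) / 2)).
- by rewrite divr_gt0.
- move=> b ba; have br : sqn b < r.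
    have := sqn_triB b a; have := sqn_le_normc (b - a); lra.
  rewrite /p mulrC /ktrans2 /ktrans -sintD //; [|exact: lcont_k2|exact: lcont_k].
  apply: sint_sub; [exact: r0|exact: (lcont_k2 br pc)|exact: (lcont_k2 ar pc)| |].
  - by move=> z zr; apply: cont_atD; [exact: (lcont_k2 br p1c zr)|exact: (lcont_k br p2c zr)].
  - by move=> z zr; rewrite /psi1 /psi2; field; rewrite !(@bd_neq _ r).
- have aa : normc (a - a) < (r - sqn a) / 2 by rewrite subrr normc0 divr_gt0.
  apply: cont_atD.
  + apply: (@ktrans2_cont _ _ _ (M * (2 / (r - sqn a)))) => // z zr.
    have [k1 _ _] := kernel_bound ar aa zr.
    by rewrite /psi1 normcM; apply: ler_pM; rewrite ?normc_ge0 ?pM.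
  + apply: (@ktrans_cont _ _ _ (M * (2 / (r - sqn a) * (2 / (r - sqn a))))) => // z zr.
    have [k1 _ _] := kernel_bound ar aa zr.
    rewrite /psi2 !normcM; apply: ler_pM; rewrite ?mulr_ge0 ?normc_ge0 ?pM //.
    by apply: ler_pM; rewrite ?normc_ge0.
Qed.

End Squares.

(** * Cauchy's formula and its estimates *)

Section CauchyFormula.
Context {R : realType}.
Local Notation C := R[i].
Local Notation I := (0 +i* 1 : C).
Implicit Types (r s t M : R) (f g G psi : C -> C) (z w a b c d : C).

Definition cont G := forall z, cont_at G z.

Definition holo_on G r := forall z, sqn z <= r -> exists d, cdiff G z d.

Lemma cont_lcont G r : cont G -> lcont G r.
Proof. by move=> Gc z _; exact: Gc. Qed.

Lemma bounded_square G r : cont G ->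
  exists M, forall z, sqn z <= r -> normc (G z) <= M.
Proof.
move=> Gc; have [r0|r0] := ltP r 0.
  by exists 0 => z zr; have := le_trans (sqn_ge0 z) zr; rewrite leNgt r0.
have rr : - r <= r by lra.
suff [M HM] : exists M : R, forall x y : R,
    - r <= x <= r -> - r <= y <= r -> normc (G (x +i* y)) <= M.
  by exists M => -[x y]; rewrite sqnE => /andP[]; exact: HM.
apply: (@rect_bisection R (fun a b c d : R => exists M : R, forall x y : R,
    a <= x <= b -> c <= y <= d -> normc (G (x +i* y)) <= M)) => //; last first.
- move=> x y _ _; have [u u0 Hu] := Gc (x +i* y) _ ltr01.
  exists (u / 2); first by rewrite divr_gt0.
  move=> a b c d _ axb _ _ cyd _ ba dc; exists (normc (G (x +i* y)) + 1) => s t sP tP.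
  have : normc (s +i* t - (x +i* y)) < u.
    apply: le_lt_trans (normc_leReIm _) _; rewrite cReB cImB /=.
    have h1 : `|s - x| < u / 2 by rewrite ltr_norml; lra.
    have h2 : `|t - y| < u / 2 by rewrite ltr_norml; lra.
    by have := ltrD h1 h2; lra.
  move=> /Hu; have := normc_triB (G (s +i* t)) (G (x +i* y)); lra.
- move=> a b c d _ _ _ _ _ _ [M1 H1] [M2 H2] [M3 H3] [M4 H4].
  exists (Num.max (Num.max M1 M2) (Num.max M3 M4)) => x y /andP[ax xb] /andP[cy yd].
  rewrite !le_max; have [xm|/ltW mx] := leP x ((a + b) / 2);
    have [yn|/ltW ny] := leP y ((c + d) / 2).
  + by rewrite H1 ?ax ?cy.
  + by rewrite H3 ?ax ?ny ?orbT.
  + by rewrite H2 ?mx ?cy ?orbT.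
  + by rewrite H4 ?mx ?ny ?orbT.
Qed.

Lemma ktrans2_1 r b : sqn b < r -> ktrans2 (fun=> 1) r b = 0.
Proof.
move=> br; have r0 : 0 <= r := le_trans (sqn_ge0 b) (ltW br).
have rr : - r <= r by lra.
have c1 : lcont (fun=> 1 : C) r by move=> z _; exact: cont_at_cst.
apply: (@rint_primitive _ (fun z => (-1) * (z - b)^-1)) => //.
  by apply: lcont_bdcont => //; exact: lcont_k2.
apply: on_bd_sqn => // z zr.
rewrite mul1r -invfM -expr2 (_ : (_ ^+ 2)^-1 = -1 * (- 1 / (z - b) ^+ 2)); last first.
  by field; exact: bd_neq zr.
apply/cdiffZ/cdiffV; first exact: bd_neq zr.
have -> : (1 : C) = 1 - 0 by rewrite subr0.
by apply: cdiffB; [exact: cdiff_id|exact: cdiff_cst].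
Qed.

(** Stands for 2 pi i; the lower bound [kappa_ge] replaces the exact value. *)
Definition kappa r := ktrans (fun=> 1 : C) r 0.

(** Along the segment from 0 to [a] the derivative is [ktrans2] of the constant 1, which vanishes
    because its kernel has a primitive. *)
Lemma ktrans1_const r a : sqn a < r -> ktrans (fun=> 1) r a = kappa r.
Proof.
move=> ar; have c1 : lcont (fun=> 1 : C) r by move=> z _; exact: cont_at_cst.
pose p (s : R) := ktrans (fun=> 1) r (0 + s%:C * a).
have sa (s : R) : 0 <= s <= 1 -> sqn (0 + s%:C * a) < r.
  move=> /andP[s0 s1]; apply: le_lt_trans ar; rewrite add0r.
  have E : sqn (s%:C * a) = s * sqn a.
    by rewrite /sqn cReM cImM /= !mul0r subr0 addr0 !normrM (ger0_norm s0) maxr_pMr.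
  by rewrite E ler_piMl ?sqn_ge0.
have := @rderiv_bound R p (fun=> 0) 0 1 0 ler01.
rewrite mulr0 mul0r => H.
have : normc (p 1 - p 0) <= 0.
  apply: H => [t t01|t _]; last by rewrite normc0.
  have := @cdiff_line R (ktrans (fun=> 1) r) 0 a t _
    (@ktrans_cdiff R (fun=> 1) r (0 + t%:C * a) 1 (sa _ t01) c1 _).
  rewrite ktrans2_1 ?sa // mul0r; apply=> z _.
  by rewrite normc1.
rewrite le_eqVlt ltNge normc_ge0 orbF => /eqP /eq0_normc /eqP.
by rewrite subr_eq0 /p mul1r !add0r mul0r => /eqP.
Qed.

Lemma cint_Im_ge (p : R -> C) (u v m : R) : u <= v -> (forall t, rcont p t) ->
  (forall t, u <= t <= v -> m <= Im (p t)) -> m * (v - u) <= Im (cint p u v).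
Proof.
move=> uv pc pm; rewrite /cint cImB.
apply: (@is_derive_ge _ (fun s => Im (prim p s)) (fun s => Im (p s))) => // t _.
by have [] := primP pc t.
Qed.

Lemma cint_Im_le (p : R -> C) (u v m : R) : u <= v -> (forall t, rcont p t) ->
  (forall t, u <= t <= v -> Im (p t) <= m) -> Im (cint p u v) <= m * (v - u).
Proof.
move=> uv pc pm; rewrite /cint cImB.
apply: (@is_derive_le _ (fun s => Im (prim p s)) (fun s => Im (p s))) => // t _.
by have [] := primP pc t.
Qed.

Lemma cint_Re_ge (p : R -> C) (u v m : R) : u <= v -> (forall t, rcont p t) ->
  (forall t, u <= t <= v -> m <= Re (p t)) -> m * (v - u) <= Re (cint p u v).
Proof.
move=> uv pc pm; rewrite /cint cReB.
apply: (@is_derive_ge _ (fun s => Re (prim p s)) (fun s => Re (p s))) => // t _.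
by have [] := primP pc t.
Qed.

Lemma cint_Re_le (p : R -> C) (u v m : R) : u <= v -> (forall t, rcont p t) ->
  (forall t, u <= t <= v -> Re (p t) <= m) -> Re (cint p u v) <= m * (v - u).
Proof.
move=> uv pc pm; rewrite /cint cReB.
apply: (@is_derive_le _ (fun s => Re (prim p s)) (fun s => Re (p s))) => // t _.
by have [] := primP pc t.
Qed.

Lemma cReV (x y : R) : Re (x +i* y)^-1 = x / (x ^+ 2 + y ^+ 2).
Proof. by []. Qed.

Lemma cImV (x y : R) : Im (x +i* y)^-1 = - (y / (x ^+ 2 + y ^+ 2)).
Proof. by []. Qed.

(** Each of the four sides contributes at least 1 to the imaginary part: the integrand is at least 1
    / (2 r) on a side of length 2 r. *)
Lemma kappa_ge r : 0 < r -> 4 <= normc (kappa r).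
Proof.
move=> r0; apply: le_trans (normc_Im _); apply: le_trans (ler_norm _).
have c1 : lcont (fun=> 1 : C) r by move=> z _; exact: cont_at_cst.
have k1 : lcont (fun z => 1 * (z - 0)^-1) r by apply: lcont_k; rewrite ?sqn0.
have [b1 b2 b3 b4] := lcont_bdcont (ltW r0) k1.
have rr : - r <= r by lra.
have bnd (t : R) : - r <= t <= r -> (2 * r)^-1 <= r / (r ^+ 2 + t ^+ 2).
  move=> /andP[t1 t2]; have d0 : 0 < r ^+ 2 + t ^+ 2.
    by rewrite ltr_wpDr ?sqr_ge0 // exprn_gt0.
  rewrite ler_pdivlMr // mulrC ler_pdivrMr ?mulr_gt0 //; nra.
have one : (2 * r)^-1 * (r - - r) = 1 by rewrite opprK; field; rewrite gt_eqF.
have mone : - (2 * r)^-1 * (r - - r) = -1 by rewrite mulNr one.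
have h1 : 1 <= Im (cint (fun s => 1 * (s +i* (- r) - 0)^-1) (- r) r).
  rewrite -one; apply: cint_Im_ge => // t /bnd.
  by rewrite mul1r subr0 cImV sqrrN mulNr opprK addrC.
have h2 : 1 <= Re (cint (fun s => 1 * (r +i* s - 0)^-1) (- r) r).
  by rewrite -one; apply: cint_Re_ge => // t /bnd; rewrite mul1r subr0 cReV.
have h3 : Im (cint (fun s => 1 * (s +i* r - 0)^-1) (- r) r) <= -1.
  rewrite -mone; apply: cint_Im_le => // t /bnd.
  by rewrite mul1r subr0 cImV lerN2 addrC.
have h4 : Re (cint (fun s => 1 * ((- r) +i* s - 0)^-1) (- r) r) <= -1.
  rewrite -mone; apply: cint_Re_le => // t /bnd.
  by rewrite mul1r subr0 cReV sqrrN mulNr lerN2.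
have ImI z : Im (I * z) = Re z by rewrite cImM /= mul0r mul1r add0r.
rewrite /kappa /ktrans /sint /rint 2!cImB cImD !ImI; lra.
Qed.

Lemma kappa_neq0 r : 0 < r -> kappa r != 0.
Proof.
by move=> /kappa_ge h; rewrite -normc_gt0; apply: lt_le_trans h.
Qed.

Definition slope f a d z := if z == a then d else (f z - f a) / (z - a).

Lemma slope_cont f a d : cont f -> cdiff f a d -> cont (slope f a d).
Proof.
move=> fc [p [pc pd fE]] z.
have slopeE w : w != a -> slope f a d w = (f w - f a) * (w - a)^-1.
  by rewrite /slope => /negPf ->.
have [->|za] := eqVneq z a.
- apply: (@cont_at_near _ p _ _ 1) => // w _; rewrite /slope.
  by case: eqVneq => [-> //|wa]; rewrite fE mulfK // subr_eq0.
- apply: (@cont_at_near _ (fun w => (f w - f a) * (w - a)^-1) _ _ (normc (z - a))).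
  + by rewrite normc_gt0 subr_eq0.
  + move=> w wz; rewrite slopeE //; apply: contraTneq wz => ->.
    by rewrite normcB ltxx.
  + apply: cont_atM; first by apply: cont_atB => //; exact: cont_at_cst.
    apply: cont_atV; first by rewrite subr_eq0.
    by apply: cont_atB; [exact: cont_at_id|exact: cont_at_cst].
Qed.

Lemma slope_cdiff f a d z e : z != a -> cdiff f z e ->
  exists e', cdiff (slope f a d) z e'.
Proof.
move=> za fz; have za0 : z - a != 0 by rewrite subr_eq0.
have h1 : cdiff (fun w => w - a) z (1 - 0).
  by apply: cdiffB; [exact: cdiff_id|exact: cdiff_cst].
have h2 : cdiff (fun w => f w - f a) z (e - 0).
  by apply: cdiffB => //; exact: cdiff_cst.
have h := cdiffM h2 (@cdiffV R (fun w => w - a) z _ za0 h1); eexists.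
apply: (@cdiff_near _ _ _ _ _ (normc (z - a)) _ _ h); first by rewrite normc_gt0.
move=> w wz; rewrite /slope ifN //; apply: contraTneq wz => ->.
by rewrite normcB ltxx.
Qed.

(** [sint_except] is applied to the slope of [G] at [a], which is continuous at [a] and
    differentiable elsewhere; expanding the vanishing integral gives the formula. *)
Lemma cauchy G r a : cont G -> holo_on G r -> sqn a < r ->
  ktrans G r a = G a * kappa r.
Proof.
move=> Gc Gh ar; have r0 : 0 <= r := le_trans (sqn_ge0 a) (ltW ar).
have [d Gd] := Gh a (ltW ar).
have := @sint_except R (slope G a d) a r (slope_cont Gc Gd) ar.
have Hs : forall z, sqn z <= r -> z != a -> exists d0, cdiff (slope G a d) z d0.
  by move=> z zr za; have [e Ge] := Gh z zr; apply: slope_cdiff Ge.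
have c1 : lcont (fun=> 1 : C) r by move=> z _; exact: cont_at_cst.
move=> /(_ Hs); rewrite -(@ktrans1_const r a ar) => H.
have := @sint_sub R (fun z => G z * (z - a)^-1) (fun z => G a * (1 * (z - a)^-1))
  (slope G a d) 1 r r0 (lcont_k ar (cont_lcont Gc)).
rewrite H mulr0 sintZ //; last exact: lcont_k.
move=> h; apply/eqP; rewrite -subr_eq0; apply/eqP; apply: h.
- by move=> z zr; apply: cont_atM; [exact: cont_at_cst|exact: (lcont_k ar c1 zr)].
- by apply: cont_lcont; exact: slope_cont.
- move=> z zr; rewrite /slope ifN; first by ring.
  by rewrite -subr_eq0; exact: bd_neq zr.
Qed.

(** A maximum principle read off Cauchy's formula: on the half square the kernel is at most 2 / r,
    so the integral is at most 32 M, and [kappa] divides by at least 4. *)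
Lemma weak_max G r M a : cont G -> holo_on G r -> 0 < r ->
  (forall z, sqn z = r -> normc (G z) <= M) -> sqn a <= r / 2 ->
  normc (G a) <= 8 * M.
Proof.
move=> Gc Gh r0 GM ar2; have ar : sqn a < r by lra.
have k4 := kappa_ge r0.
have : normc (ktrans G r a) <= 16 * (M * (2 / r)) * r.
  apply: sint_bound; [exact: ltW|by apply: lcont_k => //; exact: cont_lcont|].
  move=> z zr; rewrite normcM normcV; apply: ler_pM;
    rewrite ?normc_ge0 ?invr_ge0 ?normc_ge0 ?GM //.
  have h := dist_bd a zr.
  rewrite -[2 / r]invf_div lef_pV2 ?posrE ?divr_gt0 //; last by apply: lt_le_trans h; lra.
  by apply: le_trans h; lra.
rewrite (cauchy Gc Gh ar) normcM.
rewrite [leRHS](_ : _ = 8 * M * 4); last by field; rewrite gt_eqF.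
move=> h; rewrite -(@ler_pM2r _ 4) //; apply: le_trans h.
by rewrite ler_wpM2l ?normc_ge0.
Qed.

Lemma cdiff_cauchy G r a : cont G -> holo_on G r -> sqn a < r ->
  cdiff G a (ktrans2 G r a / kappa r) /\
  exists d, cdiff (fun b => ktrans2 G r b / kappa r) a d.
Proof.
move=> Gc Gh ar; have r0 : 0 < r := le_lt_trans (sqn_ge0 a) ar.
have [M HM] := bounded_square r Gc.
have GM z : sqn z = r -> normc (G z) <= M by move=> zr; apply: HM; rewrite zr.
have k0 := kappa_neq0 r0.
split.
  have := cdiffZ (kappa r)^-1 (ktrans_cdiff ar (cont_lcont Gc) GM).
  rewrite mulrC; apply: (@cdiff_near _ _ _ _ _ ((r - sqn a) / 2)).
    by rewrite divr_gt0 // subr_gt0.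
  move=> w wa; rewrite cauchy //; first by rewrite mulrC mulfK.
  have := sqn_triB w a; have := sqn_le_normc (w - a); lra.
have [d Hd] := ktrans2_cdiff ar (cont_lcont Gc) GM.
exists ((kappa r)^-1 * d); have := cdiffZ (kappa r)^-1 Hd.
by apply: cdiff_ext => w; rewrite mulrC.
Qed.

Lemma cauchy_estimate G r M d : cont G -> holo_on G r -> 0 < r ->
  (forall z, sqn z = r -> normc (G z) <= M) -> cdiff G 0 d ->
  normc d <= 4 * M / r.
Proof.
move=> Gc Gh r0 GM Gd; have z0 : sqn (0 : C) < r by rewrite sqn0.
have [Gd' _] := cdiff_cauchy Gc Gh z0; rewrite (cdiff_uniq Gd Gd').
have k4 := kappa_ge r0.
rewrite normcM normcV ler_pdivrMr; last by apply: lt_le_trans k4.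
have : normc (ktrans2 G r 0) <= 16 * (M * (r^-1 * r^-1)) * r.
  apply: sint_bound; [exact: ltW|by apply: lcont_k2 => //; exact: cont_lcont|].
  move=> z zr; have zr' : normc (z - 0)^-1 <= r^-1.
    rewrite normcV subr0; have h := sqn_le_normc z; rewrite zr in h.
    by rewrite lef_pV2 ?posrE //; apply: lt_le_trans h.
  rewrite !normcM; apply: ler_pM; rewrite ?mulr_ge0 ?normc_ge0 ?GM //.
  by apply: ler_pM; rewrite ?normc_ge0.
rewrite [X in _ <= X -> _](_ : _ = 4 * M / r * 4); last by field; rewrite gt_eqF.
move=> h; apply: le_trans h _; rewrite ler_wpM2l //.
rewrite divr_ge0 ?(ltW r0) // mulr_ge0 //.
have E : sqn (r%:C) = r by rewrite /sqn /= normr0 gtr0_norm // max_l // ltW.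
by apply: le_trans (normc_ge0 _) (GM _ E).
Qed.

End CauchyFormula.

(** * Entire functions *)

Section EntireFunctions.
Context {R : realType}.
Local Notation C := R[i].
Local Notation D f := (derive1 ((f : C -> C) : C^o -> C^o)).
Implicit Types (r s t M : R) (f g G : C -> C) (z w a b c d : C).

Definition hol f := forall z, exists d, cdiff f z d.

Lemma entireP f : entire f <-> hol f.
Proof.
split=> fh z; first by eexists; exact: derivable_cdiff (fh z).
by have [d fd] := fh z; exact: (cdiff_derivable fd).1.
Qed.

Lemma cdiff_D f z d : cdiff f z d -> D f z = d.
Proof. by move=> /cdiff_derivable []. Qed.

Lemma hol_cdiff f z : hol f -> cdiff f z (D f z).
Proof. by move=> /(_ z) [d fd]; rewrite (cdiff_D fd). Qed.

Lemma hol_cont f : hol f -> cont f.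
Proof. by move=> fh z; have [d fd] := fh z; exact: cdiff_cont fd. Qed.

Lemma hol_on f r : hol f -> holo_on f r.
Proof. by move=> fh z _; exact: fh. Qed.

Lemma hol_ext f g : f =1 g -> hol f -> hol g.
Proof. by move=> /funext ->. Qed.

Lemma hol_cst c : hol (fun=> c).
Proof. by move=> z; exists 0; exact: cdiff_cst. Qed.

Lemma hol_id : hol id.
Proof. by move=> z; exists 1; exact: cdiff_id. Qed.

Lemma holD f g : hol f -> hol g -> hol (fun z => f z + g z).
Proof.
by move=> fh gh z; exists (D f z + D g z); apply: cdiffD; exact: hol_cdiff.
Qed.

Lemma holN f : hol f -> hol (fun z => - f z).
Proof. by move=> fh z; exists (- D f z); apply: cdiffN; exact: hol_cdiff. Qed.

Lemma holB f g : hol f -> hol g -> hol (fun z => f z - g z).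
Proof. by move=> fh gh; apply: holD => //; exact: holN. Qed.

Lemma holM f g : hol f -> hol g -> hol (fun z => f z * g z).
Proof.
move=> fh gh z; exists (D f z * g z + f z * D g z).
by apply: cdiffM; exact: hol_cdiff.
Qed.

Lemma holZ c f : hol f -> hol (fun z => c * f z).
Proof. by move=> fh; apply: holM => //; exact: hol_cst. Qed.

Lemma holX f n : hol f -> hol (fun z => f z ^+ n).
Proof.
move=> fh; elim: n => [|n IH]; first by apply: hol_ext (hol_cst 1) => z.
by apply: hol_ext (holM fh IH) => z; rewrite exprS.
Qed.

Lemma hol_sum (T : Type) (s : seq T) (F : T -> C -> C) :
  (forall i, hol (F i)) -> hol (fun z => \sum_(i <- s) F i z).
Proof.
move=> Fh; elim: s => [|i s IH].
  by apply: hol_ext (hol_cst 0) => z; rewrite big_nil.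
by apply: hol_ext (holD (Fh i) IH) => z; rewrite big_cons.
Qed.

Lemma cdiff_shift f c z d : cdiff f (z + c) d -> cdiff (fun w => f (w + c)) z d.
Proof.
move=> fd; rewrite -[d]mulr1; apply: (@cdiff_comp _ (fun w => w + c) f) => //.
have -> : (1 : C) = 1 + 0 by rewrite addr0.
by apply: cdiffD; [exact: cdiff_id|exact: cdiff_cst].
Qed.

Lemma hol_shift f c : hol f -> hol (fun z => f (z + c)).
Proof. by move=> fh z; have [d fd] := fh (z + c); exists d; exact: cdiff_shift. Qed.

Lemma D_shift f c z : hol f -> D (fun w => f (w + c)) z = D f (z + c).
Proof. by move=> fh; apply: cdiff_D; apply: cdiff_shift; exact: hol_cdiff. Qed.

Lemma cauchy_near f r a : hol f -> sqn a < r ->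
  f a = ktrans f r a / kappa r /\ D f a = ktrans2 f r a / kappa r.
Proof.
move=> fh ar; have r0 : 0 < r := le_lt_trans (sqn_ge0 a) ar.
have k0 := kappa_neq0 r0; split.
  by rewrite (cauchy (hol_cont fh) (hol_on fh)) // mulfK.
by have [/cdiff_D] := cdiff_cauchy (hol_cont fh) (hol_on fh (r:=r)) ar.
Qed.

Lemma sqn_near a r : sqn a < r ->
  forall w, normc (w - a) < r - sqn a -> sqn w < r.
Proof.
by move=> ar w wa; have := sqn_triB w a; have := sqn_le_normc (w - a); lra.
Qed.

Lemma hol_D f : hol f -> hol (D f).
Proof.
move=> fh a; pose r := sqn a + 1; have ar : sqn a < r by rewrite ltrDl.
have [_ [d Hd]] := cdiff_cauchy (hol_cont fh) (hol_on fh (r:=r)) ar.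
exists d; apply: (@cdiff_near _ _ _ _ _ (r - sqn a) _ _ Hd); first by rewrite subr_gt0.
by move=> w /(sqn_near ar) wr; have [_ ->] := cauchy_near fh wr.
Qed.

Definition hslope f a := slope f a (D f a).

Lemma hslopeE f a z : f z = f a + (z - a) * hslope f a z.
Proof.
rewrite /hslope /slope; case: eqVneq => [->|za]; first by rewrite subrr mul0r addr0.
by rewrite mulrC divfK ?subr_eq0 // addrC subrK.
Qed.

(** Removable singularity. Subtracting Cauchy's formulas at [w] and [a] shows that inside a large
    square the slope is the Cauchy transform of f / (z - a), up to [kappa]; this covers the value at
    [a] too. *)
Lemma hol_hslope f a : hol f -> hol (hslope f a).
Proof.
move=> fh z; pose r := Num.max (sqn a) (sqn z) + 1.
have ar : sqn a < r by rewrite /r ltr_pwDr // le_max lexx.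
have zr : sqn z < r by rewrite /r ltr_pwDr // le_max lexx orbT.
have r0 : 0 <= r := le_trans (sqn_ge0 a) (ltW ar).
have [M HM] := bounded_square r (hol_cont fh).
have fc : lcont f r by apply: cont_lcont; exact: hol_cont.
pose psi w := f w * (w - a)^-1.
have pc : lcont psi r by exact: lcont_k.
have pM w : sqn w = r -> normc (psi w) <= M * (2 / (r - sqn a)).
  move=> wr; have aa : normc (a - a) < (r - sqn a) / 2.
    by rewrite subrr normc0 divr_gt0 // subr_gt0.
  have [k1 _ _] := kernel_bound ar aa wr.
  by rewrite /psi normcM; apply: ler_pM; rewrite ?normc_ge0 ?HM ?wr.
have E w : sqn w < r -> hslope f a w = (kappa r)^-1 * ktrans psi r w.
  move=> wr; have [fa Dfa] := cauchy_near fh ar; have [fw _] := cauchy_near fh wr.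
  rewrite /hslope /slope; case: eqVneq => [->|wa].
    rewrite Dfa mulrC; congr (_ * _); rewrite /ktrans2 /ktrans; congr (sint _ _).
    by apply/funext => u; rewrite /psi mulrA.
  have w0 : w - a != 0 by rewrite subr_eq0.
  rewrite fw fa -mulrBl.
  have -> : ktrans f r w - ktrans f r a = (w - a) * ktrans psi r w.
    apply: sint_sub; [exact: r0|exact: lcont_k|exact: lcont_k|exact: (lcont_k wr pc)|].
    by move=> u ur; rewrite /psi; field; rewrite !(@bd_neq _ _ r).
  have k0 := kappa_neq0 (le_lt_trans (sqn_ge0 a) ar).
  by field; rewrite w0 k0.
exists ((kappa r)^-1 * ktrans2 psi r z).
apply: (@cdiff_near _ _ _ _ _ (r - sqn z) _ _ (cdiffZ _ (ktrans_cdiff zr pc pM))).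
  by rewrite subr_gt0.
by move=> w /(sqn_near zr) wr; rewrite E.
Qed.

Lemma hol_weak_max f c r M a : hol f -> 0 < r ->
  (forall z, sqn (z - c) = r -> normc (f z) <= M) -> sqn (a - c) <= r / 2 ->
  normc (f a) <= 8 * M.
Proof.
move=> fh r0 fM ac; have gh := hol_shift c fh; rewrite -(subrK c a).
apply: (weak_max (hol_cont gh) (hol_on gh) r0) => // z zr.
by apply: fM; rewrite addrK.
Qed.

Lemma hol_cauchy_estimate f c r M : hol f -> 0 < r ->
  (forall z, sqn (z - c) = r -> normc (f z) <= M) ->
  normc (D f c) <= 4 * M / r.
Proof.
move=> fh r0 fM; have gh := hol_shift c fh.
apply: (@cauchy_estimate _ (fun z => f (z + c))) => //.
- exact: hol_cont.
- by move=> z zr; apply: fM; rewrite addrK.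
- by apply: cdiff_shift; rewrite add0r; exact: hol_cdiff.
Qed.

(** [taylor f n 0] is the n-th Taylor coefficient, and [taylor f n z] is the n-th remainder divided
    by z^n. *)
Fixpoint taylor f n := if n is n'.+1 then hslope (taylor f n') 0 else f.

Lemma hol_taylor f n : hol f -> hol (taylor f n).
Proof. by move=> fh; elim: n => [//|n IH] /=; exact: hol_hslope. Qed.

Lemma taylorE f N z :
  f z = \sum_(m < N) taylor f m 0 * z ^+ m + z ^+ N * taylor f N z.
Proof.
elim: N => [|N IH]; first by rewrite big_ord0 expr0 mul1r add0r.
rewrite {1}IH big_ord_recr /= -addrA; congr (_ + _).
by rewrite {1}(hslopeE (taylor f N) 0 z) subr0 exprS; ring.
Qed.

(** Each slope divides by |z| >= r a difference of a boundary value and a value at 0, the latter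
    costing the factor 8 of the maximum principle: 9 = 1 + 8. *)
Lemma taylor_bound f r M : hol f -> 0 < r ->
  (forall z, sqn z = r -> normc (f z) <= M) ->
  forall n z, sqn z = r -> normc (taylor f n z) <= (9 / r) ^+ n * M.
Proof.
move=> fh r0 fM; elim=> [|n IH] z zr; first by rewrite expr0 mul1r fM.
have h0 : normc (taylor f n 0) <= 8 * ((9 / r) ^+ n * M).
  apply: (@hol_weak_max _ 0 r); [exact: hol_taylor|exact: r0| |].
  - by move=> w; rewrite subr0; exact: IH.
  - by rewrite subr0 sqn0 divr_ge0 // ltW.
have zr' : r <= normc z by rewrite -zr; exact: sqn_le_normc.
have z0 : z != 0 by rewrite -normc_gt0; apply: lt_le_trans zr'.
rewrite /= /hslope /slope (negPf z0) subr0 normcM normcV.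
rewrite ler_pdivrMr; last by apply: lt_le_trans zr'.
have h1 : normc (taylor f n z - taylor f n 0) <= 9 * ((9 / r) ^+ n * M).
  apply: le_trans (le_normcD _ _) _; rewrite normcN.
  by have := IH z zr; lra.
apply: le_trans h1 _.
have B0 : 0 <= (9 / r) ^+ n * M := le_trans (normc_ge0 _) (IH z zr).
rewrite [leRHS](_ : _ = 9 * ((9 / r) ^+ n * M) * (normc z / r)).
  apply: ler_peMr; first by rewrite mulr_ge0.
  by rewrite ler_pdivlMr // mul1r.
by rewrite exprS; ring.
Qed.

Lemma taylor_bound_in f r M : hol f -> 0 < r ->
  (forall z, sqn z = r -> normc (f z) <= M) ->
  forall n z, sqn z <= r / 2 -> normc (taylor f n z) <= 8 * ((9 / r) ^+ n * M).
Proof.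
move=> fh r0 fM n z zr.
apply: (@hol_weak_max _ 0 r); [exact: hol_taylor|exact: r0| |by rewrite subr0].
by move=> w; rewrite subr0; exact: taylor_bound.
Qed.

Lemma le0_geom (x B : R) : (forall n, x <= B / 2 ^+ n) -> x <= 0.
Proof.
move=> H; rewrite leNgt; apply/negP => x0.
by have [n Hn] := exp2_unbounded B x0; have := le_lt_trans (H n) Hn; rewrite ltxx.
Qed.

(** All Taylor coefficients vanish, so f z is its own remainder of every order, and the remainder
    tends to 0 once the contour is large compared with [z]. *)
Lemma hol_zero_near0 f r : hol f -> 0 < r ->
  (forall z, normc z < r -> f z = 0) -> forall z, f z = 0.
Proof.
move=> fh r0 f0 z.
have T n : forall w, normc w < r -> taylor f n w = 0.
  elim: n => [//|n IH] w wr /=; rewrite /hslope /slope.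
  have n0 : normc (0 : C) < r by rewrite normc0.
  case: eqVneq => [_|w0]; last by rewrite (IH w wr) (IH 0 n0) subrr mul0r.
  apply: cdiff_D; apply: (@cdiff_near _ (fun=> 0) _ _ _ r) => //.
    by move=> u; rewrite subr0 => /IH ->.
  exact: cdiff_cst.
(* As |z| <= 2 [sqn z], the ratio |z| * 9 / q is at most 1/2. *)
pose q := 36 * (sqn z + 1).
have q0 : 0 < q by rewrite mulr_gt0 // ltr_wpDl ?sqn_ge0.
have [M HM] := bounded_square q (hol_cont fh).
have M0 : 0 <= M.
  by apply: le_trans (normc_ge0 _) (HM 0 _); rewrite sqn0 ltW.
apply: eq0_normc; apply/eqP; rewrite eq_le normc_ge0 andbT.
apply: (@le0_geom _ (8 * M)) => n.
have fE : f z = z ^+ n * taylor f n z.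
  rewrite {1}(taylorE f n z) big1 ?add0r // => m _.
  by rewrite T ?mul0r // normc0.
rewrite fE normcM normcX.
have zq : sqn z <= q / 2 by rewrite /q; have := sqn_ge0 z; lra.
have Mq w : sqn w = q -> normc (f w) <= M by move=> wq; apply: HM; rewrite wq.
have h := taylor_bound_in fh q0 Mq n zq.
apply: le_trans (ler_wpM2l _ h) _; first by rewrite exprn_ge0 ?normc_ge0.
rewrite [leLHS](_ : _ = 8 * M * (normc z * (9 / q)) ^+ n); last first.
  by rewrite [(normc z * _) ^+ n]exprMn; move: (normc z ^+ n) ((9 / q) ^+ n) => x y; ring.
have q9 : 0 <= normc z * (9 / q).
  by apply: mulr_ge0; [exact: normc_ge0|rewrite divr_ge0 // ltW].
rewrite ler_wpM2l ?mulr_ge0 // -exprVn lerXn2r ?nnegrE //.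
rewrite mulrA ler_pdivrMr //; have := normc_le_sqn z; rewrite /q; lra.
Qed.

Lemma hol_zero_near f a r : hol f -> 0 < r ->
  (forall z, normc (z - a) < r -> f z = 0) -> forall z, f z = 0.
Proof.
move=> fh r0 f0 z; rewrite -(subrK a z).
apply: (@hol_zero_near0 (fun z => f (z + a)) r) => //; first exact: hol_shift.
by move=> w wr; apply: f0; rewrite addrK.
Qed.

Lemma cont_neq0_near f a : cont_at f a -> f a != 0 ->
  exists2 r : R, 0 < r & forall z, normc (z - a) < r -> f z != 0.
Proof.
move=> fc fa; have fa0 : 0 < normc (f a) by rewrite normc_gt0.
have [r r0 Hr] := fc _ fa0; exists r => // z /Hr; apply: contraTneq => ->.
by rewrite sub0r normcN ltxx.
Qed.

Lemma hol_mul_eq0 f g : hol f -> hol g -> (forall z, f z * g z = 0) ->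
  (forall z, f z = 0) \/ (forall z, g z = 0).
Proof.
move=> fh gh fg; have [f0|] := pselect (forall z, f z = 0); first by left.
move=> /existsNP [a /eqP fa]; right.
have [r r0 Hr] := cont_neq0_near (hol_cont fh a) fa.
apply: (hol_zero_near gh r0 (a := a)) => z /Hr fz.
by have /eqP := fg z; rewrite mulf_eq0 (negPf fz) => /eqP.
Qed.

(** Near [a] the quotient f / g has derivative 0, hence is constant; the identity theorem extends
    the proportionality to the plane. *)
Lemma hol_proportional f g a : hol f -> hol g -> g a != 0 ->
  (forall z, D f z * g z = f z * D g z) -> forall z, f z = f a / g a * g z.
Proof.
move=> fh gh ga W.
pose t := f a / g a.
suff : forall z, f z - t * g z = 0 by move=> H z; apply/eqP; rewrite -subr_eq0 H.
have [r r0 Hr] := cont_neq0_near (hol_cont gh a) ga.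
apply: (hol_zero_near (holB fh (holZ t gh)) r0 (a := a)) => z zr.
pose q w := f w * (g w)^-1.
have qd w : g w != 0 -> cdiff q w 0.
  move=> gw; have := cdiffM (hol_cdiff w fh) (cdiffV gw (hol_cdiff w gh)).
  rewrite (_ : _ + _ = 0) //.
  have -> : D f w = f w * D g w / g w by rewrite -W mulfK.
  by field.
pose p (s : R) := q (a + s%:C * (z - a)).
have := @rderiv_bound R p (fun=> 0) 0 1 0 ler01.
rewrite mulr0 mul0r => H.
have : normc (p 1 - p 0) <= 0.
  apply: H => [s /andP[s0 s1]|s _]; last by rewrite normc0.
  have := @cdiff_line R q a (z - a) s 0; rewrite mul0r; apply; apply: qd.
  apply: Hr; rewrite addrC addKr normcM normc_real ger0_norm //.
  by apply: le_lt_trans zr; rewrite ler_piMl ?normc_ge0.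
rewrite le_eqVlt ltNge normc_ge0 orbF => /eqP /eq0_normc /eqP.
rewrite subr_eq0 /p /q mul1r mul0r addr0 addrC subrK => /eqP E.
have gz : g z != 0 by exact: Hr.
by rewrite /t -E divfK ?subrr.
Qed.

Lemma liouville_poly f (K : nat) (B : R) : hol f -> 
  (forall r, 1 <= r -> forall z, sqn z <= r -> normc (f z) <= B * r ^+ K) ->
  is_polynomial f.
Proof.
move=> fh fB.
have T0 z : taylor f K.+1 z = 0.
  apply: eq0_normc; apply/eqP; rewrite eq_le normc_ge0 andbT.
  apply/ler_addgt0Pr => e e0; rewrite add0r.
  have B0 : 0 <= B.
    have := le_trans (normc_ge0 _) (fB 1 (lexx _) 0 _).
    by rewrite expr1n mulr1; apply; rewrite sqn0.
  (* The second term puts [z] in the half square, and the last one makes the remainder bound 8 *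
     9^(K+1) B / r at most [e]. *)
  pose r := 1 + 2 * sqn z + 8 * 9 ^+ K.+1 * B / e.
  have z0 := sqn_ge0 z.
  have c0 : 0 <= 8 * 9 ^+ K.+1 * B / e by rewrite divr_ge0 ?mulr_ge0 ?exprn_ge0 // ltW.
  have r1 : 1 <= r by rewrite /r; lra.
  have r0 : 0 < r by lra.
  have zr : sqn z <= r / 2 by rewrite /r; lra.
  have Mr w : sqn w = r -> normc (f w) <= B * r ^+ K by move=> wr; apply: fB; rewrite ?wr.
  apply: le_trans (taylor_bound_in fh r0 Mr K.+1 zr) _.
  rewrite [leLHS](_ : _ = 8 * 9 ^+ K.+1 * B / r); last first.
    by rewrite expr_div_n exprS [r ^+ K.+1]exprS; field; rewrite !gt_eqF ?exprn_gt0.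
  rewrite ler_pdivrMr // [leRHS]mulrC -ler_pdivrMr // /r; lra.
exists (\poly_(m < K.+1) taylor f m 0) => z.
by rewrite {1}(taylorE f K.+1 z) T0 mulr0 addr0 horner_poly.
Qed.

End EntireFunctions.

(** * Maximum modulus and proximity function *)

Section CircleMaximum.
Context {R : realType}.
Local Notation C := R[i].
Implicit Types (r s t x y M : R) (f g G : C -> C) (z w : C).

Definition cis t : C := cos t +i* sin t.

Lemma cisD x y : cis (x + y) = cis x * cis y.
Proof.
by rewrite /cis cosD sinD; apply: ReIm_eq => /=; rewrite // addrC mulrC.
Qed.

Lemma cis0 : cis 0 = 1.
Proof. by rewrite /cis cos0 sin0. Qed.

Lemma normc_cis t : normc (cis t) = 1.
Proof. by rewrite /normc /= cos2Dsin2 sqrtr1. Qed.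

Lemma cisX t n : cis t ^+ n = cis (n%:R * t).
Proof.
elim: n => [|n IH]; first by rewrite expr0 mul0r cis0.
by rewrite exprS IH -cisD -natr1 mulrDl mul1r addrC.
Qed.

Lemma cis_neq1 t : 0 < t -> t < 2 * pi -> cis t != 1.
Proof.
move=> t0 t2; apply/eqP => /(congr1 (@complex.Re R)) /=.
have -> : t = t / 2 + t / 2 by rewrite -splitr.
have := cos2Dsin2 (t / 2); rewrite cosD.
have : 0 < sin (t / 2) by apply: sin_gt0_pi; lra.
move=> s0; move: (cos _) s0 => u; move: (sin _) => v v0; nra.
Qed.

Definition omega N : C := cis (2 * pi / N%:R).

Lemma omegaXN N : (0 < N)%N -> omega N ^+ N = 1.
Proof.
move=> N0; rewrite /omega cisX mulrC divfK ?pnatr_eq0 -?lt0n //.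
by rewrite /cis mulr_natl mulr2n cosD (sinD pi pi) sinpi cospi; apply: ReIm_eq => /=; ring.
Qed.

Lemma omegaX_neq1 N m : (0 < m)%N -> (m < N)%N -> omega N ^+ m != 1.
Proof.
move=> m0 mN; have N0 : (0 < N)%N by apply: leq_trans mN.
have N0' : 0 < N%:R :> R by rewrite ltr0n.
have p0 := pi_gt0 R.
rewrite /omega cisX; apply: cis_neq1; first by rewrite mulr_gt0 ?ltr0n // divr_gt0 ?mulr_gt0.
by rewrite mulrCA gtr_pMr ?mulr_gt0 // ltr_pdivrMr // mul1r ltr_nat.
Qed.

Lemma sum_unity (u : C) N : u ^+ N = 1 -> u != 1 -> \sum_(j < N) u ^+ j = 0.
Proof.
move=> uN u1; have := subrX1 u N; rewrite uN subrr => /esym /eqP.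
by rewrite mulf_eq0 subr_eq0 (negPf u1) => /eqP.
Qed.

Lemma sum_omega N m : (0 < m)%N -> (m < N)%N ->
  \sum_(j < N) (omega N ^+ j) ^+ m = 0.
Proof.
move=> m0 mN; under eq_bigr do rewrite exprAC.
apply: sum_unity; last exact: omegaX_neq1.
by rewrite exprAC omegaXN ?expr1n //; apply: leq_trans mN.
Qed.

Lemma normc_omegaX N j : normc (omega N ^+ j) = 1.
Proof. by rewrite normcX normc_cis expr1n. Qed.

Lemma normc_sum (T : Type) (s : seq T) (F : T -> C) :
  normc (\sum_(i <- s) F i) <= \sum_(i <- s) normc (F i).
Proof.
elim: s => [|i s IH]; first by rewrite !big_nil normc0.
rewrite !big_cons; apply: le_trans (le_normcD _ _) _; exact: lerD.
Qed.

Lemma remainder_bound G r : hol G -> 0 < r -> exists B, forall N z,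
  normc z <= r -> normc (z ^+ N * taylor G N z) <= B / 2 ^+ N.
Proof.
(* With this contour the ratio |z| * 9 / q of the remainder estimate is at most 1/2. *)
move=> Gh r0; pose q := 18 * r.
have q0 : 0 < q by rewrite mulr_gt0.
have [M HM] := bounded_square q (hol_cont Gh).
exists (8 * M) => N z zr.
have M0 : 0 <= M.
  by apply: le_trans (normc_ge0 _) (HM 0 _); rewrite sqn0 ltW.
have zq : sqn z <= q / 2 by have := sqn_le_normc z; rewrite /q; lra.
have Mq w : sqn w = q -> normc (G w) <= M by move=> wq; apply: HM; rewrite wq.
have h := taylor_bound_in Gh q0 Mq N zq.
rewrite normcM normcX; apply: le_trans (ler_wpM2l _ h) _.
  by rewrite exprn_ge0 ?normc_ge0.
rewrite [leLHS](_ : _ = 8 * M * (normc z * (9 / q)) ^+ N); last first.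
  by rewrite [(normc z * _) ^+ N]exprMn; move: (normc z ^+ N) ((9 / q) ^+ N) => x y; ring.
have q9 : 0 <= normc z * (9 / q).
  by apply: mulr_ge0; [exact: normc_ge0|rewrite divr_ge0 // ltW].
rewrite ler_wpM2l ?mulr_ge0 // -exprVn lerXn2r ?nnegrE //.
rewrite mulrA ler_pdivrMr // /q; lra.
Qed.

(** A discrete mean value property: averaging over N points r omega^j kills the monomials of degrees
    1 to N - 1, and the Taylor remainder contributes at most B / 2^N. Unlike [weak_max] it keeps the
    constant 1, and it works on circles, where the proximity function lives. *)
Lemma mean_le G r M : hol G -> 0 < r ->
  (forall z, normc z = r -> normc (G z) <= M) -> normc (G 0) <= M.
Proof.
move=> Gh r0 GM; have [B HB] := remainder_bound Gh r0.
rewrite -subr_le0; apply: (@le0_geom _ _ B) => n; pose N := n.+1.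
pose zeta j : C := r%:C * omega N ^+ j.
have nz j : normc (zeta j) = r.
  by rewrite normcM normc_omegaX mulr1 normc_real gtr0_norm.
have E : \sum_(j < N) G (zeta j) =
    N%:R * G 0 + \sum_(j < N) zeta j ^+ N * taylor G N (zeta j).
  under eq_bigr do rewrite {1}(taylorE G N).
  rewrite big_split /=; congr (_ + _); rewrite exchange_big /=.
  rewrite (bigD1 (ord0 : 'I_N)) //= [X in _ + X]big1 ?addr0; last first.
    move=> i i0; rewrite -mulr_sumr; under eq_bigr do rewrite exprMn.
    by rewrite -mulr_sumr sum_omega ?mulr0 // lt0n.
  under eq_bigr do rewrite expr0 mulr1.
  by rewrite sumr_const card_ord mulr_natl.
have N0 : 0 < N%:R :> R by rewrite ltr0n.
have h1 : normc (\sum_(j < N) G (zeta j)) <= N%:R * M.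
  apply: le_trans (normc_sum _ _) _.
  apply: (@le_trans _ _ (\sum_(j < N) M)).
    by apply: ler_sum => j _; exact: GM.
  by rewrite sumr_const card_ord mulr_natl.
have h2 : normc (\sum_(j < N) zeta j ^+ N * taylor G N (zeta j)) <= N%:R * (B / 2 ^+ N).
  apply: le_trans (normc_sum _ _) _.
  apply: (@le_trans _ _ (\sum_(j < N) (B / 2 ^+ N))).
    by apply: ler_sum => j _; apply: HB; rewrite nz.
  by rewrite sumr_const card_ord mulr_natl.
have B0 : 0 <= B.
  have := HB 0%N 0; rewrite normc0 => /(_ (ltW r0)).
  by rewrite expr0 divr1; apply: le_trans; exact: normc_ge0.
have h3 : normc (N%:R * G 0) <= N%:R * (M + B / 2 ^+ N).
  rewrite (_ : N%:R * G 0 = \sum_(j < N) G (zeta j) -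
    \sum_(j < N) zeta j ^+ N * taylor G N (zeta j)); last by rewrite E addrK.
  by apply: le_trans (le_normcD _ _) _; rewrite normcN mulrDr lerD.
move: h3; rewrite normcM (_ : N%:R = (N%:R : R)%:C); last by rewrite rmorph_nat.
rewrite normc_real gtr0_norm // ler_pM2l // => h3.
have : B / 2 ^+ N <= B / 2 ^+ n.
  rewrite ler_wpM2l // lef_pV2 ?posrE ?exprn_gt0 //.
  by rewrite ler_weXn2l ?ler1n.
lra.
Qed.

(** By [mean_le] the Taylor coefficients are at most (2 / r)^n M, so for |z| <= r / 4 the series is
    dominated by a geometric one of ratio 1/2. *)
Lemma circle_max G r M z : hol G -> 0 < r ->
  (forall z, normc z = r -> normc (G z) <= M) -> normc z <= r / 4 ->
  normc (G z) <= 2 * M.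
Proof.
move=> Gh r0 GM zr; have [B HB] := remainder_bound Gh r0.
have T n w : normc w = r -> normc (taylor G n w) <= (2 / r) ^+ n * M.
  elim: n w => [|n IH] w wr; first by rewrite expr0 mul1r GM.
  have h0 : normc (taylor G n 0) <= (2 / r) ^+ n * M.
    by apply: (mean_le (hol_taylor n Gh) r0) => u; exact: IH.
  have w0 : w != 0 by rewrite -normc_gt0 wr.
  rewrite /= /hslope /slope (negPf w0) subr0 normcM normcV wr ler_pdivrMr //.
  apply: le_trans (le_normcD _ _) _; rewrite normcN.
  rewrite [leRHS](_ : _ = (2 / r) ^+ n * M + (2 / r) ^+ n * M).
    by apply: lerD => //; exact: IH.
  by rewrite exprS; field; rewrite gt_eqF.
have T0 n : normc (taylor G n 0) <= (2 / r) ^+ n * M.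
  by apply: (mean_le (hol_taylor n Gh) r0) => u; exact: T.
have M0 : 0 <= M by apply: le_trans (normc_ge0 _) (mean_le Gh r0 GM).
have geo N : \sum_(m < N) M / 2 ^+ m = 2 * M - 2 * M / 2 ^+ N.
  elim: N => [|N IH]; first by rewrite big_ord0 expr0 divr1 subrr.
  by rewrite big_ord_recr /= IH exprS; field; rewrite expf_neq0.
rewrite -subr_le0; apply: (@le0_geom _ _ B) => N.
rewrite (taylorE G N z).
have h1 : normc (\sum_(m < N) taylor G m 0 * z ^+ m) <= 2 * M.
  apply: le_trans (normc_sum _ _) _.
  apply: (@le_trans _ _ (\sum_(m < N) M / 2 ^+ m)).
    apply: ler_sum => m _; rewrite normcM normcX.
    apply: le_trans (ler_pM _ _ (T0 m) (lerXn2r m _ _ zr)) _;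
      rewrite ?nnegrE ?exprn_ge0 ?normc_ge0 ?divr_ge0 ?(ltW r0) //.
    rewrite mulrAC -exprMn (_ : 2 / r * (r / 4) = 2^-1); last by field; rewrite gt_eqF.
    by rewrite exprVn mulrC.
  by rewrite geo lerBlDr lerDl divr_ge0 ?mulr_ge0 ?exprn_ge0.
have h2 : normc (z ^+ N * taylor G N z) <= B / 2 ^+ N by apply: HB; lra.
have := le_normcD (\sum_(m < N) taylor G m 0 * z ^+ m) (z ^+ N * taylor G N z).
lra.
Qed.

End CircleMaximum.

(** * Positive logarithms, Fejér kernels and Riemann sums *)

Section MaximumFromProximity.
Context {R : realType}.
Local Notation C := R[i].
Local Notation D f := (derive1 ((f : C -> C) : C^o -> C^o)).
Implicit Types (r s t x y M : R) (f g G : C -> C) (z w : C).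

Lemma log_plus_ge0 x : 0 <= log_plus x.
Proof. by rewrite /log_plus le_max lexx orbT. Qed.

Lemma le_exp_log_plus x : x <= expR (log_plus x).
Proof.
have [x0|x0] := leP x 0; first by apply: le_trans x0 (expR_ge0 _).
by rewrite -{1}(lnK x0) ler_expR /log_plus le_max lexx.
Qed.

Lemma log_plus_le x y : 0 <= y -> x <= expR y -> log_plus x <= y.
Proof.
move=> y0 xy; rewrite /log_plus ge_max y0 andbT.
have [x0|x0] := leP x 0; first by rewrite ln0.
by rewrite -ler_expR lnK.
Qed.

(** For a, d >= 0, exp a + d <= exp a (1 + d) <= exp (a + d). *)
Lemma log_plus_lip x y : log_plus x <= log_plus y + `|x - y|.
Proof.
apply: log_plus_le; first by rewrite addr_ge0 ?log_plus_ge0.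
have h1 : x <= expR (log_plus y) + `|x - y|.
  by have := le_exp_log_plus y; have := ler_norm (x - y); lra.
apply: le_trans h1 _; rewrite expRD.
have e1 : 1 <= expR (log_plus y) by rewrite -expR0 ler_expR log_plus_ge0.
have h2 := expR_ge1Dx `|x - y|.
have n0 := normr_ge0 (x - y).
move: (expR (log_plus y)) (expR `|x - y|) (`|x - y|) e1 h2 n0 => a b c *; nra.
Qed.

Lemma rderiv_cis t : rderiv cis t ((0 +i* 1) * cis t).
Proof.
split => /=.
- rewrite mul0r mul1r sub0r; exact: is_derive_cos.
- by rewrite mul0r mul1r add0r; exact: is_derive_sin.
Qed.

Lemma cis_lip x y : x <= y -> normc (cis y - cis x) <= 2 * (y - x).
Proof.
move=> xy; rewrite -[2]mulr1; apply: (rderiv_bound xy (fun t _ => rderiv_cis t)).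
move=> t _; rewrite normcM normc_cis mulr1 /normc /= expr0n expr1n add0r.
by rewrite sqrtr1.
Qed.

Lemma hol_lip f r : hol f -> exists2 L, 0 <= L & forall z w,
  normc z <= r -> normc w <= r -> normc (f z - f w) <= L * normc (z - w).
Proof.
move=> fh; have [r0|r0] := ltP r 0.
  exists 0 => // z w zr _; have := le_lt_trans zr r0.
  by rewrite ltNge normc_ge0.
have [M HM] := bounded_square r (hol_cont (hol_D fh)).
have M0 : 0 <= M by apply: le_trans (normc_ge0 _) (HM 0 _); rewrite sqn0.
exists (2 * M); first by rewrite mulr_ge0.
move=> z w zr wr.
pose p (s : R) := f (w + s%:C * (z - w)).
have -> : f z - f w = p 1 - p 0.
  by rewrite /p mul1r mul0r addr0 (addrC w) subrK.
have := @rderiv_bound R p (fun s => D f (w + s%:C * (z - w)) * (z - w)) 0 1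
  (M * normc (z - w)) ler01.
rewrite subr0 mulr1 mulrA; apply.
  by move=> s _; apply: cdiff_line; exact: hol_cdiff.
move=> s /andP[s0 s1]; rewrite normcM ler_wpM2r ?normc_ge0 // HM //.
apply: le_trans (sqn_le_normc _) _.
have -> : w + s%:C * (z - w) = (1 - s)%:C * w + s%:C * z.
  by rewrite rmorphB /=; ring.
apply: le_trans (le_normcD _ _) _; rewrite !normcM !normc_real.
rewrite !ger0_norm ?subr_ge0 //.
have := normc_ge0 z; have := normc_ge0 w; nra.
Qed.

Definition geosum n z : C := \sum_(m < n.+1) z ^+ m.

(** On the unit circle the k-th summand has the Dirichlet kernel as real part, so the real part of
    the sum is n + 1 times the Fejér kernel. The polynomial itself gives a holomorphic completion of
    Fejér means. *)
Definition fejer n z : C := \sum_(k < n.+1) (2 * geosum k z - 1).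

Lemma geosumS n z : geosum n.+1 z = 1 + z * geosum n z.
Proof.
rewrite /geosum big_ord_recl expr0 mulr_sumr; congr (_ + _).
by apply: eq_bigr => m _; rewrite lift0 exprS.
Qed.

(* Fejér's identity, by induction from [geosum n.+1 z = 1 + z * geosum n z]. *)
Lemma Re_fejer n z : normc z = 1 -> Re (fejer n z) = normc (geosum n z) ^+ 2.
Proof.
move=> z1; elim: n => [|n IH].
  rewrite /fejer /geosum !big_ord1 expr0 normc1 expr1n.
  by rewrite (_ : 2 * 1 - 1 = 1 :> C) //; ring.
rewrite /fejer big_ord_recr /= -/(fejer n z) cReD IH.
have E : normc (z * geosum n z) = normc (geosum n z) by rewrite normcM z1 mul1r.
rewrite geosumS -E; move: (z * _) => u.
rewrite !sqr_normc_def; case: u => a b /=.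
ring.
Qed.

Lemma geosum_bound n z : normc z = 1 ->
  normc (geosum n z) ^+ 2 * normc (1 - z) ^+ 2 <= 4.
Proof.
move=> z1; rewrite -exprMn -normcM.
have -> : geosum n z * (1 - z) = 1 - z ^+ n.+1.
  have := subrX1 z n.+1; rewrite -/(geosum n z) => h.
  by rewrite -[RHS]opprB h; ring.
have h : normc (1 - z ^+ n.+1) <= 2.
  by have := le_normcD 1 (- z ^+ n.+1); rewrite normcN normc1 normcX z1 expr1n; lra.
have := normc_ge0 (1 - z ^+ n.+1); nra.
Qed.

(** The geometric sums are at most 2, so each summand is at most 2 * 2 + 1 = 5. *)
Lemma normc_fejer_le n z : normc z <= 1 / 2 -> normc (fejer n z) <= 5 * n.+1%:R.
Proof.
move=> z2; have S2 k : normc (geosum k z) <= 2.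
  elim: k => [|k IH]; first by rewrite /geosum big_ord1 expr0 normc1 ler1n.
  rewrite geosumS; apply: le_trans (le_normcD _ _) _; rewrite normc1 normcM.
  have := normc_ge0 z; have := normc_ge0 (geosum k z); nra.
apply: le_trans (normc_sum _ _) _.
apply: (@le_trans _ _ (\sum_(k < n.+1) (5 : R))); last first.
  by rewrite sumr_const card_ord mulr_natr.
apply: ler_sum => k _; apply: le_trans (le_normcD _ _) _; rewrite normcN normc1 normcM.
have -> : normc (2 : C) = 2.
  have -> : (2 : C) = (2 : R)%:C by rewrite rmorph_nat.
  by rewrite normc_real ger0_norm.
by have := S2 k; lra.
Qed.

(** For N > n only the constant terms survive the summation over roots of unity. Hence the discrete
    Fejér weights have the same total at every point of the circle. *)
Lemma sum_fejer N n z : (n < N)%N ->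
  \sum_(j < N) fejer n (z / omega N ^+ j) = (N * n.+1)%:R.
Proof.
move=> nN; rewrite /fejer exchange_big /= natrM.
have H k : (k < N)%N -> \sum_(j < N) geosum k (z / omega N ^+ j) = N%:R.
  move=> kN; rewrite /geosum exchange_big /= (bigD1 ord0) //= [X in _ + X]big1 ?addr0.
    by under eq_bigr do rewrite expr0; rewrite sumr_const card_ord.
  move=> m m0; under eq_bigr do rewrite exprMn.
  rewrite -mulr_sumr; apply/eqP; rewrite mulf_eq0; apply/orP; right; apply/eqP.
  have mN : (m < N)%N by apply: leq_trans kN; rewrite ltnS -ltnS.
  under eq_bigr do rewrite exprVn exprAC -exprVn.
  apply: sum_unity.
    by rewrite exprVn exprAC omegaXN ?expr1n ?invr1 //; exact: leq_trans nN.
  by rewrite invr_eq1 omegaX_neq1 // lt0n.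
rewrite (eq_bigr (fun=> N%:R)); first by rewrite sumr_const card_ord mulr_natr.
move=> k _; rewrite sumrB -mulr_sumr H; last by apply: leq_trans nN; rewrite ltnS -ltnS.
by rewrite sumr_const card_ord; ring.
Qed.

Lemma natr_gt x : exists n : nat, x < n%:R.
Proof.
have [x0|x0] := leP 0 x; first by exists (Num.bound x); exact: archi_boundP.
by exists 0%N.
Qed.

Lemma riemann_sum (u : R -> R) (L b : R) : 0 < b -> 0 <= L -> 
  (forall x y, x <= y -> `|u y - u x| <= L * (y - x)) ->
  forall N, (0 < N)%N -> 
  \sum_(j < N) u (j%:R * b / N%:R) * (b / N%:R) <=
  \int[lebesgue_measure]_(t in `[0, b]) u t + L * b * b / N%:R.
Proof.
move=> b0 L0 uL N N0.
have uc : continuous u.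
  move=> x; apply/continuous_realP => e e0.
  have L1 : 0 < L + 1 by rewrite ltr_wpDl.
  exists (e / (L + 1)); first by rewrite divr_gt0.
  move=> t; rewrite ltr_pdivlMr // => tx.
  have h : `|u t - u x| <= L * `|t - x|.
    have [xt|/ltW tx'] := leP x t; first by rewrite [X in L * X]ger0_norm ?subr_ge0 // uL.
    by rewrite distrC [X in L * X]distrC [X in L * X]ger0_norm ?subr_ge0 // uL.
  apply: le_lt_trans h _; apply: le_lt_trans tx; rewrite mulrC.
  by rewrite ler_wpM2l // lerDl.
have [P HP] := ex_primitive uc.
have -> : \int[lebesgue_measure]_(t in `[0, b]) u t = P b - P 0.
  rewrite /Rintegral (@continuous_FTC2 _ u P) //.
  - exact: continuous_subspaceT.
  - have Pc : continuous P.
      move=> x; apply: differentiable_continuous; apply/derivable1_diffP.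
      by case: (HP x).
    split.
    + by move=> x _; case: (HP x).
    + by apply: cvg_at_right_filter; exact: Pc.
    + by apply: cvg_at_left_filter; exact: Pc.
  - by move=> x _; rewrite derive1E; case: (HP x).
have n0 : 0 < N%:R :> R by rewrite ltr0n.
pose v j : R := j%:R * b / N%:R.
have vE j : v j.+1 - v j = b / N%:R by rewrite /v -natr1; field; rewrite gt_eqF.
have v0 : v 0%N = 0 by rewrite /v !mul0r.
have vN : v N = b by rewrite /v mulrAC divff ?mul1r // gt_eqF.
have -> : P b - P 0 = \sum_(j < N) (P (v j.+1) - P (v j)).
  by rewrite -(big_mkord xpredT (fun j => P (v j.+1) - P (v j))) telescope_sumr // v0 vN.
have -> : L * b * b / N%:R = \sum_(j < N) L * (b / N%:R) * (b / N%:R).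
  by rewrite sumr_const card_ord -mulr_natr; field; rewrite gt_eqF.
rewrite -big_split /=; apply: ler_sum => j _.
have vv : v j <= v j.+1 by rewrite -subr_ge0 vE divr_ge0 // ltW.
have := @is_derive_ge R P u (v j) (v j.+1) (u (v j) - L * (b / N%:R)) vv (fun t _ => HP t).
rewrite vE -/(v j) => H.
have : (u (v j) - L * (b / N%:R)) * (b / N%:R) <= P (v j.+1) - P (v j).
  apply: H => t /andP[jt tj].
  have h := uL _ _ jt; have h2 := ler_norm (u (v j) - u t).
  rewrite distrC in h2; have h3 : L * (t - v j) <= L * (b / N%:R).
    by rewrite ler_wpM2l // -(vE j) lerD2r.
  lra.
by rewrite mulrBl; lra.
Qed.

End MaximumFromProximity.

(** * Bounding an entire function by its proximity function *)

Section ProximityBound.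
Context {R : realType}.
Local Notation C := R[i].
Implicit Types (r s t x y M : R) (f g G : C -> C) (z w : C).

(** After squaring, 1 + x <= exp x gives the exponent - 2 Re z + |z|^2 / m, whose last term is at
    most 1. *)
Lemma normc_1BX_le z m (B : R) : (0 < m)%N -> normc z <= B -> B ^+ 2 <= m%:R ->
  normc (1 - z / m%:R) ^+ m <= expR (1 - Re z).
Proof.
move=> m0 zB Bm; have n0 : 0 < m%:R :> R by rewrite ltr0n.
have mE : (m%:R : C)^-1 = (m%:R^-1 : R)%:C by rewrite fmorphV rmorph_nat.
have n1 := normc_ge0 (1 - z / m%:R).
rewrite -(@ler_pXn2r _ 2) ?nnegrE ?exprn_ge0 ?expR_ge0 // exprAC.
have -> : normc (1 - z / m%:R) ^+ 2 = 1 + (- 2 * Re z + normc z ^+ 2 / m%:R) / m%:R.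
  rewrite mE !sqr_normc_def; case: z {zB n1} => a b /=.
  by field; rewrite gt_eqF.
have h := expR_ge1Dx ((- 2 * Re z + normc z ^+ 2 / m%:R) / m%:R).
have h0 : 0 <= 1 + (- 2 * Re z + normc z ^+ 2 / m%:R) / m%:R.
  have -> : 1 + (- 2 * Re z + normc z ^+ 2 / m%:R) / m%:R = normc (1 - z / m%:R) ^+ 2.
    rewrite mE !sqr_normc_def; case: z {zB n1 h} => a b /=.
    by field; rewrite gt_eqF.
  exact: exprn_ge0.
apply: le_trans (lerXn2r m _ _ h) _; rewrite ?nnegrE ?expR_ge0 //.
rewrite -!expRM_natl ler_expR [leLHS]mulrC divfK ?gt_eqF //.
have : normc z ^+ 2 / m%:R <= 1.
  rewrite ler_pdivrMr // mul1r; apply: le_trans Bm.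
  by rewrite lerXn2r ?nnegrE ?normc_ge0 // (le_trans _ zB) ?normc_ge0.
lra.
Qed.

(** From 1 - t >= exp (- 2 t) for 0 <= t <= 1/2, with t = y / m. *)
Lemma normc_1BX_ge z m (y : R) : (0 < m)%N -> normc z <= y -> 2 * y <= m%:R ->
  expR (- (2 * y)) <= normc (1 - z / m%:R) ^+ m.
Proof.
move=> m0 zy ym; have n0 : 0 < m%:R :> R by rewrite ltr0n.
have y0 : 0 <= y := le_trans (normc_ge0 _) zy.
have h1 : 1 - y / m%:R <= normc (1 - z / m%:R).
  have := normc_triB 1 (z / m%:R); rewrite normc1 normcM.
  have -> : (m%:R : C)^-1 = (m%:R^-1 : R)%:C by rewrite fmorphV rmorph_nat.
  rewrite normc_real ger0_norm ?invr_ge0 ?(ltW n0) //.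
  have : normc z / m%:R <= y / m%:R by rewrite ler_pM2r ?invr_gt0.
  lra.
have h2 : y / m%:R <= 1 / 2 by rewrite ler_pdivrMr //; lra.
have yp : 0 <= y / m%:R by rewrite divr_ge0 // ltW.
have h3 : expR (- (2 * (y / m%:R))) <= 1 - y / m%:R.
  have e0 := expR_gt0 (2 * (y / m%:R)).
  rewrite expRN -(ler_pM2r e0) mulVf ?gt_eqF //.
  have := expR_ge1Dx (2 * (y / m%:R)); nra.
have -> : - (2 * y) = - (2 * (y / m%:R)) * m%:R by field; rewrite gt_eqF.
rewrite mulrC expRM_natl.
apply: lerXn2r; rewrite ?nnegrE ?expR_ge0 ?normc_ge0 //; exact: le_trans h3 h1.
Qed.

(* If the polynomial [Q] satisfies [log_plus |f| <= Re Q + 1] on the circle, then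
   [f (1 - Q / m)^m] is bounded there for [m] large, and the factor
   [(1 - Q / m)^m], which stands for [exp (- Q)], is bounded below at [z]. *)
Lemma proximity_max f r z : hol f -> 0 < r -> normc z <= r / 4 ->
  normc (f z) <= expR (10 * proximity r f + 13).
Proof.
move=> fh r0 zr.
have [L L0 fL] := hol_lip r fh.
pose lf w := log_plus (normc (f w)).
have lf0 w : 0 <= lf w := log_plus_ge0 _.
have lf_lip z1 z2 : normc z1 <= r -> normc z2 <= r -> lf z1 <= lf z2 + L * normc (z1 - z2).
  move=> h1 h2; apply: le_trans (log_plus_lip _ (normc (f z2))) _.
  rewrite lerD2l; apply: le_trans (fL _ _ h1 h2).
  rewrite ler_norml normc_triB andbT lerNl opprB normcB; exact: normc_triB.
have pi0 := pi_gt0 R.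
(* The degree [n] makes the smoothing error 1/2 + 2 (L r)^2 / (n + 1) at most 1; afterwards [N > n]
   is taken so large that the Riemann sum exceeds the mean by at most 1. *)
have [n0 Hn0] := natr_gt (4 * (L * r) ^+ 2).
pose n := n0.+1.
have Hn : 4 * (L * r) ^+ 2 <= n.+1%:R.
  by apply: le_trans (ltW Hn0) _; rewrite ler_nat /n; apply: leqW; exact: leqW.
have [N0 HN0] := natr_gt (4 * pi * L * r).
pose N := (N0 + n.+1)%N.
have nN : (n < N)%N by rewrite /N addnS ltnS leq_addl.
have N_gt0 : (0 < N)%N by apply: leq_trans nN.
have HN : 4 * pi * L * r <= N%:R.
  by apply: le_trans (ltW HN0) _; rewrite ler_nat leq_addr.
have NR : 0 < N%:R :> R by rewrite ltr0n.
pose zeta j : C := r%:C * omega N ^+ j.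
have nz j : normc (zeta j) = r.
  by rewrite normcM normc_omegaX mulr1 normc_real gtr0_norm.
pose A := (\sum_(j < N) lf (zeta j)) / N%:R.
have A0 : 0 <= A by rewrite divr_ge0 ?ler0n // sumr_ge0.
(* the Riemann sum [A] of the proximity integral *)
have hA : A <= proximity r f + 1.
  pose u t := lf (r%:C * cis t).
  have nrc t : normc (r%:C * cis t) = r.
    by rewrite normcM normc_cis mulr1 normc_real gtr0_norm.
  have uL x y : x <= y -> `|u y - u x| <= (2 * L * r) * (y - x).
    move=> xy; have h := cis_lip xy.
    have E : normc (r%:C * cis y - r%:C * cis x) <= 2 * r * (y - x).
      by rewrite -mulrBr normcM normc_real gtr0_norm // -mulrA mulrCA ler_pM2l.
    have E' := E; rewrite normcB in E'.
    have h1 : u y <= u x + L * (2 * r * (y - x)).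
      apply: le_trans (lf_lip _ (r%:C * cis x) _ _) _; rewrite ?nrc //.
      by rewrite lerD2l ler_wpM2l.
    have h2 : u x <= u y + L * (2 * r * (y - x)).
      apply: le_trans (lf_lip _ (r%:C * cis y) _ _) _; rewrite ?nrc //.
      by rewrite lerD2l ler_wpM2l.
    by rewrite ler_norml; lra.
  have b0 : 0 < 2 * pi :> R by rewrite mulr_gt0.
  have L'0 : 0 <= 2 * L * r by rewrite !mulr_ge0 // ltW.
  have := riemann_sum b0 L'0 uL N_gt0.
  have -> : \sum_(j < N) u (j%:R * (2 * pi) / N%:R) * (2 * pi / N%:R) = 2 * pi * A.
    rewrite /A mulrCA mulrA mulr_suml [RHS]mulrC mulr_sumr.
    apply: eq_bigr => j _.
    have -> : j%:R * (2 * pi) / N%:R = j%:R * (2 * pi / N%:R) :> R by rewrite -mulrA.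
    rewrite /u -cisX -/(omega N) -/(zeta j); ring.
  have -> : \int[lebesgue_measure]_(t in `[0, 2 * pi]) u t = 2 * pi * proximity r f.
    rewrite /proximity mulrA mulfV ?gt_eqF // mul1r; apply: eq_Rintegral => t _.
    rewrite /u /lf; congr (log_plus (normc (f _))).
    by rewrite /cis; apply: ReIm_eq => /=; ring.
  have h : 2 * L * r * (2 * pi) * (2 * pi) / N%:R <= 2 * pi.
    rewrite ler_pdivrMr // mulrC ler_pM2l //; lra.
  move=> h'; rewrite -(ler_pM2l b0); lra.
(* the Fejér mean [Q] of [lf]: a polynomial with [lf <= Re Q + 1] on the circle *)
pose c0 : C := (N%:R * n.+1%:R)^-1.
pose Q w : C := c0 * \sum_(j < N) ((lf (zeta j))%:C * fejer n (w / zeta j)).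
have c0E : c0 = ((N%:R * n.+1%:R)^-1 : R)%:C.
  by rewrite fmorphV rmorphM !rmorph_nat.
have m0 : 0 < N%:R * n.+1%:R :> R by rewrite mulr_gt0 ?ltr0n.
have Qh : hol Q.
  apply: holZ; apply: hol_sum => j; apply: holZ.
  have gh k : hol (fun w => geosum k (w / zeta j)).
    apply: hol_sum => m; apply: holX; apply: holM; [exact: hol_id|exact: hol_cst].
  by apply: hol_sum => k; apply: holB; [exact: holZ|exact: hol_cst].
have QR w : normc w = r -> lf w <= Re (Q w) + 1.
  move=> wr; have xj (j : 'I_N) : normc (w / zeta j) = 1.
    by rewrite normcM normcV nz wr divff // gt_eqF.
  have ReQ : Re (Q w) = (N%:R * n.+1%:R)^-1 *
      \sum_(j < N) lf (zeta j) * normc (geosum n (w / zeta j)) ^+ 2.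
    rewrite /Q c0E cReM /= mul0r subr0; congr (_ * _).
    elim/big_ind2: _ => [//|a b c d <- <-|j _]; first by rewrite cReD.
    by rewrite cReM /= mul0r subr0 Re_fejer.
  have tot : \sum_(j < N) normc (geosum n (w / zeta j)) ^+ 2 = N%:R * n.+1%:R.
    have := @sum_fejer _ N n (w / r%:C) nN => /(congr1 (@complex.Re R)).
    rewrite (_ : (N * n.+1)%:R = (N%:R * n.+1%:R : R)%:C); last first.
      by rewrite natrM rmorphM !rmorph_nat.
    move=> /= <-; elim/big_ind2: _ => [//|a b c d -> ->|j _]; first by rewrite cReD.
    have -> : w / r%:C / omega N ^+ j = w / zeta j by rewrite /zeta invfM mulrA.
    by rewrite Re_fejer.
  rewrite -lerBlDl -(ler_pM2l m0) mulr1 mulrBr ReQ mulrA mulfV ?gt_eqF // mul1r.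
  rewrite -{1}tot mulr_suml -sumrB.
  (* With S the kernel and d = |1 - w / zeta|, the Lipschitz bound L r d is at most 1/2 + (L r d)^2
     / 2, and S d^2 <= 4 by [geosum_bound]; this avoids splitting the circle into near and far
     arcs. *)
  apply: (@le_trans _ _ (\sum_(j < N) (normc (geosum n (w / zeta j)) ^+ 2 / 2
      + 2 * (L * r) ^+ 2))).
    apply: ler_sum => j _.
    have dj : normc (w - zeta j) = r * normc (1 - w / zeta j).
      rewrite -{1}(nz j) -normcM normcB mulrBr mulr1 mulrC divfK //.
      by rewrite -normc_gt0 nz.
    have := lf_lip w (zeta j); rewrite wr nz dj => /(_ (lexx _) (lexx _)).
    have := geosum_bound n (xj j).
    have : 0 <= normc (geosum n (w / zeta j)) ^+ 2 by exact: sqr_ge0.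
    move: (normc (geosum _ _) ^+ 2) (normc (1 - _)) (lf w) (lf (zeta j)) => S d x y S0 Sd xy.
    have h : x - y <= 1 / 2 + (L * r) ^+ 2 * d ^+ 2 / 2.
      by have := sqr_ge0 (L * r * d - 1); nra.
    have h' := ler_wpM2l S0 h.
    have h2 : (L * r) ^+ 2 * (S * d ^+ 2) <= (L * r) ^+ 2 * 4.
      by rewrite ler_wpM2l ?sqr_ge0.
    lra.
  rewrite big_split /= -mulr_suml tot sumr_const card_ord -mulr_natr.
  nra.
have [B HB] := bounded_square r (hol_cont Qh).
have QB w : normc w <= r -> normc (Q w) <= B.
  by move=> wr; apply: HB; apply: le_trans wr; exact: sqn_le_normc.
have Q5 : normc (Q z) <= 5 * A.
  rewrite /Q c0E normcM normc_real gtr0_norm ?invr_gt0 //.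
  rewrite ler_pdivrMl //.
  apply: le_trans (normc_sum _ _) _.
  apply: (@le_trans _ _ (\sum_(j < N) lf (zeta j) * (5 * n.+1%:R))).
    apply: ler_sum => j _; rewrite normcM normc_real ger0_norm //.
    rewrite ler_wpM2l //; apply: normc_fejer_le.
    by rewrite normcM normcV nz ler_pdivrMr //; lra.
  rewrite -mulr_suml /A le_eqVlt; apply/orP; left; apply/eqP; field.
  by rewrite gt_eqF.
(* [m] has to exceed B^2 for the upper bound on the circle and 10 A for the lower bound at [z]. *)
have [m1 Hm1] := natr_gt (B ^+ 2 + 2 * (5 * A)).
pose m := m1.+1.
have mB : B ^+ 2 <= m%:R /\ 2 * (5 * A) <= m%:R.
  have h : m1%:R <= m%:R :> R by rewrite ler_nat.
  have := sqr_ge0 B; lra.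
pose G w := f w * (1 - Q w / m%:R) ^+ m.
have Gh : hol G.
  apply: holM => //; apply: holX; apply: holB; first exact: hol_cst.
  by apply: holM => //; exact: hol_cst.
have GM w : normc w = r -> normc (G w) <= expR 2.
  move=> wr; rewrite normcM normcX.
  have h1 := @normc_1BX_le (Q w) m B isT (QB w _) mB.1.
  have h2 : normc (f w) <= expR (Re (Q w) + 1).
    by apply: le_trans (le_exp_log_plus _) _; rewrite ler_expR; exact: QR.
  have -> : 2 = (Re (Q w) + 1) + (1 - Re (Q w)) :> R by ring.
  rewrite expRD; apply: ler_pM; rewrite ?exprn_ge0 ?normc_ge0 //.
  by apply: h1; rewrite wr.
have h1 := circle_max Gh r0 GM zr.
have h2 := @normc_1BX_ge (Q z) m (5 * A) isT Q5 mB.2.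
have h3 : normc (f z) * expR (- (2 * (5 * A))) <= 2 * expR 2.
  apply: le_trans h1; rewrite normcM normcX ler_wpM2l ?normc_ge0 //.
have e2 : 2 <= expR 1 :> R by have := @expR_ge1Dx R 1; lra.
have h4 : normc (f z) <= expR (1 + 2 + 2 * (5 * A)).
  rewrite 2!expRD -ler_pdivrMr ?expR_gt0 // -expRN.
  apply: le_trans h3 _; rewrite ler_wpM2r ?expR_ge0 //.
by apply: le_trans h4 _; rewrite ler_expR; lra.
Qed.

End ProximityBound.

(** * Growth classes *)

Section Growth.
Context {R : realType}.
Local Notation C := R[i].
Local Notation D f := (derive1 ((f : C -> C) : C^o -> C^o)).
Implicit Types (r s t x y M : R) (f g G : C -> C) (z w : C) (b c : R -> R).

Definition iexp p x : R := iter p expR x.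

Lemma le_iexp p x y : x <= y -> iexp p x <= iexp p y.
Proof. by move=> xy; elim: p => [//|p IH] /=; rewrite ler_expR. Qed.

Lemma iexp_ge p x : x <= iexp p x.
Proof.
elim: p => [|p IH] /=; first exact: lexx.
by apply: le_trans IH _; have := expR_ge1Dx (iexp p x); lra.
Qed.

(** (exp u)^2 = exp (2 u), and 2 u <= u^2 as soon as u >= 2. *)
Lemma iexp_sqr p x : 2 <= x -> iexp p x ^+ 2 <= iexp p (x ^+ 2).
Proof.
move=> x2; elim: p => [|p IH]; first exact: lexx.
rewrite /= -/(iexp p x) -/(iexp p (x ^+ 2)) -expRM_natl ler_expR.
apply: le_trans IH; have := le_trans x2 (iexp_ge p x); nra.
Qed.

(** One integer serves as constant, exponent and dilation, so each closure property only enlarges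
    [K]. *)
Definition scale (K : nat) r : R := (K%:R * r) ^+ K.

Lemma scale_ge K r : (1 <= K)%N -> 1 <= r -> K%:R <= scale K r.
Proof.
move=> K1 r1; have KR : 1 <= K%:R :> R by rewrite ler1n.
have h : K%:R <= K%:R * r by rewrite ler_peMr //; lra.
by apply: le_trans (h) _; apply: ler_eXnr => //; exact: le_trans KR h.
Qed.

Lemma scale_mono K L r : (1 <= K)%N -> (K <= L)%N -> 1 <= r -> scale K r <= scale L r.
Proof.
move=> K1 KL r1; have KR : 1 <= K%:R :> R by rewrite ler1n.
have KLR : K%:R <= L%:R :> R by rewrite ler_nat.
have h1 : 1 <= K%:R * r by apply: le_trans KR _; rewrite ler_peMr //; lra.
have h2 : K%:R * r <= L%:R * r by rewrite ler_pM2r //; lra.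
apply: (@le_trans _ _ ((L%:R * r) ^+ K)).
  by apply: lerXn2r; rewrite ?nnegrE //; lra.
by apply: ler_weXn2l => //; lra.
Qed.

Lemma scale_sqr K r : (1 <= K)%N -> 1 <= r -> scale K r ^+ 2 <= scale (K * 2) r.
Proof.
move=> K1 r1; rewrite /scale -exprM; have K0 : 0 <= K%:R :> R by [].
apply: lerXn2r; rewrite ?nnegrE ?mulr_ge0 //; try lra.
by rewrite ler_pM2r ?ler_nat ?leq_pmulr //; lra.
Qed.

Lemma scale_dil K m r : (1 <= K)%N -> (1 <= m)%N -> 1 <= r ->
  scale K (m%:R * r) <= scale (K * m) r.
Proof.
move=> K1 m1 r1; rewrite /scale mulrA -natrM.
have h : 1 <= (K * m)%:R * r.
  have : 1 <= (K * m)%:R :> R by rewrite ler1n muln_gt0 K1.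
  by move=> h; apply: le_trans h _; rewrite ler_peMr //; lra.
by apply: ler_weXn2l => //; rewrite leq_pmulr.
Qed.

(** The condition on [K] makes [scale K r] at least 2, which [iexp_sqr] requires. For [p = 0] these
    are the polynomial bounds. *)
Definition bnd p b := exists2 K, (2 <= K)%N &
  forall r, 1 <= r -> b r <= iexp p (scale K r).

Lemma bnd_le p b c : (forall r, 1 <= r -> b r <= c r) -> bnd p c -> bnd p b.
Proof.
by move=> bc [K K2 H]; exists K => // r r1; apply: le_trans (bc r r1) (H r r1).
Qed.

(** Products and sums reduce to this case: b c is at most the square of the maximum, and b + c <= 2
    m <= m^2 for a common upper bound m >= 2. *)
Lemma bnd_sqr p b : (forall r, 1 <= r -> 0 <= b r) -> bnd p b ->
  bnd p (fun r => b r ^+ 2).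
Proof.
move=> b0 [K K2 H]; exists (K * 2)%N; first by rewrite (leq_trans K2) // leq_pmulr.
move=> r r1; have K1 : (1 <= K)%N by apply: ltnW.
have s2 : 2 <= scale K r.
  by apply: le_trans (scale_ge K1 r1); rewrite ler_nat.
apply: (@le_trans _ _ (iexp p (scale K r) ^+ 2)).
  have := H r r1; have := b0 r r1; nra.
by apply: le_trans (iexp_sqr p s2) _; apply: le_iexp; exact: scale_sqr.
Qed.

Lemma bnd_max p b c : bnd p b -> bnd p c -> bnd p (fun r => Num.max (b r) (c r)).
Proof.
move=> [K K2 H] [L L2 H']; exists (K + L)%N; first by rewrite (leq_trans K2) // leq_addr.
move=> r r1; rewrite ge_max; apply/andP; split.
  by apply: le_trans (H r r1) _; apply: le_iexp; apply: scale_mono; rewrite ?leq_addr // ltnW.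
by apply: le_trans (H' r r1) _; apply: le_iexp; apply: scale_mono; rewrite ?leq_addl // ltnW.
Qed.

Lemma bnd_cst p x : bnd p (fun=> x).
Proof.
have [n Hn] := natr_gt x; exists n.+2 => // r r1.
apply: le_trans (iexp_ge _ _); apply: le_trans (scale_ge _ r1) => //.
by apply: le_trans (ltW Hn) _; rewrite ler_nat -addn2 leq_addr.
Qed.

Lemma bndM p b c : (forall r, 1 <= r -> 0 <= b r) -> (forall r, 1 <= r -> 0 <= c r) ->
  bnd p b -> bnd p c -> bnd p (fun r => b r * c r).
Proof.
move=> b0 c0 pb pc; apply: (@bnd_le _ _ (fun r => Num.max (b r) (c r) ^+ 2)).
  move=> r r1; rewrite expr2; apply: ler_pM; rewrite ?b0 ?c0 // le_max lexx ?orbT //.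
apply: bnd_sqr; last exact: bnd_max.
by move=> r r1; rewrite le_max b0.
Qed.

Lemma bndD p b c : bnd p b -> bnd p c -> bnd p (fun r => b r + c r).
Proof.
move=> pb pc; pose m r := Num.max 2 (Num.max (b r) (c r)).
have m2 r : 2 <= m r by rewrite /m le_max lexx.
apply: (@bnd_le _ _ (fun r => m r ^+ 2)).
  move=> r r1; have : b r <= m r by rewrite /m !le_max lexx orbT.
  have : c r <= m r by rewrite /m !le_max lexx !orbT.
  have := m2 r; nra.
apply: bnd_sqr; first by move=> r _; apply: le_trans (m2 r).
by do !apply: bnd_max => //; exact: bnd_cst.
Qed.

Lemma bndX p b n : (forall r, 1 <= r -> 0 <= b r) -> bnd p b ->
  bnd p (fun r => b r ^+ n).
Proof.
move=> b0 pb; elim: n => [|n IH].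
  by apply: bnd_le (bnd_cst p 1) => r _; rewrite expr0.
apply: (@bnd_le _ _ (fun r => b r * b r ^+ n)); first by move=> r _; rewrite exprS.
by apply: bndM => // r r1; rewrite exprn_ge0 // b0.
Qed.

Lemma bnd_dil p b m : (1 <= m)%N -> bnd p b -> bnd p (fun r => b (m%:R * r)).
Proof.
move=> m1 [K K2 H]; exists (K * m)%N; first by rewrite (leq_trans K2) // leq_pmulr.
move=> r r1; have mr : 1 <= m%:R * r.
  have : 1 <= m%:R :> R by rewrite ler1n.
  by move=> h; apply: le_trans h _; rewrite ler_peMr //; lra.
by apply: le_trans (H _ mr) _; apply: le_iexp; apply: scale_dil => //; exact: ltnW.
Qed.

Lemma bnd_exp p b : bnd p b -> bnd p.+1 (fun r => expR (b r)).
Proof. by move=> [K K2 H]; exists K => // r r1 /=; rewrite ler_expR; exact: H. Qed.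

(* Up to constants, [growth p f] says that [|f z|] is at most the [p]-fold
   exponential of a power of [|z|]. *)
Definition growth p f := exists2 b, bnd p b &
  forall r, 1 <= r -> forall z, sqn z <= r -> normc (f z) <= b r.

Lemma growth_ext p f g : f =1 g -> growth p f -> growth p g.
Proof. by move=> /funext ->. Qed.

Lemma growth_ge0 f b : (forall r, 1 <= r -> forall z, sqn z <= r -> normc (f z) <= b r) ->
  forall r, 1 <= r -> 0 <= b r.
Proof.
move=> fb r r1; apply: le_trans (normc_ge0 _) (fb r r1 0 _).
by rewrite sqn0; lra.
Qed.

Lemma growthD p f g : growth p f -> growth p g -> growth p (fun z => f z + g z).
Proof.
move=> [b pb fb] [c pc gc]; exists (fun r => b r + c r); first exact: bndD.
move=> r r1 z zr; apply: le_trans (le_normcD _ _) _.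
by apply: lerD; [exact: fb|exact: gc].
Qed.

Lemma growthM p f g : growth p f -> growth p g -> growth p (fun z => f z * g z).
Proof.
move=> [b pb fb] [c pc gc]; exists (fun r => b r * c r).
  by apply: bndM => //; [exact: growth_ge0 fb|exact: growth_ge0 gc].
move=> r r1 z zr; rewrite normcM; apply: ler_pM; rewrite ?normc_ge0 //.
  exact: fb.
exact: gc.
Qed.

Lemma growth_cst p (a : C) : growth p (fun=> a).
Proof. by exists (fun=> normc a) => //; exact: bnd_cst. Qed.

Lemma growthN p f : growth p f -> growth p (fun z => - f z).
Proof. by move=> [b pb fb]; exists b => // r r1 z zr; rewrite normcN; exact: fb. Qed.

Lemma growthB p f g : growth p f -> growth p g -> growth p (fun z => f z - g z).
Proof. by move=> fp gp; apply: growthD => //; exact: growthN. Qed.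

Lemma growthZ p (a : C) f : growth p f -> growth p (fun z => a * f z).
Proof. by apply: growthM; exact: growth_cst. Qed.

Lemma growth_shift p f a : growth p f -> growth p (fun z => f (z + a)).
Proof.
move=> [b pb fb]; have [n Hn] := natr_gt (sqn a).
exists (fun r => b (n.+1%:R * r)); first exact: bnd_dil.
move=> r r1 z zr; apply: fb.
  have : 1 <= n.+1%:R :> R by rewrite ler1n.
  by move=> h; apply: le_trans h _; rewrite ler_peMr //; lra.
apply: le_trans (sqnD _ _) _; rewrite -natr1 mulrDl mul1r addrC.
apply: lerD => //; apply: le_trans (ltW Hn) _.
by rewrite ler_peMr.
Qed.

Lemma growth_D p f : hol f -> growth p f -> growth p (D f).
Proof.
move=> fh [b pb fb]; exists (fun r => 4 * b (2%:R * r)).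
  apply: bndM => //; [|exact: bnd_cst|exact: bnd_dil].
  by move=> r r1; apply: (growth_ge0 fb); lra.
move=> r r1 z zr.
rewrite -[leRHS]divr1; apply: hol_cauchy_estimate => // w wz.
apply: fb; first by lra.
by have := sqn_triB w z; lra.
Qed.

Lemma growth0_polynomial f : hol f -> growth 0 f -> is_polynomial f.
Proof.
move=> fh [b [K K2 H] fb]; apply: (@liouville_poly _ f K (K%:R ^+ K)) => //.
move=> r r1 z zr; apply: le_trans (fb r r1 z zr) _.
by apply: le_trans (H r r1) _; rewrite /iexp /= /scale exprMn.
Qed.

(* By the maximum principle it is enough to bound [f] on one large square for
   each scale. *)
Lemma growth_squares p f b : hol f -> bnd p b ->
  (forall r, 1 <= r -> exists2 s, r <= s & forall z, sqn z = s -> normc (f z) <= b r) ->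
  growth p f.
Proof.
move=> fh pb H; exists (fun r => 8 * Num.max 0 (b (2%:R * r))).
  apply: bndM => //; first by move=> r _; rewrite le_max lexx.
    exact: bnd_cst.
  by apply: bnd_max; [exact: bnd_cst|exact: bnd_dil].
move=> r r1 z zr; have r2 : 1 <= 2%:R * r by lra.
have [s rs Hs] := H _ r2.
apply: (@hol_weak_max _ f 0 s) => //; first lra.
  by move=> w; rewrite subr0 => /Hs h; rewrite le_max h orbT.
by rewrite subr0; lra.
Qed.

End Growth.

(** * Zeros and logarithmic derivatives *)

Section Retraction.
Context {R : realType}.
Local Notation C := R[i].
Local Notation I := (0 +i* 1 : C).
Implicit Types (r s t x y M : R) (f g G Q : C -> C) (z w a d : C).

Definition clamp r x : R := Num.max (- r) (Num.min x r).

(** Precomposition with this projection onto the square turns a function that is well behaved only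
    there into a globally continuous one, as the integral lemmas demand. *)
Definition retract r z : C := clamp r (Re z) +i* clamp r (Im z).

Lemma clamp_id r x : `|x| <= r -> clamp r x = x.
Proof.
by rewrite ler_norml /clamp => /andP[h1 h2]; rewrite min_l // max_r.
Qed.

Lemma clamp_bound r x : 0 <= r -> `|clamp r x| <= r.
Proof.
move=> r0; rewrite ler_norml /clamp le_max lexx /= ge_max ge_min lexx orbT andbT.
lra.
Qed.

Lemma clamp_lip r x y : `|clamp r x - clamp r y| <= `|x - y|.
Proof.
have h u v : `|Num.max (- r) u - Num.max (- r) v| <= `|u - v|.
  have := ler_norm (u - v); have := ler_norm (v - u); rewrite (distrC v).
  by rewrite ler_norml; case: (leP (- r) u) => ?; case: (leP (- r) v) => ?; lra.
apply: le_trans (h _ _) _.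
have := ler_norm (x - y); have := ler_norm (y - x); rewrite (distrC y).
by rewrite ler_norml; case: (leP x r) => ?; case: (leP y r) => ?; lra.
Qed.

Lemma retract_id r z : sqn z <= r -> retract r z = z.
Proof.
rewrite sqn_le => /andP[h1 h2].
by rewrite /retract !clamp_id //; case: z {h1 h2}.
Qed.

Lemma sqn_retract r z : 0 <= r -> sqn (retract r z) <= r.
Proof. by move=> r0; rewrite sqn_le /= !clamp_bound. Qed.

Lemma retract_cont r : cont (retract r).
Proof.
move=> z; apply: (@cont_at_lip _ _ _ 1 2) => // w _.
apply: le_trans (normc_leReIm _) _; rewrite cReB cImB /=.
have := clamp_lip r (Re w) (Re z); have := clamp_lip r (Im w) (Im z).
rewrite -cReB -cImB; have := normc_Re (w - z); have := normc_Im (w - z); lra.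
Qed.

Lemma cont_comp f g : cont f -> (forall z, cont_at g (f z)) -> cont (g \o f).
Proof. by move=> fc gc z; apply: cont_at_comp. Qed.

Lemma retract_cdiff G r z d : sqn z < r -> cdiff G z d ->
  cdiff (G \o retract r) z d.
Proof.
move=> zr; apply: (@cdiff_near _ G _ _ _ (r - sqn z)); first by rewrite subr_gt0.
by move=> w /(sqn_near zr) wr /=; rewrite retract_id // ltW.
Qed.

Lemma cdiff_of_eps f z d : (forall e : R, 0 < e -> exists2 r, 0 < r & forall w,
    normc (w - z) < r -> normc (f w - f z - d * (w - z)) <= e * normc (w - z)) ->
  cdiff f z d.
Proof.
move=> H; exists (fun w => if w == z then d else (f w - f z) / (w - z)); split.
- move=> e e0; rewrite eqxx; have e2 : 0 < e / 2 by rewrite divr_gt0.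
  have [r r0 Hr] := H _ e2; exists r => // w /Hr.
  case: eqVneq => [_ _|wz h]; first by rewrite subrr normc0.
  have wz0 : w - z != 0 by rewrite subr_eq0.
  have wz1 : 0 < normc (w - z) by rewrite normc_gt0.
  have -> : (f w - f z) / (w - z) - d = (f w - f z - d * (w - z)) / (w - z) by field.
  rewrite normcM normcV ltr_pdivrMr //; apply: le_lt_trans h _.
  by rewrite ltr_pM2r //; lra.
- by rewrite eqxx.
- move=> w; case: eqVneq => [->|wz]; first by rewrite !subrr mulr0.
  by rewrite divfK // subr_eq0.
Qed.

Lemma goursat_any G r x0 x1 y0 y1 : cont G ->
  (forall z, sqn z < r -> exists d, cdiff G z d) ->
  `|x0| < r -> `|x1| < r -> `|y0| < r -> `|y1| < r -> rint G x0 x1 y0 y1 = 0.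
Proof.
move=> Gc Gd.
have ord u0 u1 v0 v1 : u0 <= u1 -> v0 <= v1 -> `|u0| < r -> `|u1| < r ->
    `|v0| < r -> `|v1| < r -> rint G u0 u1 v0 v1 = 0.
  move=> u01 v01; rewrite !ltr_norml => u0r u1r v0r v1r.
  apply: goursat => // x y xP yP; apply: Gd; rewrite sqn_lt /= !ltr_norml; lra.
move=> h1 h2 h3 h4.
have swapx u0 u1 v0 v1 : rint G u0 u1 v0 v1 = - rint G u1 u0 v0 v1.
  by rewrite /rint /cint; ring.
have swapy u0 u1 v0 v1 : rint G u0 u1 v0 v1 = - rint G u0 u1 v1 v0.
  by rewrite /rint /cint; ring.
have [x01|/ltW x01] := leP x0 x1; have [y01|/ltW y01] := leP y0 y1.
- exact: ord.
- by rewrite swapy ord ?oppr0.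
- by rewrite swapx ord ?oppr0.
- by rewrite swapx swapy ord ?oppr0.
Qed.

Lemma cint_bound_any (p : R -> C) (u v M : R) : (forall t, rcont p t) ->
  (forall t, `|t - u| <= `|v - u| -> normc (p t) <= M) ->
  normc (cint p u v) <= 2 * M * `|v - u|.
Proof.
move=> pc pM; have [uv|/ltW vu] := leP u v.
  rewrite ger0_norm ?subr_ge0 //; apply: cint_bound => // t /andP[ut tv].
  by apply: pM; rewrite !ger0_norm ?subr_ge0 // lerD2r.
rewrite (_ : cint p u v = - cint p v u); last by rewrite /cint opprB.
rewrite normcN distrC ger0_norm ?subr_ge0 //; apply: cint_bound => // t /andP[vt tu].
by apply: pM; rewrite !ler0_norm ?subr_le0 // lerN2 lerD2r.
Qed.

Lemma cint_cst (k : C) (u v : R) : cint (fun=> k) u v = k * (v - u)%:C.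
Proof.
have kc t : rcont (fun=> k) t by move=> e e0; exists 1 => // s _; rewrite subrr normc0.
rewrite (@cint_unique_all _ _ (fun t => k * t%:C)) //; first by rewrite rmorphB /=; ring.
move=> t; rewrite -[k]mulr1; rewrite (_ : (fun s => _) = (fun s => k * s%:C)); last first.
  by rewrite mulr1.
apply: rderivZ; split => /=.
  exact: is_derive_id.
exact: is_derive_cst.
Qed.

Definition lprim G z := cint (fun s => G (s +i* 0)) 0 (Re z) +
  I * cint (fun t => G (Re z +i* t)) 0 (Im z).

Lemma lprim0 G : lprim G 0 = 0.
Proof. by rewrite /lprim /cint /= !subrr mulr0 addr0. Qed.

(** [lprim] integrates from 0 along the real axis and then vertically. Goursat on the rectangle with
    corners Re z and (Re w, Im z) turns the increment from [z] to [w] into an integral along a path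
    from [z] to [w], where [G] is close to [G z]. *)
Lemma lprim_cdiff G r z : cont G ->
  (forall w, sqn w < r -> exists d, cdiff G w d) -> sqn z < r ->
  cdiff (lprim G) z (G z).
Proof.
move=> Gc Gd zr; apply: cdiff_of_eps => e e0.
have e4 : 0 < e / 4 by rewrite divr_gt0.
have [u u0 Hu] := Gc z _ e4.
exists (Num.min (u / 2) (r - sqn z)); first by rewrite lt_min divr_gt0 // subr_gt0.
move=> w; rewrite lt_min => /andP[wu /(sqn_near zr) wr].
have := normc_Re (w - z); have := normc_Im (w - z); rewrite cReB cImB.
move: zr wr; rewrite !sqn_lt => /andP[xr yr] /andP[xr' yr'].
have r0 : `|0 : R| < r by rewrite normr0; apply: le_lt_trans xr.
have := goursat_any Gc Gd xr xr' r0 yr.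
have Gh y t : rcont (fun s => G (s +i* y)) t by exact: cont_at_hline.
have Gv x t : rcont (fun s => G (x +i* s)) t by exact: cont_at_vline.
pose x := Re z; pose y := Im z; pose x' := Re w; pose y' := Im w.
rewrite -/x -/y -/x' -/y' => Rect hy hx.
have zE : z = x +i* y by rewrite /x /y; case: (z).
have wE : w = x' +i* y' by rewrite /x' /y'; case: (w).
have wz : w - z = (x' - x)%:C + I * (y' - y)%:C.
  by rewrite zE wE; apply: ReIm_eq => /=; ring.
have small s t : `|s - x| <= `|x' - x| -> `|t - y| <= `|y' - y| ->
    normc (G (s +i* t) + (-1) * G z) <= e / 4.
  move=> sx ty; rewrite mulN1r; apply: ltW; apply: Hu.
  apply: le_lt_trans (normc_leReIm _) _; rewrite cReB cImB /= -/x -/y; lra.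
have -> : lprim G w - lprim G z - G z * (w - z) =
    cint (fun s => G (s +i* y) + (-1) * G z) x x' +
    I * cint (fun t => G (x' +i* t) + (-1) * G z) y y'.
  have cc t : rcont (fun=> (-1) * G z) t by move=> d d0; exists 1 => // s _; rewrite subrr normc0.
  rewrite !cintD // !cint_cst wz /lprim -/x -/y -/x' -/y'.
  move: Rect; rewrite /rint /cint => Rect.
  rewrite -[RHS]addr0 -Rect; ring.
have b1 : normc (cint (fun s => G (s +i* y) + (-1) * G z) x x') <= 2 * (e / 4) * `|x' - x|.
  apply: cint_bound_any => [t|t tx].
    by apply: rcontD => // d d0; exists 1 => // s _; rewrite subrr normc0.
  by apply: small => //; rewrite subrr normr0.
have b2 : normc (cint (fun t => G (x' +i* t) + (-1) * G z) y y') <= 2 * (e / 4) * `|y' - y|.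
  apply: cint_bound_any => [t|t tx].
    by apply: rcontD => // d d0; exists 1 => // s _; rewrite subrr normc0.
  by apply: small.
apply: le_trans (le_normcD _ _) _; rewrite normcM.
rewrite (_ : normc I = 1) ?mul1r; last by rewrite /normc /= expr0n expr1n add0r sqrtr1.
nra.
Qed.

Lemma local_cauchy_estimate G c r M d : cont G ->
  (forall z, sqn (z - c) <= r -> exists e, cdiff G z e) -> 0 < r ->
  (forall z, sqn (z - c) = r -> normc (G z) <= M) -> cdiff G c d ->
  normc d <= 4 * M / r.
Proof.
move=> Gc Gh r0 GM Gd; apply: (@cauchy_estimate _ (fun z => G (z + c))) => //.
- move=> z; apply: (@cont_at_comp _ (fun z => z + c) G) => //.
  by apply: cont_atD; [exact: cont_at_id|exact: cont_at_cst].
- move=> z zr; have [|e Ge] := Gh (z + c); first by rewrite addrK.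
  by exists e; apply: cdiff_shift.
- by move=> z zr; apply: GM; rewrite addrK.
- by apply: cdiff_shift; rewrite add0r.
Qed.

(* Borel-Carathéodory: [Q / (2 A - Q)] maps into the unit disc and vanishes at 0. *)
Lemma borel_caratheodory Q r (A : R) : cont Q ->
  (forall z, sqn z <= r -> exists d, cdiff Q z d) -> 0 < r -> 0 < A ->
  Q 0 = 0 -> (forall z, Re (Q z) <= A) ->
  forall z, sqn z <= r / 64 -> normc (Q z) <= 2 * A.
Proof.
move=> Qc Qh r0 A0 Q0 QA.
pose den z := (2 * A)%:C - Q z.
have den0 z : den z != 0.
  apply/eqP => /(congr1 (@complex.Re R)); rewrite cReB /=.
  by have := QA z; lra.
pose phi z := Q z * (den z)^-1.
have denc : cont den by move=> z; apply: cont_atB => //; exact: cont_at_cst.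
have phic : cont phi by move=> z; apply: cont_atM => //; exact: cont_atV.
have phih z : sqn z <= r -> exists d, cdiff phi z d.
  move=> /Qh [d Qd]; have dd := cdiffB (cdiff_cst (2 * A)%:C z) Qd.
  by eexists; exact: cdiffM Qd (cdiffV (den0 z) dd).
have phi1 z : normc (phi z) <= 1.
  rewrite /phi normcM normcV ler_pdivrMr ?normc_gt0 // mul1r.
  rewrite -(@ler_pXn2r _ 2) ?nnegrE ?normc_ge0 // !sqr_normc_def /den cReB cImB /=.
  by have := QA z; nra.
have phi0 : phi 0 = 0 by rewrite /phi Q0 mul0r.
move=> z zr; have z0 := sqn_ge0 z.
pose p (s : R) := phi (0 + s%:C * z).
have sz (s : R) : 0 <= s <= 1 -> sqn (0 + s%:C * z) <= sqn z.
  move=> /andP[s0 s1]; rewrite add0r.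
  have -> : sqn (s%:C * z) = s * sqn z.
    by rewrite /sqn cReM cImM /= !mul0r subr0 addr0 !normrM (ger0_norm s0) maxr_pMr.
  by rewrite ler_piMl.
have /choice [D HD] : forall s : R, exists d : C,
    0 <= s <= 1 -> cdiff phi (0 + s%:C * z) d.
  move=> s; have [s01|ns] := pselect (0 <= s <= 1); last by exists 0.
  have [|d Hd] := phih (0 + s%:C * z); first by have := sz s s01; lra.
  by exists d.
have DB s : 0 <= s <= 1 -> normc (D s) <= 8 / r.
  move=> s01; have szs := sz s s01.
  have -> : 8 / r = 4 * 1 / (r / 2) by field; rewrite gt_eqF.
  apply: (local_cauchy_estimate phic _ _ _ (HD s s01)).
  - move=> w wr; apply: phih; have := sqn_triB w (0 + s%:C * z); lra.
  - by rewrite divr_gt0.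
  - by move=> w _; exact: phi1.
(* The derivative bound 8 / r and |z| <= 2 [sqn z] give 32 [sqn z] / r, whence the radius r / 64. *)
have hz : normc (phi z) <= 1 / 2.
  have E : phi z = p 1 - p 0 by rewrite /p mul1r mul0r !add0r phi0 subr0.
  rewrite E; have := @rderiv_bound R p (fun s => D s * z) 0 1 (8 / r * normc z) ler01.
  move=> H; apply: le_trans (H _ _) _.
  - by move=> s s01; apply: cdiff_line; exact: HD.
  - by move=> s s01; rewrite normcM ler_wpM2r ?normc_ge0 // DB.
  - have := normc_le_sqn z; rewrite subr0 mulr1 => h.
    rewrite mulrA -mulrAC mulrA mulrC ler_pdivrMl //; lra.
have E : Q z = (2 * A)%:C * phi z - Q z * phi z.
  by rewrite /phi -mulrBl -/(den z) mulrCA mulfV ?mulr1.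
have : normc (Q z) <= 2 * A * (1 / 2) + normc (Q z) * (1 / 2).
  rewrite {1}E; apply: le_trans (le_normcD _ _) _; rewrite normcN.
  rewrite (normcM _ (phi z)) (normcM (Q z) (phi z)) normc_real gtr0_norm ?mulr_gt0 //; apply: lerD.
    by rewrite ler_pM2l ?mulr_gt0.
  by rewrite ler_wpM2l ?normc_ge0.
lra.
Qed.

End Retraction.

(** * Zero-free functions *)

Section ZeroFree.
Context {R : realType}.
Local Notation C := R[i].
Local Notation D f := (derive1 ((f : C -> C) : C^o -> C^o)).
Implicit Types (r s t x y M : R) (f g G Q F : C -> C) (z w a d : C).

Lemma is_derive_normc2 (p : R -> C) t d : rderiv p t d ->
  is_derive t 1 (fun s => normc (p s) ^+ 2) (2 * Re (p t) * Re d + 2 * Im (p t) * Im d).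
Proof.
move=> [pr pi].
rewrite (_ : (fun s => _) = (fun s => Re (p s)) ^+ 2 + (fun s => Im (p s)) ^+ 2); last first.
  by apply/funext => s; rewrite sqr_normc_def.
apply: is_derive_eq (is_deriveD (is_deriveX 2 pr) (is_deriveX 2 pi)) _.
have sc (x y : R) : x *: (y : R^o) = x * y by [].
by rewrite !sc /= !expr1.
Qed.

(** [Q] is a logarithm of F / F 0. The identity is stated for moduli, so that the real exponential
    suffices: |F|^2 exp (- 2 Re Q) has derivative 0 along each segment from 0. *)
Lemma normc_exp_primitive F Q r : hol F ->
  (forall z, sqn z < r -> F z != 0) ->
  (forall z, sqn z < r -> cdiff Q z (D F z / F z)) -> Q 0 = 0 ->
  forall z, sqn z < r -> normc (F z) ^+ 2 = normc (F 0) ^+ 2 * expR (2 * Re (Q z)).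
Proof.
move=> Fh F0 Qd Q0 z zr.
pose N (s : R) := normc (F (0 + s%:C * z)) ^+ 2.
pose u (s : R) := Re (Q (0 + s%:C * z)).
pose k := N * (expR \o (fun s => - 2 * u s)).
have sz (s : R) : 0 <= s <= 1 -> sqn (0 + s%:C * z) < r.
  move=> /andP[s0 s1]; rewrite add0r.
  have -> : sqn (s%:C * z) = s * sqn z.
    by rewrite /sqn cReM cImM /= !mul0r subr0 addr0 !normrM (ger0_norm s0) maxr_pMr.
  by apply: le_lt_trans zr; rewrite ler_piMl ?sqn_ge0.
have kd s : 0 <= s <= 1 -> is_derive s 1 k 0.
  move=> s01; have szs := sz s s01; have Fz := F0 _ szs.
  set w := 0 + s%:C * z in szs Fz.
  have h1 := is_derive_normc2 (cdiff_line (hol_cdiff w Fh)).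
  have [h2 _] := cdiff_line (Qd w szs).
  have h3 : is_derive s 1 (fun s => - 2 * u s) (- 2 * Re (D F w / F w * z)).
    by apply: (@is_deriveZ _ _ _ u (-2)).
  have h4 := @is_derive1_comp R expR _ s _ _ (is_derive_expR _) h3.
  rewrite /k; apply: is_derive_eq (is_deriveM h1 h4) _.
  rewrite /GRing.scale /= /N -/w.
  have E : D F w * z = (D F w / F w * z) * F w by field.
  rewrite {}E; move: (D F w / F w * z) => q.
  rewrite sqr_normc_def -/(u s) cReM cImM; move: (expR _) => e; ring.
have := @is_derive_le R k (fun=> 0) 0 1 0 ler01 kd (fun t _ => lexx 0).
have := @is_derive_ge R k (fun=> 0) 0 1 0 ler01 kd (fun t _ => lexx 0).
rewrite mul0r subr_ge0 subr_le0 => k1 k2.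
have : k 1 = k 0 by apply/eqP; rewrite eq_le k1 k2.
have kE s : k s = N s * expR (- 2 * u s) by [].
rewrite !kE /N /u mul0r mul1r !add0r Q0 /= mulr0 expR0 mulr1 => <-.
by rewrite -mulrA -expRD mulNr addNr expR0 mulr1.
Qed.

(** The real part of the logarithm of F / F 0 is at most [A], so Borel-Carathéodory bounds its
    modulus by 2 A. This gives the lower bound for F directly and the bound for F' / F by Cauchy's
    estimate. *)
Lemma zero_free_bounds F (r A : R) : hol F -> 0 < r -> 0 < A ->
  (forall z, sqn z <= r -> F z != 0) ->
  (forall z, sqn z <= r -> normc (F z) <= expR A * normc (F 0)) ->
  forall z, sqn z <= r / 512 ->
  normc (D F z) <= 4096 * A / r * normc (F z) /\
  normc (F 0) * expR (- (2 * A)) <= normc (F z).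
Proof.
move=> Fh r0 A0 F0 FA z zr.
have f00 : 0 < normc (F 0) by rewrite normc_gt0 F0 // sqn0 ltW.
pose G := (fun w => D F w * (F w)^-1) \o retract r.
have Gc : cont G.
  apply: cont_comp; first exact: retract_cont.
  move=> w; have wr := sqn_retract w (ltW r0).
  apply: cont_atM; first exact: hol_cont (hol_D Fh) _.
  by apply: cont_atV; [exact: F0|exact: hol_cont].
have Gh w : sqn w < r -> exists d, cdiff G w d.
  move=> wr; eexists; apply: (retract_cdiff wr).
  exact: cdiffM (hol_cdiff w (hol_D Fh)) (cdiffV (F0 _ (ltW wr)) (hol_cdiff w Fh)).
have GE w : sqn w <= r -> G w = D F w / F w by move=> wr; rewrite /G /= retract_id.
have Ld w : sqn w < r -> cdiff (lprim G) w (G w) := lprim_cdiff Gc Gh.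
(* Retracting to t < r keeps the argument of [lprim G] in the open square where it is
   differentiable. Borel-Carathéodory at radius t / 2 reaches r / 256, and r / 512 leaves room for a
   Cauchy estimate around [z]: 4 (2 A) / (r / 512) = 4096 A / r. *)
pose t := r / 2.
have tr : t < r by rewrite /t; lra.
have t0 : 0 < t by rewrite divr_gt0.
pose Q := lprim G \o retract t.
have Qc : cont Q.
  apply: cont_comp; first exact: retract_cont.
  by move=> w; apply: cdiff_cont (Ld _ _); apply: le_lt_trans tr; apply: sqn_retract; exact: ltW.
have Qd w : sqn w < t -> cdiff Q w (D F w / F w).
  move=> wt; rewrite -GE; last by lra.
  by apply: retract_cdiff => //; apply: Ld; lra.
have Q0 : Q 0 = 0 by rewrite /Q /= retract_id ?lprim0 // sqn0 ltW.
have FQ w : sqn w < r -> normc (F w) ^+ 2 = normc (F 0) ^+ 2 * expR (2 * Re (lprim G w)).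
  apply: normc_exp_primitive => //; last exact: lprim0.
  - by move=> v vr; apply: F0; exact: ltW.
  - by move=> v vr; rewrite -GE; [exact: Ld|exact: ltW].
have QA w : Re (Q w) <= A.
  have wr : sqn (retract t w) < r by apply: le_lt_trans tr; apply: sqn_retract; exact: ltW.
  have : normc (F 0) ^+ 2 * expR (2 * Re (Q w)) <= normc (F 0) ^+ 2 * expR (2 * A).
    rewrite /Q /= -(FQ _ wr) expRM_natl -exprMn mulrC.
    apply: lerXn2r; rewrite ?nnegrE ?normc_ge0 ?mulr_ge0 ?expR_ge0 ?normc_ge0 //.
    exact: FA (ltW wr).
  rewrite ler_pM2l ?exprn_gt0 // ler_expR; lra.
have t2 : 0 < t / 2 by rewrite divr_gt0.
have Qh w : sqn w <= t / 2 -> exists d, cdiff Q w d.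
  by move=> wt; eexists; apply: Qd; lra.
have Q2 := @borel_caratheodory R Q (t / 2) A Qc Qh t2 A0 Q0 QA.
have z0 := sqn_ge0 z.
have r512 : 0 < r / 512 by lra.
have zt : sqn z < t by rewrite /t; lra.
have Q2z w : sqn (w - z) <= r / 512 -> normc (Q w) <= 2 * A.
  by move=> wz; apply: Q2; have := sqn_triB w z; rewrite /t; lra.
split.
  have Fz : F z != 0 by apply: F0; rewrite /t in zt; lra.
  have : normc (D F z / F z) <= 4 * (2 * A) / (r / 512).
    apply: (local_cauchy_estimate Qc _ _ _ (Qd z zt)).
    - move=> w wz; apply: Qh; have := sqn_triB w z; rewrite /t; lra.
    - exact: r512.
    - by move=> w wz; apply: Q2z; rewrite wz.
  rewrite normcM normcV ler_pdivrMr ?normc_gt0 // => h; apply: le_trans h _.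
  rewrite ler_wpM2r ?normc_ge0 // le_eqVlt; apply/orP; left; apply/eqP; field.
  by rewrite gt_eqF.
have zr' : sqn z < r by rewrite /t in zt; lra.
rewrite -(@ler_pXn2r _ 2) ?nnegrE ?mulr_ge0 ?expR_ge0 ?normc_ge0 // (FQ _ zr').
rewrite exprMn -expRM_natl ler_pM2l ?exprn_gt0 // ler_expR.
have := Q2z z; rewrite subrr sqn0 => /(_ (ltW r512)).
have := normc_Re (Q z); have := ler_norm (- Re (Q z)); rewrite normrN.
have -> : lprim G z = Q z by rewrite /Q /= retract_id // ltW.
lra.
Qed.

End ZeroFree.

(** * Counting, dividing out and avoiding zeros *)

Section Zeros.
Context {R : realType}.
Local Notation C := R[i].
Local Notation D f := (derive1 ((f : C -> C) : C^o -> C^o)).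
Implicit Types (r s t x y M : R) (f g h F : C -> C) (z w a d : C) (l : seq C).

Definition zprod l z : C := \prod_(a <- l) (z - a).

Lemma hol_zprod l : hol (zprod l).
Proof.
elim: l => [|a l IH].
  by apply: hol_ext (hol_cst 1) => z; rewrite /zprod big_nil.
apply: hol_ext (holM (holB hol_id (hol_cst a)) IH) => z.
by rewrite /zprod big_cons.
Qed.

Lemma zprod_ge l z (e : R) : 0 <= e -> (forall a, a \in l -> e <= normc (z - a)) ->
  e ^+ size l <= normc (zprod l z).
Proof.
move=> e0; elim: l => [|a l IH] H; first by rewrite /zprod big_nil normc1.
rewrite /zprod big_cons normcM /= exprS.
apply: ler_pM; rewrite ?exprn_ge0 //; first by apply: H; rewrite mem_head.
by apply: IH => b bl; apply: H; rewrite in_cons bl orbT.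
Qed.

Lemma zprod_le l z (e : R) : (forall a, a \in l -> normc (z - a) <= e) ->
  normc (zprod l z) <= e ^+ size l.
Proof.
elim: l => [|a l IH] H; first by rewrite /zprod big_nil normc1.
rewrite /zprod big_cons normcM /= exprS.
apply: ler_pM; rewrite ?normc_ge0 //; first by apply: H; rewrite mem_head.
by apply: IH => b bl; apply: H; rewrite in_cons bl orbT.
Qed.

Lemma expR1_le4 : expR 1 <= 4 :> R.
Proof.
have h := expR_ge1Dx (- (1 / 2) : R); have e0 := expR_gt0 (1 / 2 : R).
rewrite expRN in h.
have h2 : expR (1 / 2) <= 2 :> R.
  rewrite -(@ler_pM2r _ (expR (1 / 2))^-1) ?invr_gt0 // mulfV ?gt_eqF //.
  by move: h; lra.
have -> : (1 : R) = 1 / 2 + 1 / 2 by lra.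
rewrite expRD; nra.
Qed.

Section Decomposition.
Variables (h : C -> C) (r E : R).
Hypotheses (hh : hol h) (h0 : h 0 != 0) (r0 : 0 < r).
Hypothesis hE : forall z, sqn z = 9 * r -> normc (h z) <= expR E.

Let decomp l F := [/\ hol F, (forall z, h z = zprod l z * F z) &
  forall a, a \in l -> sqn a <= r].

Lemma quotient_bound l F : decomp l F -> forall z, sqn z <= r ->
  normc (F z) <= 8 * (expR E / (8 * r) ^+ size l).
Proof.
move=> [Fh hF lr] z zr.
have r9 : 0 < 9 * r by rewrite mulr_gt0.
apply: (hol_weak_max Fh r9 (c := 0)); last by rewrite subr0; lra.
move=> w; rewrite subr0 => wr.
have r8 : 0 < (8 * r) ^+ size l by rewrite exprn_gt0 // mulr_gt0.
rewrite ler_pdivlMr // mulrC.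
have := hE wr; rewrite hF normcM; apply: le_trans.
rewrite ler_wpM2r ?normc_ge0 //; apply: zprod_ge; first by rewrite mulr_ge0 // ltW.
move=> a /lr ar; have := sqn_triB w a; have := sqn_le_normc (w - a); lra.
Qed.

Lemma quotient_ge l F : decomp l F ->
  normc (h 0) <= (2 * r) ^+ size l * normc (F 0).
Proof.
move=> [Fh hF lr]; rewrite hF normcM ler_wpM2r ?normc_ge0 //.
apply: zprod_le => a /lr ar; rewrite sub0r normcN.
have := normc_le_sqn a; lra.
Qed.

(** Each zero costs a factor 4: its linear factor is at least 8 r on the square of radius 9 r and at
    most 2 r at 0. Since exp 1 <= 4, this bounds the number of zeros by [E] plus a constant. *)
Let Jensen l F : decomp l F -> (4 : R) ^+ size l * normc (h 0) <= 8 * expR E.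
Proof.
move=> dec; have h1 := quotient_ge dec.
have h2 : normc (F 0) <= _ := quotient_bound dec _; rewrite sqn0 in h2.
have {}h2 := h2 (ltW r0).
have r2 : 0 < (2 * r) ^+ size l by rewrite exprn_gt0 // mulr_gt0.
have r8 : 0 < (8 * r) ^+ size l by rewrite exprn_gt0 // mulr_gt0.
have E8 : (8 * r) ^+ size l = 4 ^+ size l * (2 * r) ^+ size l.
  by rewrite -exprMn; congr (_ ^+ _); ring.
have h3 := le_trans h1 (ler_wpM2l (ltW r2) h2).
have p4 : 0 < 4 ^+ size l :> R by rewrite exprn_gt0.
apply: le_trans (ler_wpM2l (ltW p4) h3) _.
rewrite E8 le_eqVlt; apply/orP; left; apply/eqP; field.
by rewrite !gt_eqF.
Qed.

Let c0 : R := ln 8 - ln (normc (h 0)).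

Lemma size_zeros l F : decomp l F -> (size l)%:R <= E + c0.
Proof.
move=> /Jensen H; have n0 : 0 < normc (h 0) by rewrite normc_gt0.
rewrite -ler_expR /c0 addrA expRB expRD !lnK ?posrE //.
rewrite ler_pdivlMr //; rewrite mulrC in H.
rewrite mulrC; apply: le_trans (_ : _ <= normc (h 0) * 4 ^+ size l) _; last first.
  by rewrite [leRHS]mulrC.
rewrite ler_pM2l // -[(size l)%:R]mulr1 expRM_natl.
by apply: lerXn2r; rewrite ?nnegrE ?expR_ge0 // expR1_le4.
Qed.

(* Dividing out zeros must stop, because [size_zeros] bounds how many can be
   divided out. *)
Lemma zero_decomposition : exists l F, decomp l F /\ forall z, sqn z <= r -> F z != 0.
Proof.
apply: contrapT => H.
have step k : exists l F, decomp l F /\ size l = k.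
  elim: k => [|k [l [F [dec lk]]]].
    exists [::], h; split=> //; split=> // z; by rewrite /zprod big_nil mul1r.
  have [a ar Fa] : exists2 a, sqn a <= r & F a = 0.
    apply: contrapT => noz; apply: H; exists l, F; split=> // z zr.
    by apply/eqP => Fz; apply: noz; exists z.
  exists (a :: l), (hslope F a); split; last by rewrite /= lk.
  move: dec => [Fh hF lr]; split.
  - exact: hol_hslope.
  - move=> z; rewrite hF {1}(hslopeE F a z) Fa add0r /zprod big_cons; ring.
  - by move=> b; rewrite in_cons => /orP[/eqP -> //|/lr].
have [n Hn] := natr_gt (E + c0).
have [l [F [dec ln]]] := step n.
by have := size_zeros dec; rewrite ln leNgt Hn.
Qed.

End Decomposition.

(** Every zero adds 1 / (z - a), of modulus at most 1 / e, to the logarithmic derivative. *)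
Lemma log_derivative_zprod l F z (e B : R) : hol F -> 0 < e -> 
  (forall a, a \in l -> e <= normc (z - a)) -> normc (D F z) <= B * normc (F z) ->
  normc (D (fun w => zprod l w * F w) z) <=
    ((size l)%:R / e + B) * normc (zprod l z * F z).
Proof.
move=> Fh e0; elim: l => [|a l IH] H FB.
  rewrite (_ : (fun w => _) = F) ?mul0r ?add0r ?mul1r //.
    by rewrite /zprod big_nil mul1r.
  by apply/funext => w; rewrite /zprod big_nil mul1r.
pose g w := zprod l w * F w.
have gh : hol g by apply: holM => //; exact: hol_zprod.
have -> : (fun w => zprod (a :: l) w * F w) = (fun w => (w - a) * g w).
  by apply/funext => w; rewrite /zprod big_cons mulrA.
have -> : zprod (a :: l) z * F z = (z - a) * g z by rewrite /zprod big_cons mulrA.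
have -> : D (fun w => (w - a) * g w) z = (1 - 0) * g z + (z - a) * D g z.
  apply: cdiff_D; apply: cdiffM; last exact: hol_cdiff.
  by apply: cdiffB; [exact: cdiff_id|exact: cdiff_cst].
have ea : e <= normc (z - a) by apply: H; rewrite mem_head.
have {}IH : normc (D g z) <= ((size l)%:R / e + B) * normc (g z).
  by apply: IH => // b bl; apply: H; rewrite in_cons bl orbT.
rewrite subr0 mul1r; apply: le_trans (le_normcD _ _) _; rewrite !(normcM (z - a)).
have h1 : normc (g z) <= e^-1 * (normc (z - a) * normc (g z)).
  by rewrite mulrA ler_peMl ?normc_ge0 // ler_pdivlMl // mulr1.
have h2 := ler_wpM2l (normc_ge0 (z - a)) IH.
rewrite [leRHS](_ : _ = e^-1 * (normc (z - a) * normc (g z)) +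
  normc (z - a) * (((size l)%:R / e + B) * normc (g z))).
  exact: lerD.
by rewrite /= -natr1; ring.
Qed.

(** Pigeonhole: n + 1 candidates are spaced by r / (n + 1), so each of the n points comes within
    half that distance of at most one candidate. *)
Lemma avoid_radius (u : seq R) r : 0 < r -> exists2 s, r <= s <= 2 * r &
  forall x, x \in u -> r / (2 * (size u).+1%:R) <= `|s - x|.
Proof.
move=> r0; pose n := size u.
have n0 : 0 < n.+1%:R :> R by rewrite ltr0n.
pose cand (j : 'I_n.+1) := r + r * j%:R / n.+1%:R.
have candP j : r <= cand j <= 2 * r.
  have j0 : 0 <= j%:R :> R by [].
  have jn : j%:R <= n.+1%:R :> R by rewrite ler_nat ltnW.
  rewrite /cand lerDl divr_ge0 ?mulr_ge0 ?(ltW r0) ?(ltW n0) //=.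
  by rewrite mulr_natl mulr2n lerD2l ler_pdivrMr // ler_pM2l.
apply: contrapT => H.
have hit (j : 'I_n.+1) : exists i : 'I_n,
    `|cand j - nth 0 u i| < r / (2 * n.+1%:R).
  apply: contrapT => nohit; apply: H; exists (cand j); first exact: candP.
  move=> x xu; rewrite leNgt; apply/negP => hx; apply: nohit.
  have iu : (index x u < n)%N by rewrite /n index_mem.
  by exists (Ordinal iu) => /=; rewrite nth_index.
have [f Hf] := choice hit.
have finj : injective f.
  move=> j k fjk; have h1 := Hf j; have h2 := Hf k; rewrite -fjk in h2.
  have : `|cand j - cand k| < r / n.+1%:R.
    rewrite (_ : cand j - cand k = (cand j - nth 0 u (f j)) - (cand k - nth 0 u (f j))); last by ring.
    apply: le_lt_trans (ler_normB _ _) _.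
    rewrite [ltRHS](_ : _ = r / (2 * n.+1%:R) + r / (2 * n.+1%:R)); last by field; rewrite gt_eqF.
    exact: ltrD.
  have -> : cand j - cand k = (j%:R - k%:R) * (r / n.+1%:R).
    by rewrite /cand; ring.
  rewrite normrM (ger0_norm (divr_ge0 (ltW r0) (ltW n0))).
  rewrite -ltr_pdivlMr ?divr_gt0 // divff ?gt_eqF ?divr_gt0 // => jk.
  apply: val_inj; apply/eqP; rewrite /= eqn_leq.
  move: jk; rewrite ltr_norml => /andP[jk kj].
  have jk' : (k%:R : R) < j.+1%:R by rewrite -natr1; lra.
  have kj' : (j%:R : R) < k.+1%:R by rewrite -natr1; lra.
  by rewrite !ltr_nat !ltnS in jk' kj'; rewrite kj' jk'.
have := leq_card f finj; rewrite !card_ord.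
by rewrite ltnn.
Qed.

End Zeros.

(** * Squares on which functions stay away from their zeros *)

Section GoodSquares.
Context {R : realType}.
Local Notation C := R[i].
Local Notation D f := (derive1 ((f : C -> C) : C^o -> C^o)).
Implicit Types (r s t x y M : R) (f g h F : C -> C) (z w a d : C) (l : seq C).

Lemma bnd_sum p n (b : 'I_n -> R -> R) : (forall i, bnd p (b i)) ->
  bnd p (fun r => \sum_(i < n) b i r).
Proof.
elim: n b => [|n IH] b pb.
  by apply: bnd_le (bnd_cst p 0) => r _; rewrite big_ord0.
apply: bnd_le (bndD (pb ord0) (IH (fun i => b (lift ord0 i)) _)) => [r _|i]; last exact: pb.
by rewrite big_ord_recl.
Qed.

(** Hides both radius ratio and derivative constant behind one symbol, which keeps later arithmetic
    small. *)
Lemma zero_free_bounds_ex : exists2 c : R, 1 <= c & forall F (r A : R),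
  hol F -> 0 < r -> 0 < A -> (forall z, sqn z <= r -> F z != 0) ->
  (forall z, sqn z <= r -> normc (F z) <= expR A * normc (F 0)) ->
  forall z, sqn z <= r / c ->
  normc (D F z) <= c * A / r * normc (F z) /\
  normc (F 0) * expR (- (2 * A)) <= normc (F z).
Proof.
exists 4096; first by lra.
move=> F r A Fh r0 A0 F0 FA z zr; apply: zero_free_bounds => //.
by apply: le_trans zr _; lra.
Qed.

(** The zero factor is controlled by the distance [e] to the zeros and the cofactor by the zero-free
    case. In [A], the logarithms ensure 8 exp E <= |h 0| exp A, and the final 1 makes [A]
    positive. *)
Lemma zeros_and_bounds : exists2 c : R, 1 <= c & forall h (r E : R),
  hol h -> h 0 != 0 -> 0 < r -> 0 <= E ->
  (forall z, sqn z = 9 * r -> normc (h z) <= expR E) ->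
  let A := E + (ln 8 + `|ln (normc (h 0))| + 1) in
  exists l, (size l)%:R <= A /\ forall z e, sqn z <= r / c -> 0 < e ->
    (forall a, a \in l -> e <= normc (z - a)) ->
    [/\ h z != 0, normc (D h z) <= ((size l)%:R / e + c * A / r) * normc (h z) &
        e ^+ size l * ((normc (h 0) / (2 * r) ^+ size l) * expR (- (2 * A)))
          <= normc (h z)].
Proof.
have [c c1 Zc] := zero_free_bounds_ex; exists c => // h r E.
move=> hh h0 r0 E0 hE A.
have n0 : 0 < normc (h 0) by rewrite normc_gt0.
have ln8 : 0 <= ln 8 :> R by apply: ln_ge0; rewrite ler1n.
have lnh := ler_norm (- ln (normc (h 0))); rewrite normrN in lnh.
have A0 : 0 < A by rewrite /A; have := normr_ge0 (ln (normc (h 0))); lra.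
have EA : E + (ln 8 - ln (normc (h 0))) <= A by rewrite /A; lra.
have [l [F [dec Fz]]] := zero_decomposition hh h0 r0 hE.
have [Fh hF lr] := dec.
have r2 : 0 < (2 * r) ^+ size l by rewrite exprn_gt0 // mulr_gt0.
have r8 : 0 < (8 * r) ^+ size l by rewrite exprn_gt0 // mulr_gt0.
have F0 : normc (h 0) / (2 * r) ^+ size l <= normc (F 0).
  by rewrite ler_pdivrMr // mulrC; exact: (quotient_ge dec).
have FA z : sqn z <= r -> normc (F z) <= expR A * normc (F 0).
  move=> zr; apply: le_trans (quotient_bound r0 hE dec zr) _.
  apply: le_trans (ler_wpM2l (expR_ge0 A) F0).
  have h1 : 8 * expR E <= expR A * normc (h 0).
    apply: le_trans (ler_wpM2r (ltW n0) (_ : expR (E + (ln 8 - ln (normc (h 0)))) <= _)).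
      rewrite addrA expRB expRD !lnK ?posrE // divfK ?gt_eqF //.
      by rewrite mulrC.
    by rewrite ler_expR.
  rewrite !mulrA; apply: ler_pM; rewrite ?mulr_ge0 ?expR_ge0 ?invr_ge0 ?(ltW r8) //.
  rewrite lef_pV2 ?posrE //; apply: lerXn2r; rewrite ?nnegrE; lra.
have Z := Zc F r A Fh r0 A0 Fz FA.
exists l; split; first by apply: le_trans (size_zeros h0 r0 hE dec) _.
move=> z e zr e0 le.
have rz : sqn z <= r.
  apply: le_trans zr _; rewrite ler_pdivrMr; last by lra.
  by rewrite ler_peMr // ltW.
have [Z1 Z2] := Z z zr.
have e1 : 0 < e ^+ size l by rewrite exprn_gt0.
have zp := zprod_ge (ltW e0) le.
split.
- rewrite hF mulf_neq0 ?Fz // -normc_gt0; exact: lt_le_trans zp.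
- have -> : h = fun w => zprod l w * F w by apply/funext.
  exact: log_derivative_zprod.
- rewrite (hF z) normcM; apply: ler_pM => //; first exact: ltW.
    by rewrite mulr_ge0 ?expR_ge0 // divr_ge0 ?normc_ge0 // ltW.
  by apply: le_trans Z2; rewrite ler_wpM2r ?expR_ge0.
Qed.

(* The zeros of the [h i] in a large square number at most [S r], so some radius
   stays at distance [r / (2 (S r + 1))] from all of them. *)
Lemma good_squares p m (h : 'I_m -> C -> C) :
  (forall i, hol (h i)) -> (forall i, h i 0 != 0) -> (forall i, growth p.+1 (h i)) ->
  exists2 b, bnd p b & forall r, 1 <= r -> exists2 s, r <= s <= 2 * r &
    forall i z, sqn z = s -> [/\ h i z != 0,
      normc (D (h i) z) <= b r * normc (h i z) & expR (- b r) <= normc (h i z)].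
Proof.
move=> hh h0 hg; have [k k1 Zk] := zeros_and_bounds.
have [N HN] := natr_gt (18 * k).
have /choice [K HK] : forall i, exists K, (2 <= K)%N /\ forall r, 1 <= r ->
    forall z, sqn z <= r -> normc (h i z) <= expR (iexp p (scale K r)).
  move=> i; have [b [K K2 Hb] hb] := hg i; exists K; split=> // r r1 z zr.
  by apply: le_trans (hb r r1 z zr) _; exact: Hb.
pose c i : R := ln 8 + `|ln (normc (h i 0))| + 1.
have c0 i : 0 <= c i.
  have : 0 <= ln 8 :> R by apply: ln_ge0; rewrite ler1n.
  have := normr_ge0 (ln (normc (h i 0))); rewrite /c; lra.
pose E i r := iexp p (scale (K i) (N.+1%:R * r)).
pose A i r := E i r + c i.
have E0 i r : 1 <= r -> 0 <= E i r.
  move=> r1; apply: le_trans (iexp_ge _ _); rewrite /scale exprn_ge0 // mulr_ge0 //.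
  by rewrite mulr_ge0 //; lra.
have A0 i r : 1 <= r -> 0 <= A i r by move=> r1; rewrite /A addr_ge0 ?E0.
have Ab i : bnd p (A i).
  apply: bndD; last exact: bnd_cst.
  apply: (@bnd_dil _ p (fun r => iexp p (scale (K i) r)) N.+1) => //.
  by exists (K i) => //; exact: (HK i).1.
pose S r := \sum_(i < m) A i r.
have Sb : bnd p S by exact: bnd_sum.
have S0 r : 1 <= r -> 0 <= S r by move=> r1; apply: sumr_ge0 => i _; exact: A0.
have AS i r : 1 <= r -> A i r <= S r.
  by move=> r1; rewrite /S (bigD1 i) //= lerDl; apply: sumr_ge0 => j _; exact: A0.
pose T r := \sum_(i < m) `|ln (normc (h i 0))|.
(* The first summand bounds the logarithmic derivative: number of zeros over distance, plus k A / q
   <= S. The others bound minus the logarithm of |h|: [T] for the value at 0, 2 S for the cofactor,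
   and the last for the factors e / (2 q) = 1 / (8 k (n + 1)), at most [S r] many. *)
pose b r := S r * (2 * (S r + 1) + 1) + (T r + 2 * S r + S r * (8 * k * (S r + 1))).
have cstb x : bnd p (fun=> x) := bnd_cst p x.
have S1b : bnd p (fun r => S r + 1) by apply: bndD.
have S10 r : 1 <= r -> 0 <= S r + 1 by move=> r1; rewrite addr_ge0 // S0.
have ZS (x : R) : 0 <= x -> bnd p (fun r => x * (S r + 1)).
  by move=> x0; apply: (@bndM _ p (fun=> x) (fun r => S r + 1)).
exists b.
  apply: bndD; last apply: bndD.
  - apply: (@bndM _ p S (fun r => 2 * (S r + 1) + 1)) => //.
      by move=> r r1; rewrite addr_ge0 // mulr_ge0 // S10.
    by apply: bndD => //; exact: ZS.
  - apply: bndD; first exact: bnd_cst.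
    exact: (@bndM _ p (fun=> 2) S).
  - apply: (@bndM _ p S (fun r => 8 * k * (S r + 1))) => //.
      by move=> r r1; rewrite mulr_ge0 ?S10 //; lra.
    by apply: ZS; lra.
move=> r r1; have r0 : 0 < r by lra.
(* A radius s <= 2 r then satisfies s <= q / k, and 9 q = 18 k r is within the dilation [N.+1]. *)
pose q := 2 * k * r.
have q0 : 0 < q by rewrite mulr_gt0 //; lra.
have hE i z : sqn z = 9 * q -> normc (h i z) <= expR (E i r).
  have N1 : N%:R <= N.+1%:R :> R by rewrite ler_nat.
  move=> zq; apply: (HK i).2; last by rewrite zq /q; nra.
  have : 1 <= N.+1%:R :> R by rewrite ler1n.
  nra.
have /choice [l Hl] : forall i, exists l, (size l)%:R <= A i r /\
    forall z e, sqn z <= q / k -> 0 < e -> (forall a, a \in l -> e <= normc (z - a)) ->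
    [/\ h i z != 0,
        normc (D (h i) z) <= ((size l)%:R / e + k * A i r / q) * normc (h i z) &
        e ^+ size l * ((normc (h i 0) / (2 * q) ^+ size l) * expR (- (2 * A i r)))
          <= normc (h i z)].
  by move=> i; exact: (Zk _ _ _ (hh i) (h0 i) q0 (E0 i r r1) (hE i)).
pose L := flatten [seq [seq sqn a | a <- l i] | i <- enum 'I_m].
have LS : (size L)%:R <= S r.
  rewrite /L size_flatten /shape -map_comp sumnE big_map natr_sum big_enum /=.
  by apply: ler_sum => i _; rewrite size_map; exact: (Hl i).1.
have LL i a : a \in l i -> sqn a \in L.
  move=> al; apply/flattenP; exists [seq sqn a | a <- l i]; last by rewrite map_f.
  by apply/mapP; exists i; rewrite ?mem_enum.
have [s /andP[rs sr] Hs] := avoid_radius L r0.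
exists s => [|i z zs]; first by rewrite rs.
pose n := size L; pose e := r / (2 * n.+1%:R).
have n0 : 0 < n.+1%:R :> R by rewrite ltr0n.
have e0 : 0 < e by rewrite divr_gt0 // mulr_gt0.
have nS : n.+1%:R <= S r + 1 by rewrite -natr1 lerD2r.
have [||h1 h2 h3] := (Hl i).2 z e _ e0.
- by rewrite zs /q mulrAC mulfK ?gt_eqF //; lra.
- move=> a /LL /Hs; rewrite -/n -/e => he; apply: le_trans he _.
  apply: le_trans (sqn_le_normc _); rewrite -zs ler_norml.
  have := sqn_triB z a; have := sqn_triB a z; rewrite sqnB; lra.
have lA := (Hl i).1; have AiS := AS i r r1; have Ai0 := A0 i r r1.
have Sr0 := S0 r r1.
have T0 : 0 <= T r by apply: sumr_ge0.
have SS0 : 0 <= S r * (S r + 1) by rewrite mulr_ge0 // addr_ge0.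
split=> //.
- apply: le_trans h2 _; rewrite ler_wpM2r ?normc_ge0 //.
  have k3 : (size (l i))%:R / e <= S r * (2 * (S r + 1)).
    have ei : e^-1 <= 2 * (S r + 1).
      rewrite /e invf_div ler_pdivrMr //.
      have : 0 <= (S r + 1) * (r - 1) by rewrite mulr_ge0 //; lra.
      lra.
    by apply: ler_pM => //; rewrite ?invr_ge0 ?(ltW e0) //; exact: le_trans AiS.
  have k4 : k * A i r / q <= S r.
    rewrite ler_pdivrMr // /q.
    have : 0 <= k * A i r * (2 * r - 1) by rewrite !mulr_ge0 //; lra.
    have : 0 <= (S r - A i r) * (2 * k * r) by rewrite !mulr_ge0 //; lra.
    lra.
  have : 0 <= S r * (8 * k * (S r + 1)).
    by rewrite mulr_ge0 // mulr_ge0 ?S10 //; lra.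
  move: k3 k4; rewrite /b; set u := _ / e; set v := _ / q.
  rewrite [S r * (_ + 1)]mulrDr mulr1; set x1 := S r * _; set x2 := S r * _; lra.
- apply: le_trans h3.
  have -> : e ^+ size (l i) * ((normc (h i 0) / (2 * q) ^+ size (l i)) * expR (- (2 * A i r))) =
     normc (h i 0) * (((8 * k * n.+1%:R)^-1) ^+ size (l i) * expR (- (2 * A i r))).
    have -> : (8 * k * n.+1%:R)^-1 = e / (2 * q).
      by rewrite /e /q; field; rewrite !gt_eqF //; lra.
    have gen (u v x y : R) : u * ((x / v) * y) = x * ((u / v) * y) by ring.
    by rewrite [(e / _) ^+ _]expr_div_n gen.
  have nh : 0 < normc (h i 0) by rewrite normc_gt0.
  have t1 : expR (- T r) <= normc (h i 0).
    rewrite -[leRHS](lnK nh) ler_expR lerNl; apply: (@le_trans _ _ `|ln (normc (h i 0))|).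
      by rewrite -normrN ler_norm.
    by rewrite /T (bigD1 i) //= lerDl; apply: sumr_ge0.
  have t2 : expR (- (S r * (8 * k * (S r + 1)))) <= (8 * k * n.+1%:R)^-1 ^+ size (l i).
    have k8 : 0 < 8 * k by lra.
    have u0 : 0 < 8 * k * n.+1%:R :> R by rewrite mulr_gt0.
    apply: (@le_trans _ _ (expR (- (8 * k * n.+1%:R)) ^+ size (l i))).
      rewrite -expRM_natl ler_expR mulrN lerN2; apply: ler_pM => //.
      - exact: ltW.
      - exact: le_trans AiS.
      - by rewrite ler_pM2l.
    apply: lerXn2r; rewrite ?nnegrE ?expR_ge0 ?invr_ge0 ?(ltW u0) //.
    rewrite expRN lef_pV2 ?posrE ?expR_gt0 //.
    by have := expR_ge1Dx (8 * k * n.+1%:R : R); lra.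
  have t3 : expR (- (2 * S r)) <= expR (- (2 * A i r)) by rewrite ler_expR; lra.
  apply: (@le_trans _ _ (expR (- T r) * (expR (- (S r * (8 * k * (S r + 1)))) * expR (- (2 * S r))))).
    rewrite -!expRD ler_expR /b; lra.
  apply: ler_pM; rewrite ?mulr_ge0 ?expR_ge0 //.
  by apply: ler_pM; rewrite ?expR_ge0.
Qed.

End GoodSquares.

(** * Descent in the growth classes *)

Section Quotients.
Context {R : realType}.
Local Notation C := R[i].
Local Notation D f := (derive1 ((f : C -> C) : C^o -> C^o)).
Implicit Types (r s t x y M : R) (f g h w E A B X Y U V : C -> C) (z a d : C).

Lemma hol_mul_neq0 f g : hol f -> hol g -> (exists a, f a != 0) -> (exists a, g a != 0) ->
  exists a, f a * g a != 0.
Proof.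
move=> fh gh [a fa] [b gb]; apply: contrapT => /forallNP H.
have [|f0|g0] := hol_mul_eq0 fh gh.
- by move=> z; apply/eqP; apply: contrapT => /negP /H.
- by rewrite f0 eqxx in fa.
- by rewrite g0 eqxx in gb.
Qed.

(** [good_squares] is centred at a point where no function of the family vanishes; the product of
    the family is not identically 0, so there is one. *)
Lemma hol_neq0_common m (h : 'I_m -> C -> C) : (forall i, hol (h i)) ->
  (forall i, exists a, h i a != 0) -> exists a, forall i, h i a != 0.
Proof.
move=> hh h0; suff [P [_ [a Pa] /(_ a Pa)]] : exists P, [/\ hol P, exists a, P a != 0 &
    forall z, P z != 0 -> forall i, h i z != 0] by exists a.
elim: m h hh h0 => [|m IH] h hh h0.
  exists (fun=> 1); split; first exact: hol_cst; first by exists 0; rewrite oner_neq0.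
  by move=> z _ [].
have [i|i|P [Ph P0 HP]] := IH (fun i => h (lift ord0 i)); [exact: hh|exact: h0|].
exists (fun z => h ord0 z * P z); split; [exact: holM|exact: hol_mul_neq0|].
move=> z; rewrite mulf_eq0 negb_or => /andP[h0z Pz] i.
by have [j ->|->] := unliftP ord0 i; [exact: HP|].
Qed.

Lemma good_squares_at p m (h : 'I_m -> C -> C) : (forall i, hol (h i)) ->
  (forall i, exists a, h i a != 0) -> (forall i, growth p.+1 (h i)) ->
  exists a b, [/\ bnd p b, forall r, 0 <= b r &
    forall r, 1 <= r -> exists2 s, r <= s <= 2 * r &
    forall i z, sqn (z - a) = s -> [/\ h i z != 0,
      normc (D (h i) z) <= b r * normc (h i z) & expR (- b r) <= normc (h i z)]].
Proof.
move=> hh h0 hp; have [a ha] := hol_neq0_common hh h0.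
have [i|i|i|b pb Hb] := @good_squares _ p m (fun i z => h i (z + a)).
- exact: hol_shift.
- by rewrite add0r.
- exact: growth_shift.
exists a, (fun r => Num.max 0 (b r)); split.
- by apply: bnd_max => //; exact: bnd_cst.
- by move=> r; rewrite le_max lexx.
move=> r r1; have [s rs Hs] := Hb r r1; exists s => // i z /Hs -/(_ i).
rewrite D_shift // subrK => -[h1 h2 h3].
have bb : b r <= Num.max 0 (b r) by rewrite le_max lexx orbT.
split=> //; first by apply: le_trans h2 _; rewrite ler_wpM2r ?normc_ge0.
by apply: le_trans h3; rewrite ler_expR lerN2.
Qed.

Lemma growth_squares_at p f a b : hol f -> bnd p b ->
  (forall r, 1 <= r -> exists2 s, r <= s & forall z, sqn (z - a) = s -> normc (f z) <= b r) ->
  growth p f.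
Proof.
move=> fh pb H.
apply: (@growth_ext _ p (fun z => f (z - a + a))) => [z|]; first by rewrite subrK.
apply: (@growth_shift _ p (fun z => f (z + a)) (- a)).
apply: growth_squares pb _ => [|r r1]; first exact: hol_shift.
by have [s rs Hs] := H r r1; exists s => // z zs; apply: Hs; rewrite addrK.
Qed.

Lemma growth_at p f a : growth p f -> exists b, [/\ bnd p b, forall r, 1 <= r -> 0 <= b r &
  forall r, 1 <= r -> forall z, sqn (z - a) <= 2 * r -> normc (f z) <= b r].
Proof.
move=> /(growth_shift a) [b pb Hb]; exists (fun r => b (2%:R * r)); split.
- exact: bnd_dil.
- by move=> r r1; apply: (growth_ge0 Hb); lra.
- move=> r r1 z zr; rewrite -(subrK a z); apply: Hb zr; lra.
Qed.

Lemma D0 f z : (forall a, f a = 0) -> D f z = 0.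
Proof. by move=> /funext ->; apply: cdiff_D; exact: cdiff_cst. Qed.

Lemma growth_log_derivative p X Y : hol X -> hol Y -> growth p.+1 X ->
  growth p (fun z => X z * Y z) -> growth p (fun z => (D X z : C) * Y z).
Proof.
move=> Xh Yh Xg XY; have [X0|/forallNP X0] := pselect (exists a, X a != 0); last first.
  apply: growth_ext (growth_cst p 0) => z; rewrite D0 ?mul0r // => w.
  by apply/eqP; apply: contrapT => /negP /X0.
have [//|//|//|a [b [pb b0 Hb]]] := @good_squares_at p 1 (fun=> X).
have [c [pc c0 Hc]] := growth_at a XY.
apply: (@growth_squares_at _ _ a (fun r => b r * c r)); first by apply: holM => //; exact: hol_D.
  by apply: bndM => // r _; exact: b0.
move=> r r1; have [s /andP[rs sr] Hs] := Hb r r1; exists s => // z zs.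
have [_ h _] := Hs ord0 z zs; rewrite normcM.
apply: (@le_trans _ _ (b r * normc (X z * Y z))).
  by rewrite normcM mulrA ler_wpM2r ?normc_ge0.
by apply: ler_wpM2l => //; apply: Hc => //; rewrite zs.
Qed.

Definition Dn n f : C -> C := iter n (fun g : C -> C => D g) f.

Lemma hol_Dn n f : hol f -> hol (Dn n f).
Proof. by move=> fh; elim: n => [//|n IH]; exact: hol_D. Qed.

Lemma growth_Dn p n f : hol f -> growth p f -> growth p (Dn n f).
Proof. by move=> fh fp; elim: n => [//|n IH]; apply: growth_D => //; exact: hol_Dn. Qed.

(* A derivative that vanishes identically is replaced by the constant 1, so that
   a single family of squares controls all the quotients of consecutive
   derivatives. *)
Lemma growth_linear_quotient p k (c : 'I_k -> C) h w : hol h -> hol w ->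
  growth p.+1 h -> (exists a, h a != 0) ->
  (forall z, w z * h z = \sum_(j < k) c j * Dn j.+1 h z) -> growth p w.
Proof.
move=> hh wh hg h0 wE.
have /choice [g Hg] : forall i : 'I_k.+1, exists g,
    [/\ hol g, exists a, g a != 0, growth p.+1 g & (forall z, Dn i h z = 0) \/ g = Dn i h].
  move=> i.
  have [X0|/forallNP X0] := pselect (exists a, Dn i h a != 0).
    by exists (Dn i h); split=> //; [exact: hol_Dn|exact: growth_Dn|right].
  exists (fun=> 1); split; first exact: hol_cst.
  - by exists 0; rewrite oner_neq0.
  - exact: growth_cst.
  - by left=> z; apply/eqP; apply: contrapT => /negP /X0.
have [i|i|i|a [b [pb b0 Hb]]] := @good_squares_at p k.+1 g; try by have [] := Hg i.
apply: (@growth_squares_at _ _ a (fun r => \sum_(j < k) normc (c j) * b r ^+ j.+1)) => //.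
  apply: (@bnd_sum _ p k (fun j r => normc (c j) * b r ^+ j.+1)) => j.
  apply: bndM => [r _|r _||]; rewrite ?normc_ge0 ?exprn_ge0 //; first exact: bnd_cst.
  by apply: bndX => // r _.
move=> r r1; have [s /andP[rs sr] Hs] := Hb r r1; exists s => // z zs.
have hz : h z != 0.
  have [_ _ _ [H|E]] := Hg ord0; first by have [b' /eqP[]] := h0; exact: H.
  by have [] := Hs ord0 z zs; rewrite E.
have step j : (j <= k)%N -> normc (Dn j.+1 h z) <= b r * normc (Dn j h z).
  rewrite -ltnS => jk; have [_ _ _ [H|E]] := Hg (Ordinal jk).
    have -> : Dn j.+1 h z = 0 by exact: D0.
    by rewrite normc0 mulr_ge0 ?normc_ge0.
  by have [_ + _] := Hs (Ordinal jk) z zs; rewrite E.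
have pow j : (j <= k)%N -> normc (Dn j h z) <= b r ^+ j * normc (h z).
  elim: j => [|j IH] jk; first by rewrite expr0 mul1r.
  apply: le_trans (step j (ltnW jk)) _; rewrite exprS -mulrA ler_wpM2l //.
  exact: IH (ltnW jk).
have n0 : 0 < normc (h z) by rewrite normc_gt0.
rewrite -(ler_pM2r n0) -normcM wE; apply: le_trans (normc_sum _ _) _.
rewrite mulr_suml; apply: ler_sum => j _; rewrite normcM -mulrA.
by rewrite ler_wpM2l ?normc_ge0 // pow.
Qed.

(** Far from the roots every linear factor has modulus at least 1, so the leading coefficient bounds
    the polynomial below. *)
Lemma polynomial_lower_bound B : is_polynomial B -> (exists a, B a != 0) ->
  exists N (c : R), 0 < c /\ forall z, N%:R <= sqn z -> c <= normc (B z).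
Proof.
move=> [q Bq] [a Ba]; have [l ql] := closed_field_poly_normal q.
have q0 : lead_coef q != 0.
  by rewrite lead_coef_eq0; apply: contraNneq Ba => q0; rewrite Bq q0 horner0.
have [N HN] : exists N, forall x : C, x \in (l : seq C) -> sqn x + 1 <= N%:R.
  elim: l {ql} => [|x l [N HN]]; first by exists 0%N.
  have [n Hn] := natr_gt (sqn x + 1); exists (n + N)%N => y.
  rewrite inE natrD => /orP[/eqP ->|/HN h].
    by have : 0 <= N%:R :> R by []; lra.
  by have : 0 <= n%:R :> R by []; lra.
exists N, (normc (lead_coef q)); split=> [|z zN]; first by rewrite normc_gt0.
rewrite Bq [q in q.[z]]ql hornerZ horner_prod normcM ler_peMr ?normc_ge0 //.
elim: l {ql} HN => [|x l IH] HN; first by rewrite big_nil normc1.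
rewrite big_cons normcM -[leLHS]mulr1; apply: ler_pM => //.
  rewrite hornerXsubC; apply: le_trans (sqn_le_normc _).
  by have := HN x (mem_head _ _); have := sqn_triB z x; lra.
by apply: IH => y yl; apply: HN; rewrite inE yl orbT.
Qed.

(** For [p.+1], good squares give |B| >= exp (- b) with [b] of class [p], and exp b is again of
    class [p.+1]. Class 0 lies below the reach of good squares, but there [B] is a polynomial. *)
Lemma growth_quotient p E A B : hol E -> hol B -> growth p A -> growth p B ->
  (exists a, B a != 0) -> (forall z, E z * B z = A z) -> growth p E.
Proof.
case: p => [|p] Eh Bh Ag Bg B0 EB.
  have [N [c [c0 Hc]]] := polynomial_lower_bound (growth0_polynomial Bh Bg) B0.
  have [b pb Hb] := Ag.
  apply: (@growth_squares _ 0 E (fun r => c^-1 * b (N.+1%:R * r))) => //.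
    apply: bndM; [|move=> r r1|exact: bnd_cst|exact: bnd_dil].
      by move=> r _; rewrite invr_ge0 ltW.
    apply: (growth_ge0 Hb); have : 1 <= N.+1%:R :> R by rewrite ler1n.
    by move=> h; apply: le_trans h _; rewrite ler_peMr.
  move=> r r1; have N1 : 1 <= N.+1%:R :> R by rewrite ler1n.
  exists (N.+1%:R * r) => [|z zr]; first by rewrite ler_peMl //; lra.
  have : c <= normc (B z).
    apply: Hc; rewrite zr; apply: (@le_trans _ _ N.+1%:R); first by rewrite ler_nat.
    by rewrite ler_peMr.
  have : normc (E z) * normc (B z) <= b (N.+1%:R * r).
    rewrite -normcM EB; apply: Hb; rewrite ?zr //.
    by apply: le_trans N1 _; rewrite ler_peMr.
  move=> h1 h2; rewrite mulrC ler_pdivlMr //; apply: le_trans h1.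
  by rewrite ler_wpM2l ?normc_ge0.
have [//|//|//|a [b [pb b0 Hb]]] := @good_squares_at p 1 (fun=> B).
have [c [pc c0 Hc]] := growth_at a Ag.
apply: (@growth_squares_at _ _ a (fun r => expR (b r) * c r)) => //.
  apply: bndM => [r _|//||//]; [exact: expR_ge0|exact: bnd_exp].
move=> r r1; have [s /andP[rs sr] Hs] := Hb r r1; exists s => // z zs.
have [_ _ h] := Hs ord0 z zs.
rewrite -ler_pdivrMl ?expR_gt0 // -expRN mulrC.
apply: (@le_trans _ _ (normc (A z))); last by apply: Hc; rewrite ?zs.
by rewrite -EB normcM ler_wpM2l ?normc_ge0.
Qed.

Lemma growth_root p X : growth p (fun z => X z * X z) -> growth p X.
Proof.
move=> [b pb Hb]; exists (fun r => 1 + b r); first by apply: bndD => //; exact: bnd_cst.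
move=> r r1 z zr; have := Hb r r1 z zr; rewrite normcM.
have := normc_ge0 (X z); nra.
Qed.

(** This is the rule (x - u)' = x' - u', each derivative replaced by its logarithmic derivative
    times the function, after multiplication by w w' (w' - w). *)
Lemma borel_identity (K : comNzRingType) (x y u v z w w' x' u' : K) :
  x * y = - w' -> u * v = - w -> (x - u) * z = w' - w ->
  x * (w * (x' * y * (w' - w) + (x' - u') * z * w')) =
  u * (w' * (u' * v * (w' - w) + (x' - u') * z * w)).
Proof.
move=> xy uv xuz; apply/eqP; rewrite -subr_eq0; apply/eqP.
have <- : w * w' * (x' - u') * ((x - u) * z - (w' - w)) = 0 by rewrite xuz subrr mulr0.
have -> : w' = - (x * y) by rewrite xy opprK.
have -> : w = - (u * v) by rewrite uv opprK.
by ring.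
Qed.

(** The degenerate case: if both coefficients vanish, [g] is eliminated between the two equations
    and the Wronskian of x and u remains. *)
Lemma borel_identity2 (K : comNzRingType) (x y u v g w w' x' u' : K) :
  x * y = - w' -> u * v = - w ->
  x' * y * (w' - w) + g * w' = 0 -> u' * v * (w' - w) + g * w = 0 ->
  w * w' * (w' - w) * (x' * u - x * u') = 0.
Proof.
move=> xy uv A0 B0; transitivity (x * u * (w' * (u' * v * (w' - w) + g * w)
    - w * (x' * y * (w' - w) + g * w'))); last by rewrite A0 B0 !mulr0 subr0 mulr0.
have -> : w' = - (x * y) by rewrite xy opprK.
have -> : w = - (u * v) by rewrite uv opprK.
by ring.
Qed.

(* With [al = X' Y], [be = U' V] and [ga = (X - U)' Z], the relations
   [W' X' = - al X], [W U' = - be U] and [(W' - W) (X - U)' = ga (X - U)] turn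
   [(X - U)' = X' - U'] into a linear relation between [X] and [U] whose
   coefficients grow more slowly. *)
Lemma borel_relation p X Y U V Z (W W' : C -> C) :
  hol X -> hol Y -> hol U -> hol V -> hol Z -> hol W -> hol W' ->
  growth p.+1 X -> growth p.+1 U -> growth p W -> growth p W' ->
  (exists a, W a != 0) -> (exists a, W' a != 0) -> (exists a, W' a - W a != 0) ->
  (forall z, X z * Y z = - W' z) -> (forall z, U z * V z = - W z) ->
  (forall z, (X z - U z) * Z z = W' z - W z) ->
  exists A B, [/\ hol A /\ hol B, growth p A, growth p B, exists a, A a != 0 &
    forall z, X z * A z = U z * B z].
Proof.
move=> Xh Yh Uh Vh Zh Wh W'h Xg Ug Wg W'g W0 W'0 d0 XY UV XUZ.
pose al z : C := (D X z : C) * Y z; pose be z : C := (D U z : C) * V z.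
pose ga z : C := (D (fun z => X z - U z) z : C) * Z z.
have Tg : growth p (fun z => W' z - W z) by exact: growthB.
have DE z : D (fun z => X z - U z) z = D X z - D U z.
  by apply: cdiff_D; apply: cdiffB; exact: hol_cdiff.
have alg : growth p al.
  by apply: growth_log_derivative => //; apply: growth_ext (growthN W'g) => z; rewrite XY.
have beg : growth p be.
  by apply: growth_log_derivative => //; apply: growth_ext (growthN Wg) => z; rewrite UV.
have gag : growth p ga.
  apply: growth_log_derivative => //; [exact: holB|exact: growthB|].
  by apply: growth_ext Tg => z; rewrite XUZ.
have alh : hol al by apply: holM => //; exact: hol_D.
have beh : hol be by apply: holM => //; exact: hol_D.
have gah : hol ga by apply: holM => //; apply: hol_D; exact: holB.
have Th : hol (fun z => W' z - W z) by exact: holB.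
pose A1 z : C := al z * (W' z - W z) + ga z * W' z.
pose B1 z : C := be z * (W' z - W z) + ga z * W z.
have A1h : hol A1 by apply: holD; exact: holM.
have B1h : hol B1 by apply: holD; exact: holM.
have key z : X z * (W z * A1 z) = U z * (W' z * B1 z).
  by rewrite /A1 /B1 /al /be /ga DE; apply: borel_identity.
have [A10|/forallNP A10] := pselect (exists a, A1 a != 0).
  exists (fun z => W z * A1 z), (fun z => W' z * B1 z); split=> //.
  - by split; exact: holM.
  - by apply: growthM => //; apply: growthD; exact: growthM.
  - by apply: growthM => //; apply: growthD; exact: growthM.
  - exact: hol_mul_neq0.
(* Otherwise [A1] vanishes identically, hence [B1] too; then the Wronskian of [X] and [U] is 0, and
   the relation holds with constant coefficients. *)
have A1z z : A1 z = 0 by apply/eqP; apply: contrapT => /negP /A10.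
have U0 : exists a, U a != 0.
  by have [a Wa] := W0; exists a; apply: contra_neq Wa => Ua; rewrite -[W a]opprK -UV Ua mul0r oppr0.
have B1z z : B1 z = 0.
  have [|||H|H] := @hol_mul_eq0 R (fun z => U z * W' z) B1.
  - exact: holM.
  - exact: B1h.
  - by move=> x; rewrite -mulrA -key A1z !mulr0.
  - by have [a /eqP[]] := hol_mul_neq0 Uh W'h U0 W'0; exact: H.
  - exact: H.
have XU z : D X z * U z = X z * D U z.
  have [|||H|H] := @hol_mul_eq0 R (fun z => (W z * W' z) * (W' z - W z))
    (fun z => D X z * U z - X z * D U z).
  - by apply: holM => //; exact: holM.
  - by apply: holB; apply: holM => //; exact: hol_D.
  - move=> w; apply: (borel_identity2 (g := ga w) (XY w) (UV w)); [exact: A1z|exact: B1z].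
  - have [a Ha] := hol_mul_neq0 (holM Wh W'h) Th (hol_mul_neq0 Wh W'h W0 W'0) d0.
    by rewrite (H a) eqxx in Ha.
  - by apply/eqP; rewrite -subr_eq0 (H z).
have [a Ua] := U0.
exists (fun=> 1), (fun=> X a / U a); split; try exact: growth_cst.
- by split; exact: hol_cst.
- by exists 0; rewrite oner_neq0.
- by move=> z; rewrite mulr1 mulrC; exact: hol_proportional.
Qed.

(** The hypotheses are symmetric in [U] and [V], so [borel_relation] applies twice, and in the
    product of the two relations U V is known to be - W. *)
Lemma borel_descent p X Y U V (W W' : C -> C) :
  hol X -> hol Y -> hol U -> hol V -> hol W -> hol W' ->
  growth p.+1 X -> growth p.+1 U -> growth p.+1 V -> growth p W -> growth p W' ->
  (exists a, W a != 0) -> (exists a, W' a != 0) -> (exists a, W' a - W a != 0) ->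
  (forall z, X z * Y z = - W' z) -> (forall z, U z * V z = - W z) ->
  (forall z, (X z - U z) * (X z - V z) = W' z - W z) ->
  growth p U /\ growth p V.
Proof.
move=> Xh Yh Uh Vh Wh W'h Xg Ug Vg Wg W'g W0 W'0 d0 XY UV XUV.
have [|A [B [[Ah Bh] Ag Bg A0 AB]]] := borel_relation Xh Yh Uh Vh (holB Xh Vh) Wh W'h
  Xg Ug Wg W'g W0 W'0 d0 XY UV; first exact: XUV.
have [z|z|A2 [B2 [[A2h B2h] A2g B2g A20 AB2]]] := borel_relation Xh Yh Vh Uh (holB Xh Uh) Wh W'h
  Xg Vg Wg W'g W0 W'0 d0 XY; first by rewrite mulrC UV.
  by rewrite mulrC XUV.
have X0 : exists a, X a != 0.
  have [a Wa] := W'0; exists a; apply: contra_neq Wa => Xa.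
  by rewrite -[W' a]opprK -XY Xa mul0r oppr0.
have Xp : growth p X.
  apply: growth_root; apply: (growth_quotient (E := fun z => X z * X z)
    (A := fun z => - (W z * (B z * B2 z))) (B := fun z => A z * A2 z)).
  - exact: holM.
  - exact: holM.
  - by apply: growthN; apply: growthM => //; exact: growthM.
  - exact: growthM.
  - exact: hol_mul_neq0.
  - move=> z; have -> : X z * X z * (A z * A2 z) = (X z * A z) * (X z * A2 z) by ring.
    by rewrite AB AB2 -mulNr -UV; ring.
have neq0 A' B' T : hol A' -> (exists a, A' a != 0) -> (forall z, X z * A' z = T z * B' z) ->
    exists a, B' a != 0.
  move=> A'h A'0 H; have [a Ha] := hol_mul_neq0 Xh A'h X0 A'0.
  by exists a; apply: contra_neq Ha => Ba; rewrite H Ba mulr0.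
split.
- apply: (growth_quotient Uh Bh (growthM Xp Ag)) => //; exact: neq0 AB.
- apply: (growth_quotient Vh B2h (growthM Xp A2g)) => //; exact: neq0 AB2.
Qed.

End Quotients.

(** * One descent step for the cubic equation *)

Section CubicDifference.
Context {R : realType}.
Local Notation C := R[i].
Local Notation D f := (derive1 ((f : C -> C) : C^o -> C^o)).
Implicit Types (f g : C -> C) (z c : C) (p n : nat).

Lemma Dn_shift n f c z : hol f -> Dn n (fun x : C => f (x + c)) z = Dn n f (z + c).
Proof.
move=> fh; elim: n z => [//|n IH] z.
have IH' : Dn n (fun x : C => f (x + c)) = fun x => Dn n f (x + c) by apply/funext.
by rewrite /= IH'; apply: D_shift; exact: hol_Dn.
Qed.

Lemma DnB n f g z : hol f -> hol g ->
  Dn n (fun x : C => f x - g x) z = Dn n f z - Dn n g z.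
Proof.
move=> fh gh; elim: n z => [//|n IH] z.
have IH' : Dn n (fun x : C => f x - g x) = fun x => Dn n f x - Dn n g x by apply/funext.
rewrite /= IH'; apply: cdiff_D.
by apply: cdiffB; apply: hol_cdiff; exact: hol_Dn.
Qed.

Lemma cube_root_unity : exists u : C, u ^+ 2 + u + 1 = 0.
Proof.
exists ((- (1 / 2)) +i* (Num.sqrt 3 / 2)).
have s3 : Num.sqrt 3 * Num.sqrt 3 = 3 :> R by rewrite -expr2 sqr_sqrtr.
rewrite expr2; apply/eqP; rewrite eq_complex /=; apply/andP; split; apply/eqP.
  have -> : Num.sqrt 3 / 2 * (Num.sqrt 3 / 2) = 3 / 4 :> R by rewrite mulf_div s3; field.
  by field.
by field.
Qed.

Lemma growth_cubic_descent p f k (a : 'I_k -> C) c : hol f ->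
  (forall z, f (z + c) ^+ 3 + \sum_(j < k) a j * Dn j.+1 f (z + c) =
             f z ^+ 3 + \sum_(j < k) a j * Dn j.+1 f z) ->
  ~ periodic f c -> ~ periodic f (2 * c) -> ~ periodic f (3 * c) ->
  growth p.+1 f -> growth p f.
Proof.
move=> fh E n1 n2 n3 fg.
pose f1 z := f (z + c); pose f2 z := f (z + c + c).
have f1h : hol f1 by exact: hol_shift.
have f2h : hol f2 := hol_shift c f1h.
have f1g : growth p.+1 f1 by exact: growth_shift.
have f2g : growth p.+1 f2 := growth_shift c f1g.
pose h z : C := f1 z - f z; pose w z : C := f z ^+ 2 + f z * f1 z + f1 z ^+ 2.
pose w' z : C := f1 z ^+ 2 + f1 z * f2 z + f2 z ^+ 2.
have hh : hol h by exact: holB.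
have wh : hol w by do !apply: holD; [exact: holX|exact: holM|exact: holX].
have w'h : hol w' by do !apply: holD; [exact: holX|exact: holM|exact: holX].
have three (x : C) : x + c + c + c = x + 3 * c by ring.
have two (x : C) : x + c + c = x + 2 * c by ring.
have h0 : exists z, h z != 0.
  apply: contrapT => /forallNP H; apply: n1 => z.
  by apply/eqP; rewrite -subr_eq0; apply: contrapT => /negP /H.
have [u uE] := cube_root_unity.
have u3 : u ^+ 3 = 1.
  (* Here and below, an identity modulo [u ^+ 2 + u + 1 = 0] is checked by exhibiting the cofactor
     of that polynomial. *)
  by apply/eqP; rewrite -subr_eq0; apply/eqP; rewrite -[RHS](mulr0 (u - 1)) -uE; ring.
(* Applying f = t f1 three times gives f(z) = t^3 f(z + 3 c). *)
have rot t : t ^+ 3 = 1 -> ~ (forall z, f z = t * f1 z).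
  move=> t3 H; apply: n3 => z; rewrite -three.
  rewrite [RHS]H /f1 [f (z + c)]H /f1 [f (z + c + c)]H /f1.
  by rewrite !mulrA -expr2 -exprSr t3 mul1r.
(* [w] factors as (f - u f1)(f - u^2 f1), so its vanishing forces one of the relations excluded by
   [rot]. *)
have w0 : exists z, w z != 0.
  apply: contrapT => /forallNP H.
  have [|||H1|H1] := @hol_mul_eq0 R (fun z => f z - u * f1 z) (fun z => f z - u ^+ 2 * f1 z).
  - by apply: holB => //; exact: holZ.
  - by apply: holB => //; exact: holZ.
  - move=> z; have <- : w z = 0 by apply/eqP; apply: contrapT => /negP /H.
    apply/eqP; rewrite -subr_eq0; apply/eqP.
    rewrite -[RHS](mulr0 ((u - 1) * f1 z ^+ 2 - f z * f1 z)) -uE /w; ring.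
  - apply: (rot u u3) => z; apply/eqP; rewrite -subr_eq0; exact/eqP.
  - apply: (rot (u ^+ 2)) => [|z]; first by rewrite -exprM mulnC exprM u3 expr1n.
    by apply/eqP; rewrite -subr_eq0; exact/eqP.
have w'0 : exists z, w' z != 0.
  by have [z wz] := w0; exists (z - c); rewrite /w' /f2 /f1 subrK.
have d0 : exists z, w' z - w z != 0.
  apply: contrapT => /forallNP H.
  have [|||H1|H1] := @hol_mul_eq0 R (fun z => f2 z - f z) (fun z => f z + f1 z + f2 z).
  - exact: holB.
  - by do !apply: holD.
  - move=> z; have <- : w' z - w z = 0 by apply/eqP; apply: contrapT => /negP /H.
    by rewrite /w /w'; ring.
  - by apply: n2 => z; rewrite -two; apply/eqP; rewrite -subr_eq0; apply/eqP; exact: H1.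
  (* If f + f1 + f2 = 0, the difference of this identity at z + c and at z is f(z + 3 c) = f(z). *)
  - apply: n3 => z; rewrite -three; apply/eqP; rewrite -subr_eq0; apply/eqP.
    rewrite -[RHS](subrr 0) -{1}(H1 (z + c)) -(H1 z) /f2 /f1; ring.
have wE z : w z * h z = \sum_(j < k) (- a j) * Dn j.+1 h z.
  have -> : \sum_(j < k) (- a j) * Dn j.+1 h z =
      \sum_(j < k) a j * Dn j.+1 f z - \sum_(j < k) a j * Dn j.+1 f (z + c).
    rewrite -sumrB; apply: eq_bigr => j _.
    by rewrite (@DnB j.+1 f1 f) // (@Dn_shift j.+1 f c) // mulNr mulrBr opprB.
  have -> : w z * h z = f (z + c) ^+ 3 - f z ^+ 3 by rewrite /w /h /f1; ring.
  by apply/eqP; rewrite subr_eq -addrA [- _ + _]addrC addrA -subr_eq opprK E addrC.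
have wg : growth p w.
  by apply: growth_linear_quotient wE => //; exact: growthB.
have w'g : growth p w'.
  by apply: growth_ext (growth_shift c wg) => z.
have [Ug Vg] : growth p (fun z => f z - u * f1 z) /\ growth p (fun z => u ^+ 2 * f1 z - f z).
  apply: (@borel_descent R p (fun z => u ^+ 2 * f1 z - f2 z) (fun z => f2 z - u * f1 z)
    _ _ w w') => //; try by [apply: holB => //; exact: holZ|apply: growthB => //; exact: growthZ].
  - move=> z; apply/eqP; rewrite -subr_eq0; apply/eqP.
    rewrite -[RHS](mulr0 (f1 z * f2 z - (u - 1) * f1 z ^+ 2)) -uE /w'; ring.
  - move=> z; apply/eqP; rewrite -subr_eq0; apply/eqP.
    rewrite -[RHS](mulr0 (f z * f1 z - (u - 1) * f1 z ^+ 2)) -uE /w; ring.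
  - move=> z; apply/eqP; rewrite -subr_eq0; apply/eqP.
    rewrite -[RHS](mulr0 ((f z - f2 z) * f1 z)) -uE /w /w'; ring.
have u1 : u - 1 != 0.
  rewrite subr_eq0; apply/eqP => uE1; move/eqP: uE.
  rewrite uE1 expr1n; have -> : 1 + 1 + 1 = 3 :> C by ring.
  by rewrite pnatr_eq0.
(* [f] is recovered from u U + V = (u - 1) f. *)
apply: growth_ext (growthZ (u - 1)^-1 (growthD (growthZ u Ug) Vg)) => z.
by field.
Qed.

End CubicDifference.

(** * From finite iterated order to growth classes *)

Section FiniteOrder.
Context {R : realType}.
Local Notation C := R[i].
Implicit Types (f : C -> C) (r x y M : R) (z : C) (p : nat).

(** The default value of [ln] is harmless: for u <= 0 the bound u <= exp v holds anyway. *)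
Lemma iter_ln_le p x y : iter p.+1 (@ln R) x <= y -> x <= iexp p.+1 y.
Proof.
have lnE u v : ln u <= v -> u <= expR v :> R.
  have [u0 _|u0 uv] := leP u 0; first by apply: le_trans u0 (expR_ge0 _).
  by rewrite -[leLHS](lnK u0) ler_expR.
elim: p y => [|p IH] y /lnE; first by [].
by move=> /IH; rewrite [X in _ -> _ <= X]/iexp iterSr.
Qed.

Lemma iterated_order_bound p f : (iterated_order p.+1 f < +oo)%E ->
  exists n r0, forall r, r0 <= r -> proximity r f <= iexp p (r ^+ n).
Proof.
rewrite /iterated_order limf_esupE => /ereal_inf_lt [_ [A [r0 [_ Ar]] <-]] supA.
have [M HM] : exists M : R, forall r, A r ->
    iter p.+1 (@ln R) (proximity r f) / ln r <= M.
  case E : (ereal_sup _) supA => [M| |] // _.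
    exists M => r Ar'; rewrite -lee_fin -E; apply: ereal_sup_ubound.
    by exists r.
  (* A supremum equal to -oo is impossible once [A] has a point, so any bound serves. *)
  exists 0 => r Ar'; suff : ((iter p.+1 (@ln R) (proximity r f) / ln r)%:E <= -oo)%E by [].
  by rewrite -E; apply: ereal_sup_ubound; exists r.
(* Beyond radius 3 the logarithm is positive and can be cleared; the innermost exponential then
   becomes exp (M ln r) <= r^n, as M < n. *)
have [n Mn] := natr_gt M; exists n, (Num.max r0 2 + 1) => r rr.
have r0r : r0 < r by have : r0 <= Num.max r0 2 by [rewrite le_max lexx]; lra.
have r2 : 2 < r by have : 2 <= Num.max r0 2 by [rewrite le_max lexx orbT]; lra.
have lr : 0 < ln r by rewrite ln_gt0 //; lra.
have := HM r (Ar r r0r); rewrite ler_pdivrMr // => /iter_ln_le h.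
apply: le_trans h _; rewrite /iexp iterSr; apply: le_iexp.
rewrite -[in leRHS](lnK (_ : r \in Num.pos)) ?posrE; last by lra.
by rewrite -expRM_natl ler_expR ler_wpM2r // ltW.
Qed.

Lemma growth_finite_order p f : hol f -> (iterated_order p.+1 f < +oo)%E -> growth p.+1 f.
Proof.
move=> fh /iterated_order_bound [n [r0 H]].
(* The circle of radius m r is then beyond [r0], and |z| <= 2 r <= m r / 4 as [proximity_max]
   requires. *)
have [m Hm] := natr_gt (Num.max r0 8).
exists (fun r => expR (10 * iexp p ((m%:R * r) ^+ n) + 13)).
  apply/bnd_exp/bndD; last exact: bnd_cst.
  apply: bndM; [by []| |exact: bnd_cst|].
    move=> r r1; apply: le_trans (iexp_ge _ _).
    by rewrite exprn_ge0 // mulr_ge0 //; lra.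
  exists (m + n + 2)%N; first by rewrite leq_addl.
  move=> r r1; apply: le_iexp; rewrite /scale.
  have m1 : 1 <= m%:R * r by have : 8 <= Num.max r0 8 by [rewrite le_max lexx orbT]; nra.
  apply: (@le_trans _ _ ((m%:R * r) ^+ (m + n + 2))).
    by apply: ler_weXn2l => //; rewrite -addnA addnCA leq_addr.
  apply: lerXn2r; rewrite ?nnegrE ?mulr_ge0 //; try lra.
  by rewrite ler_wpM2r ?ler_nat -?addnA ?leq_addr //; lra.
have r8 : 8 <= Num.max r0 8 by rewrite le_max lexx orbT.
have rr0 : r0 <= Num.max r0 8 by rewrite le_max lexx.
move=> r r1 z zr; have mr : m%:R <= m%:R * r by rewrite ler_peMr.
apply: le_trans (@proximity_max _ f (m%:R * r) z fh _ _) _; first by lra.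
  by have := normc_le_sqn z; nra.
by rewrite ler_expR lerD2r ler_pM2l //; apply: H; lra.
Qed.

End FiniteOrder.

Theorem theorem4p1 (R : realType) (f : R[i] -> R[i]) (k : nat)
    (a : 'I_k -> R[i]) (c : R[i]) :
  transcendental_entire f ->
  (1 <= k)%N ->
  c != 0 ->
  periodic (fun z : R[i] => f z ^+ 3 + \sum_(j < k) a j * derive1n j.+1 (f : R[i] -> R[i]^o) z) c ->
  (finiteness_degree f < +oo)%E ->
  [\/ periodic f c, periodic f (2 * c) | periodic f (3 * c)].
Proof.
move=> [/entireP fh fp] _ _ E; rewrite /finiteness_degree.
case: (pselect (is_polynomial f)) => [//|_] /=.
case: (pselect (exists j, has_finite_order f j)) => [[p /asboolP [p0 fo]] _|//].
have {p p0 fo} [p fg] : exists p, growth p f.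
  by case: p p0 fo => // p _ fo; exists p.+1; exact: growth_finite_order.
have [n1|n1] := pselect (periodic f c); first by apply: Or31.
have [n2|n2] := pselect (periodic f (2 * c)); first by apply: Or32.
have [n3|n3] := pselect (periodic f (3 * c)); first by apply: Or33.
exfalso; apply/fp/growth0_polynomial => //.
elim: p fg => [//|p IH] fg; apply: IH.
exact: (@growth_cubic_descent R p f k a c fh E n1 n2 n3 fg).
Qed.
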